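(* Let $W\subset\mathbb H$ be open and let $U$ be a slice Cauchy domain with $\overline U\subset W$. Let $J\in\mathbb S$ and $ds_J=ds(-J)$. (1) If $f$ is left slice hyperholomorphic on $W$, then $\tilde f(q)=\mathcal D f(q)$ is harmonic and $$\tilde f(q)=-\frac1\pi\int_{\partial(U\cap\mathbb C_J)}\mathcal Q_{c,s}(q)^{-1}\,ds_J\,f(s),\qquad q\in U.$$ (2) If $f$ is right slice hyperholomorphic on $W$, then $\tilde f(q)=f(q)\mathcal D$ is harmonic and $$\tilde f(q)=-\frac1\pi\int_{\partial(U\cap\mathbb C_J)}f(s)\,ds_J\,\mathcal Q_{c,s}(q)^{-1},\qquad q\in U.$$ The integrals depend neither on $U$ nor on $J\in\mathbb S$.
   Context: $\mathbb H$ denotes the quaternions; for $q=q_0+\underline q$, $\Re(q)=q_0$, $|q|$ its modulus; $\mathbb S$ is the unit sphere of purely imaginary quaternions and $\mathbb C_J=\{u+Jv:u,v\in\mathbb R\}$. $\mathcal Q_{c,s}(q)^{-1}:=(s^2-2\Re(q)s+|q|^2)^{-1}$. A set is axially symmetric if with $u+Iv$ it contains all $u+Jv$, $J\in\mathbb S$. A slice Cauchy domain is an axially symmetric open set $U$ such that for every $J\in\mathbb S$ the boundary of $U\cap\mathbb C_J$ is a union of finitely many nonintersecting piecewise continuously differentiable Jordan curves; boundary integrals are over the positively oriented boundary, with $ds_J=ds(-J)$. On an axially symmetric open set, $f$ is left (resp. right) slice hyperholomorphic if $f(u+Jv)=\alpha(u,v)+J\beta(u,v)$ (resp. $\alpha(u,v)+\beta(u,v)J$)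 for all $J\in\mathbb S$, with $\alpha,\beta$ $\mathbb H$-valued differentiable, $\alpha(u,-v)=\alpha(u,v)$, $\beta(u,-v)=-\beta(u,v)$, and $\partial_u\alpha-\partial_v\beta=0$, $\partial_v\alpha+\partial_u\beta=0$. The Fueter operator acts as $\mathcal Dg=\partial_{q_0}g+\sum_{i=1}^3e_i\partial_{q_i}g$ and $g\mathcal D=\partial_{q_0}g+\sum_{i=1}^3\partial_{q_i}g\,e_i$.
   Formalization: U is assumed bounded (for the exterior of a closed ball and f(s)=s, Df=-2 but the integral is 0); W is taken axially symmetric; independence of U and J is left as a consequence of the formula. *)

(* Defs.v *)
From Stdlib Require Import Reals Lra List.
From Coquelicot Require Import Coquelicot.
Open Scope R_scope.

Record H := mkH { h0 : R; h1 : R; h2 : R; h3 : R }.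

Definition Hc (q : H) (c : nat) : R :=
  match c with 0%nat => h0 q | 1%nat => h1 q | 2%nat => h2 q | _ => h3 q end.

Definition Hadd (p q : H) : H := mkH (h0 p + h0 q) (h1 p + h1 q) (h2 p + h2 q) (h3 p + h3 q).
Definition Hopp (p : H) : H := mkH (- h0 p) (- h1 p) (- h2 p) (- h3 p).
Definition Hscal (a : R) (p : H) : H := mkH (a * h0 p) (a * h1 p) (a * h2 p) (a * h3 p).
Definition Hreal (a : R) : H := mkH a 0 0 0.
Definition Hmul (a b : H) : H :=
  mkH (h0 a * h0 b - h1 a * h1 b - h2 a * h2 b - h3 a * h3 b)
      (h0 a * h1 b + h1 a * h0 b + h2 a * h3 b - h3 a * h2 b)
      (h0 a * h2 b - h1 a * h3 b + h2 a * h0 b + h3 a * h1 b)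
      (h0 a * h3 b + h1 a * h2 b - h2 a * h1 b + h3 a * h0 b).
Definition Hconj (p : H) : H := mkH (h0 p) (- h1 p) (- h2 p) (- h3 p).
Definition Hnorm2 (p : H) : R := h0 p ^ 2 + h1 p ^ 2 + h2 p ^ 2 + h3 p ^ 2.
Definition Hnorm (p : H) : R := sqrt (Hnorm2 p).
Definition Hinv (p : H) : H := Hscal (/ Hnorm2 p) (Hconj p).
Definition Hre (p : H) : R := h0 p.

Declare Scope H_scope. Delimit Scope H_scope with H.
Infix "+" := Hadd : H_scope.
Infix "*" := Hmul : H_scope.
Notation "- x" := (Hopp x) : H_scope.

Definition He (i : nat) : H :=
  match i with
  | 0%nat => mkH 1 0 0 0 | 1%nat => mkH 0 1 0 0 | 2%nat => mkH 0 0 1 0 | _ => mkH 0 0 0 1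
  end.

Definition in_S (J : H) : Prop := h0 J = 0 /\ Hnorm2 J = 1.

Definition sl (u v : R) (J : H) : H := Hadd (Hreal u) (Hscal v J).

Definition Hdist (p q : H) : R := Hnorm (Hadd p (Hopp q)).
Definition H_open (W : H -> Prop) : Prop :=
  forall q, W q -> exists eps, 0 < eps /\ forall p, Hdist p q < eps -> W p.
Definition H_closure (U : H -> Prop) (q : H) : Prop :=
  forall eps, 0 < eps -> exists p, U p /\ Hdist p q < eps.
Definition H_bounded (U : H -> Prop) : Prop :=
  exists M, forall q, U q -> Hnorm q <= M.
Definition H_cont_at (g : H -> R) (q : H) : Prop :=
  forall eps, 0 < eps -> exists del, 0 < del /\
    forall p, Hdist p q < del -> Rabs (g p - g q) < eps.

Definition axially_symmetric (U : H -> Prop) : Prop :=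
  forall u v I J, in_S I -> in_S J -> U (sl u v I) -> U (sl u v J).

Definition Rpartial (i : nat) (g : H -> R) (q : H) : R :=
  Derive (fun t => g (Hadd q (Hscal t (He i)))) 0.
Definition Rpartial_ex (i : nat) (g : H -> R) (q : H) : Prop :=
  ex_derive (fun t => g (Hadd q (Hscal t (He i)))) 0.
Definition Hpartial (i : nat) (f : H -> H) (q : H) : H :=
  mkH (Rpartial i (fun p => h0 (f p)) q) (Rpartial i (fun p => h1 (f p)) q)
      (Rpartial i (fun p => h2 (f p)) q) (Rpartial i (fun p => h3 (f p)) q).

Definition FueterL (f : H -> H) (q : H) : H :=
  Hadd (Hpartial 0 f q)
  (Hadd (Hmul (He 1) (Hpartial 1 f q))
  (Hadd (Hmul (He 2) (Hpartial 2 f q)) (Hmul (He 3) (Hpartial 3 f q)))).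
Definition FueterR (f : H -> H) (q : H) : H :=
  Hadd (Hpartial 0 f q)
  (Hadd (Hmul (Hpartial 1 f q) (He 1))
  (Hadd (Hmul (Hpartial 2 f q) (He 2)) (Hmul (Hpartial 3 f q) (He 3)))).

Definition R_harmonic (W : H -> Prop) (g : H -> R) : Prop :=
  forall q, W q ->
    H_cont_at g q /\
    (forall i j, (i <= 3)%nat -> (j <= 3)%nat ->
       Rpartial_ex i g q /\ H_cont_at (Rpartial i g) q /\
       Rpartial_ex j (Rpartial i g) q /\ H_cont_at (Rpartial j (Rpartial i g)) q) /\
    Rpartial 0 (Rpartial 0 g) q + Rpartial 1 (Rpartial 1 g) q
    + Rpartial 2 (Rpartial 2 g) q + Rpartial 3 (Rpartial 3 g) q = 0.

Definition H_harmonic (W : H -> Prop) (f : H -> H) : Prop :=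
  forall c, (c <= 3)%nat -> R_harmonic W (fun q => Hc (f q) c).

(** the set of (u,v) with u + J v in W (for some, equivalently all, J in S
    when W is axially symmetric) *)
Definition sl_dom (W : H -> Prop) (u v : R) : Prop :=
  exists J, in_S J /\ W (sl u v J).

Definition slice_conditions (W : H -> Prop) (alpha beta : R -> R -> H) : Prop :=
  (forall u v, sl_dom W u v ->
     alpha u (- v) = alpha u v /\ beta u (- v) = Hopp (beta u v)) /\
  (forall u v, sl_dom W u v -> forall c, (c <= 3)%nat ->
     differentiable_pt (fun x y => Hc (alpha x y) c) u v /\
     differentiable_pt (fun x y => Hc (beta x y) c) u v) /\
  (forall u v, sl_dom W u v -> forall c, (c <= 3)%nat ->
     Derive (fun x => Hc (alpha x v) c) u - Derive (fun y => Hc (beta u y) c) v = 0 /\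
     Derive (fun y => Hc (alpha u y) c) v + Derive (fun x => Hc (beta x v) c) u = 0).

Definition left_slice_hyperholomorphic (W : H -> Prop) (f : H -> H) : Prop :=
  axially_symmetric W /\ H_open W /\
  exists alpha beta : R -> R -> H, slice_conditions W alpha beta /\
    forall u v J, in_S J -> W (sl u v J) ->
      f (sl u v J) = Hadd (alpha u v) (Hmul J (beta u v)).

Definition right_slice_hyperholomorphic (W : H -> Prop) (f : H -> H) : Prop :=
  axially_symmetric W /\ H_open W /\
  exists alpha beta : R -> R -> H, slice_conditions W alpha beta /\
    forall u v J, in_S J -> W (sl u v J) ->
      f (sl u v J) = Hadd (alpha u v) (Hmul (beta u v) J).

(** * Curves in C_J, written in the coordinates (u,v) of u + J v *)
Record curve := mkCurve { cu : R -> R; cv : R -> R }.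

Definition jordan (g : curve) : Prop :=
  (forall t, 0 <= t <= 1 -> continuity_pt (cu g) t /\ continuity_pt (cv g) t) /\
  cu g 0 = cu g 1 /\ cv g 0 = cv g 1 /\
  (forall s t, 0 <= s < 1 -> 0 <= t < 1 -> cu g s = cu g t -> cv g s = cv g t -> s = t).

Definition C1_at (h : R -> R) (t : R) : Prop :=
  (exists d, 0 < d /\ forall x, Rabs (x - t) < d -> ex_derive h x) /\
  continuity_pt (Derive h) t.

Definition piecewise_C1 (g : curve) : Prop :=
  exists (n : nat) (tk : nat -> R), tk 0%nat = 0 /\ tk n = 1 /\
    (forall k, (k < n)%nat -> tk k < tk (S k)) /\
    forall k, (k < n)%nat -> exists pu pv : R -> R,
      forall t, tk k <= t <= tk (S k) ->
        pu t = cu g t /\ pv t = cv g t /\ C1_at pu t /\ C1_at pv t.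

Definition on_curve (g : curve) (x y : R) : Prop :=
  exists t, 0 <= t <= 1 /\ cu g t = x /\ cv g t = y.

Definition winding (g : curve) (x y : R) : R :=
  / (2 * PI) * RInt (fun t =>
     ((cu g t - x) * Derive (cv g) t - (cv g t - y) * Derive (cu g) t)
     / ((cu g t - x) ^ 2 + (cv g t - y) ^ 2)) 0 1.

Fixpoint sum_curves (F : curve -> R) (l : list curve) : R :=
  match l with nil => 0 | cons g l' => F g + sum_curves F l' end.

Definition slice_set (U : H -> Prop) (J : H) (x y : R) : Prop := U (sl x y J).
Definition slice_boundary (U : H -> Prop) (J : H) (x y : R) : Prop :=
  forall eps, 0 < eps ->
    (exists a b, (a - x) ^ 2 + (b - y) ^ 2 < eps ^ 2 /\ U (sl a b J)) /\
    (exists a b, (a - x) ^ 2 + (b - y) ^ 2 < eps ^ 2 /\ ~ U (sl a b J)).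
Definition slice_closure (U : H -> Prop) (J : H) (x y : R) : Prop :=
  forall eps, 0 < eps ->
    exists a b, (a - x) ^ 2 + (b - y) ^ 2 < eps ^ 2 /\ U (sl a b J).

Definition boundary_curves (U : H -> Prop) (J : H) (l : list curve) : Prop :=
  (forall g, In g l -> jordan g /\ piecewise_C1 g) /\
  (forall k m g1 g2, nth_error l k = Some g1 -> nth_error l m = Some g2 -> k <> m ->
     forall x y, on_curve g1 x y -> ~ on_curve g2 x y) /\
  (forall x y, slice_boundary U J x y <-> exists g, In g l /\ on_curve g x y).

Definition pos_oriented_boundary (U : H -> Prop) (J : H) (l : list curve) : Prop :=
  boundary_curves U J l /\
  (forall x y, slice_set U J x y -> sum_curves (fun g => winding g x y) l = 1) /\
  (forall x y, ~ slice_closure U J x y -> sum_curves (fun g => winding g x y) l = 0).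

Definition slice_Cauchy_domain (U : H -> Prop) : Prop :=
  axially_symmetric U /\ H_open U /\ H_bounded U /\
  forall J, in_S J -> exists l, boundary_curves U J l.

Definition HRInt (g : R -> H) (a b : R) : H :=
  mkH (RInt (fun t => h0 (g t)) a b) (RInt (fun t => h1 (g t)) a b)
      (RInt (fun t => h2 (g t)) a b) (RInt (fun t => h3 (g t)) a b).

Definition cpt (J : H) (g : curve) (t : R) : H := sl (cu g t) (cv g t) J.
Definition dsJ (J : H) (g : curve) (t : R) : H :=
  Hmul (sl (Derive (cu g) t) (Derive (cv g) t) J) (Hopp J).

Definition curve_int (J : H) (A B : H -> H) (g : curve) : H :=
  HRInt (fun t => Hmul (Hmul (A (cpt J g t)) (dsJ J g t)) (B (cpt J g t))) 0 1.
Fixpoint cycle_int (J : H) (A B : H -> H) (l : list curve) : H :=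
  match l with
  | nil => mkH 0 0 0 0
  | cons g l' => Hadd (curve_int J A B g) (cycle_int J A B l')
  end.

Definition Qcs_inv (q s : H) : H :=
  Hinv (Hadd (Hmul s s) (Hadd (Hscal (- (2 * Hre q)) s) (Hreal (Hnorm2 q)))).

(* Main.v *)
Require Import Defs.
From Stdlib Require Import Reals Lra Lia List ClassicalEpsilon.
From Coquelicot Require Import Coquelicot.
Open Scope R_scope.

(** Write a slice function as [alpha + J beta]. By the Cauchy-Riemann system every component
    [F = alpha_c + i beta_c] is a holomorphic function on a plane domain symmetric about the real
    axis, with [F (conj z) = conj (F z)], and a direct computation gives
    [D f (u + J v) = - 2 beta / v]. The right-hand side is [-2] times the difference quotient
    [F[z, conj z] = (F z - F (conj z)) / (z - conj z)], [z = u + i v], which also makes sense at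
    real points, where it is [F' z]. Both claims are thus statements about [F[z, conj z]].

    Since [Q_{c,s}(q) = (s - z) (s - conj z)], the integral formula says
    [2 pi i F[z, conj z] = int F (s) / ((s - z) (s - conj z)) ds] over a cycle of winding number
    [1] about the points of [U] and [0] off its closure. It is Cauchy's formula for the function
    [s |-> F[s, conj z]], and the homological form of that formula is proved by Dixon's argument:
    the integral of [F[w, z]] over the cycle in [w], continued by the Cauchy transform of [F]
    outside [U], is entire and vanishes at infinity. As [alpha] and [beta] are only assumed
    differentiable, the local theory starts from Goursat's lemma.

    Harmonicity is local: near each point, [F[z, conj z]] is the real part of an integral of
    [K (t) / (zeta^2 - 2 q0 zeta + |q|^2)] over a fixed circle, and this kernel is harmonic. *)

(** Since [alpha] and [beta] have quaternionic values, [F] stands for four functions [F_c], one for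
    each real coordinate; no splitting of the quaternions relative to [J] is made. Let [X] be the
    quaternion with coordinates [F_c (s) ds / ((s - z) (s - conj z))]. The integrand of the theorem
    is [Im X - J (Re X)], and [Im X - (Re X) J] on the right. By the symmetry of [F_c] the number
    [F_c[z, conj z]] is real, so [2 pi i F_c[z, conj z]] is purely imaginary: the term with [J]
    integrates to zero, and the factor [- 1 / pi] turns [2 pi] into [- 2].

    The orientation of the boundary is given by winding numbers alone, with no description of the
    regions that the curves bound. This makes Green's formula and homotopies awkward, whereas
    Dixon's argument uses winding numbers only. The winding number is defined as a real integral,
    the imaginary part of [int ds / (s - z)] divided by [2 pi]; that the real part vanishes is shown
    separately with [ln |s - z|]. *)

(* [ring] does not see through the structure projections in the type of such an equation. *)
Ltac Req_type := match goal with |- @eq _ ?a ?b => change (@eq R a b) end.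

Ltac segment := rewrite Rmin_left, Rmax_right by lra.

(** * Continuity of complex-valued maps, tested on real and imaginary parts *)

Definition ccont {T : UniformSpace} (f : T -> C) (x : T) : Prop :=
  continuous (fun y => fst (f y)) x /\ continuous (fun y => snd (f y)) x.

Local Notation R2 := (prod_UniformSpace R_UniformSpace R_UniformSpace).

(** The plane as a domain of functions, with the product structure whose balls are squares;
    [locally_Cmod] converts its neighbourhoods into discs. Having a name for it lets continuity
    statements fix their domain explicitly. *)
Definition CT : UniformSpace := R2.

Local Notation CT2 := (prod_UniformSpace CT CT).

Lemma continuous_Rmult {T : UniformSpace} (f g : T -> R) (x : T) :
  continuous f x -> continuous g x -> continuous (fun y => f y * g y) x.
Proof. exact (continuous_mult (K := R_AbsRing) f g x). Qed.

Lemma continuous_Rplus {T : UniformSpace} (f g : T -> R) (x : T) :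
  continuous f x -> continuous g x -> continuous (fun y => f y + g y) x.
Proof. exact (continuous_plus (V := R_NormedModule) f g x). Qed.

Lemma continuous_Rminus {T : UniformSpace} (f g : T -> R) (x : T) :
  continuous f x -> continuous g x -> continuous (fun y => f y - g y) x.
Proof. exact (continuous_minus (V := R_NormedModule) f g x). Qed.

Lemma continuous_Ropp {T : UniformSpace} (f : T -> R) (x : T) :
  continuous f x -> continuous (fun y => - f y) x.
Proof. exact (continuous_opp (V := R_NormedModule) f x). Qed.

Lemma continuous_Rdiv {T : UniformSpace} (f g : T -> R) (x : T) :
  continuous f x -> continuous g x -> g x <> 0 -> continuous (fun y => f y / g y) x.
Proof.
  intros Hf Hg Hn. apply continuous_Rmult; [exact Hf|].
  apply (continuous_comp g Rinv); [exact Hg|].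
  apply continuous_Rinv. exact Hn.
Qed.

Section ComplexContinuity.
Context {T : UniformSpace}.
Implicit Types (f g : T -> C) (x : T).

Lemma ccont_const (c : C) x : ccont (fun _ : T => c) x.
Proof. split; apply continuous_const. Qed.

Lemma ccont_plus f g x : ccont f x -> ccont g x -> ccont (fun y => f y + g y)%C x.
Proof. intros [a b] [c d]; split; simpl; apply continuous_Rplus; assumption. Qed.

Lemma ccont_opp f x : ccont f x -> ccont (fun y => - f y)%C x.
Proof. intros [a b]; split; simpl; apply continuous_Ropp; assumption. Qed.

Lemma ccont_minus f g x : ccont f x -> ccont g x -> ccont (fun y => f y - g y)%C x.
Proof. intros; apply ccont_plus; [|apply ccont_opp]; assumption. Qed.

Lemma ccont_mult f g x : ccont f x -> ccont g x -> ccont (fun y => f y * g y)%C x.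
Proof.
  intros [a b] [c d]; split; simpl;
  [apply continuous_Rminus|apply continuous_Rplus]; apply continuous_Rmult; assumption.
Qed.

Lemma ccont_RtoC (f : T -> R) x : continuous f x -> ccont (fun y => RtoC (f y)) x.
Proof. intros a; split; simpl; [exact a|apply continuous_const]. Qed.

Lemma Cnorm2_neq_0 (z : C) : z <> 0 -> fst z ^ 2 + snd z ^ 2 <> 0.
Proof.
  intros Hz H0. apply Hz. destruct z as [a b]; simpl in H0.
  assert (a = 0) by nra. assert (b = 0) by nra. subst; reflexivity.
Qed.

Lemma ccont_inv f x : ccont f x -> f x <> 0 -> ccont (fun y => / f y)%C x.
Proof.
  intros [a b] Hn; apply Cnorm2_neq_0 in Hn; split; simpl;
  (apply continuous_Rdiv;
   [try apply continuous_Ropp; assumption| |exact Hn]);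
  apply continuous_Rplus; apply continuous_Rmult; try assumption;
  apply continuous_Rmult; try assumption; apply continuous_const.
Qed.

Lemma ccont_pow f n x : ccont f x -> ccont (fun y => f y ^ n)%C x.
Proof.
  intros Hf; induction n as [|n IH]; simpl.
  - apply ccont_const.
  - now apply ccont_mult.
Qed.

Lemma ccont_ext_loc f g x : locally x (fun y => f y = g y) -> ccont f x -> ccont g x.
Proof.
  intros E [a b]; split.
  - refine (continuous_ext_loc _ _ _ _ a).
    revert E; apply filter_imp; intros y Hy; now rewrite Hy.
  - refine (continuous_ext_loc _ _ _ _ b).
    revert E; apply filter_imp; intros y Hy; now rewrite Hy.
Qed.

Lemma ccont_ext f g x : (forall y, f y = g y) -> ccont f x -> ccont g x.
Proof. intros E; apply ccont_ext_loc; now apply filter_forall. Qed.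

(** Two coordinatewise limits combine into one limit in the plane; in this form [ccont] feeds the
    composition lemmas for uniform spaces. *)
Lemma ccont_pair f x : ccont f x -> continuous (f : T -> CT) x.
Proof.
  intros [a b].
  apply (continuous_ext (fun y => (fst (f y), snd (f y)) : CT)).
  { intros y; now destruct (f y). }
  refine (filterlim_filter_le_2 _ _ (filterlim_pair _ _ a b)).
  intros P [eps HP]. exists (ball (fst (f x)) eps) (ball (snd (f x)) eps).
  - now exists eps.
  - now exists eps.
  - intros u v Hu Hv. apply HP. now split.
Qed.

Lemma ccont_comp (h : C -> C) f x :
  ccont (T := CT) h (f x) -> ccont f x -> ccont (fun y => h (f y)) x.
Proof.
  intros [a b] Hf; apply ccont_pair in Hf; split.
  - exact (continuous_comp f (fun z : CT => fst (h z)) x Hf a).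
  - exact (continuous_comp f (fun z : CT => snd (h z)) x Hf b).
Qed.

Lemma ccont_comp_2 (h : C -> C -> C) f g x :
  ccont (T := CT2) (fun p => h (fst p) (snd p)) (f x, g x) ->
  ccont f x -> ccont g x -> ccont (fun y => h (f y) (g y)) x.
Proof.
  intros [a b] Hf Hg; apply ccont_pair in Hf; apply ccont_pair in Hg; split.
  - exact (continuous_comp_2 (f : T -> CT) (g : T -> CT) (fun z w => fst (h z w)) x Hf Hg a).
  - exact (continuous_comp_2 (f : T -> CT) (g : T -> CT) (fun z w => snd (h z w)) x Hf Hg b).
Qed.
End ComplexContinuity.

Lemma ccont_id (z : C) : ccont (T := CT) (fun w => w) z.
Proof. split; [apply continuous_fst|apply continuous_snd]. Qed.

Lemma ccont_fst {T S : UniformSpace} (f : T -> C) (p : prod_UniformSpace T S) :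
  ccont f (fst p) -> ccont (T := prod_UniformSpace T S) (fun q => f (fst q)) p.
Proof.
  intros [a b]; split.
  - apply (continuous_comp (fun q : prod_UniformSpace T S => fst q) (fun y => fst (f y)));
    [destruct p; apply continuous_fst|exact a].
  - apply (continuous_comp (fun q : prod_UniformSpace T S => fst q) (fun y => snd (f y)));
    [destruct p; apply continuous_fst|exact b].
Qed.

Lemma ccont_snd {T S : UniformSpace} (f : S -> C) (p : prod_UniformSpace T S) :
  ccont f (snd p) -> ccont (T := prod_UniformSpace T S) (fun q => f (snd q)) p.
Proof.
  intros [a b]; split.
  - apply (continuous_comp (fun q : prod_UniformSpace T S => snd q) (fun y => fst (f y)));
    [destruct p; apply continuous_snd|exact a].
  - apply (continuous_comp (fun q : prod_UniformSpace T S => snd q) (fun y => snd (f y)));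
    [destruct p; apply continuous_snd|exact b].
Qed.

Lemma Cmod_fst (z : C) : Rabs (fst z) <= Cmod z.
Proof. eapply Rle_trans; [apply Rmax_l|apply Rmax_Cmod]. Qed.

Lemma Cmod_snd (z : C) : Rabs (snd z) <= Cmod z.
Proof. eapply Rle_trans; [apply Rmax_r|apply Rmax_Cmod]. Qed.

Lemma Cmod_diag (z : C) : Cmod (z - z) = 0.
Proof. replace (z - z)%C with (RtoC 0) by ring. apply Cmod_0. Qed.

Lemma Cmod_le_abs (z : C) : Cmod z <= Rabs (fst z) + Rabs (snd z).
Proof.
  replace z with ((fst z, 0) + (0, snd z))%C at 1.
  2: destruct z; unfold Cplus; simpl; f_equal; ring.
  eapply Rle_trans; [apply Cmod_triangle|].
  apply Rplus_le_compat.
  - apply Req_le. exact (Cmod_R (fst z)).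
  - unfold Cmod; simpl. replace (0 * (0 * 1) + snd z * (snd z * 1)) with (Rsqr (snd z)).
    apply Req_le, sqrt_Rsqr_abs. unfold Rsqr; ring.
Qed.

Lemma locally_Cmod (z : C) (P : C -> Prop) :
  (exists d, 0 < d /\ forall w, Cmod (w - z) < d -> P w) <-> locally (T := CT) z P.
Proof.
  split.
  - intros (d & Hd & HP).
    assert (Hd2 : 0 < d / 2) by lra.
    exists (mkposreal _ Hd2). intros w [H1 H2]. apply HP.
    eapply Rle_lt_trans; [apply Cmod_le_abs|].
    change (Rabs (fst w - fst z) < d / 2) in H1.
    change (Rabs (snd w - snd z) < d / 2) in H2.
    change (Rabs (fst w - fst z) + Rabs (snd w - snd z) < d). lra.
  - intros [d HP]. exists d. split; [apply cond_pos|].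
    intros w Hw. apply HP. split.
    + change (Rabs (fst (w - z)%C) < d). eapply Rle_lt_trans; [apply Cmod_fst|exact Hw].
    + change (Rabs (snd (w - z)%C) < d). eapply Rle_lt_trans; [apply Cmod_snd|exact Hw].
Qed.

Lemma ccont_eps {T : UniformSpace} (f : T -> C) (x : T) :
  (forall eps, 0 < eps -> locally x (fun y => Cmod (f y - f x) < eps)) <-> ccont f x.
Proof.
  split.
  - intros Hf; split; apply filterlim_locally; intros eps;
    generalize (Hf eps (cond_pos eps)); apply filter_imp; intros y Hy.
    + change (Rabs (fst (f y - f x)%C) < eps). eapply Rle_lt_trans; [apply Cmod_fst|exact Hy].
    + change (Rabs (snd (f y - f x)%C) < eps). eapply Rle_lt_trans; [apply Cmod_snd|exact Hy].
  - intros [a b] eps Heps.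
    assert (H2 : 0 < eps / 2) by lra.
    apply (proj1 (filterlim_locally _ _)) with (eps := mkposreal _ H2) in a.
    apply (proj1 (filterlim_locally _ _)) with (eps := mkposreal _ H2) in b.
    generalize (filter_and _ _ a b). apply filter_imp. intros y [Ha Hb].
    eapply Rle_lt_trans; [apply Cmod_le_abs|].
    change (Rabs (fst (f y) - fst (f x)) < eps / 2) in Ha.
    change (Rabs (snd (f y) - snd (f x)) < eps / 2) in Hb.
    change (Rabs (fst (f y) - fst (f x)) + Rabs (snd (f y) - snd (f x)) < eps). lra.
Qed.

(** * Integrals of complex-valued functions of a real variable *)

Definition CInt (f : R -> C) (a b : R) : C :=
  (RInt (fun t => fst (f t)) a b, RInt (fun t => snd (f t)) a b).

(** [CInt] is total and says nothing about integrability. The algebra of integrals is therefore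
    carried by this relation, and [is_CInt_unique] returns to [CInt] at the end. *)
Definition is_CInt (f : R -> C) (a b : R) (l : C) : Prop :=
  is_RInt (fun t => fst (f t)) a b (fst l) /\ is_RInt (fun t => snd (f t)) a b (snd l).

Lemma is_CInt_unique f a b l : is_CInt f a b l -> CInt f a b = l.
Proof.
  intros [H1 H2]. unfold CInt. destruct l as [x y]. simpl in *.
  f_equal; now apply is_RInt_unique.
Qed.

Lemma is_CInt_ccont (f : R -> C) a b : a <= b ->
  (forall t, a <= t <= b -> ccont f t) -> is_CInt f a b (CInt f a b).
Proof.
  intros Hab Hf; split; simpl; apply (RInt_correct (V := R_CompleteNormedModule));
  apply (ex_RInt_continuous (V := R_CompleteNormedModule)); intros t;
  segment; intros Ht; apply (Hf t Ht).
Qed.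

Lemma is_CInt_plus f g a b l m :
  is_CInt f a b l -> is_CInt g a b m -> is_CInt (fun t => f t + g t)%C a b (l + m)%C.
Proof.
  intros [H1 H2] [H3 H4]; split.
  - exact (is_RInt_plus (V := R_NormedModule) _ _ _ _ _ _ H1 H3).
  - exact (is_RInt_plus (V := R_NormedModule) _ _ _ _ _ _ H2 H4).
Qed.

Lemma is_CInt_scal f a b l (c : C) :
  is_CInt f a b l -> is_CInt (fun t => c * f t)%C a b (c * l)%C.
Proof.
  intros [H1 H2]; split; simpl.
  - exact (is_RInt_minus (V := R_NormedModule) _ _ _ _ _ _
      (is_RInt_scal (V := R_NormedModule) _ _ _ (fst c) _ H1)
      (is_RInt_scal (V := R_NormedModule) _ _ _ (snd c) _ H2)).
  - exact (is_RInt_plus (V := R_NormedModule) _ _ _ _ _ _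
      (is_RInt_scal (V := R_NormedModule) _ _ _ (fst c) _ H2)
      (is_RInt_scal (V := R_NormedModule) _ _ _ (snd c) _ H1)).
Qed.

Lemma is_CInt_ext f g a b l : a <= b ->
  (forall t, a < t < b -> f t = g t) -> is_CInt f a b l -> is_CInt g a b l.
Proof.
  intros Hab E [H1 H2]; split; (eapply is_RInt_ext; [|eassumption]);
  intros t; segment; intros Ht; now rewrite E.
Qed.

Lemma is_CInt_opp f a b l :
  is_CInt f a b l -> is_CInt (fun t => - f t)%C a b (- l)%C.
Proof.
  intros [H1 H2]; split.
  - exact (is_RInt_opp (V := R_NormedModule) _ _ _ _ H1).
  - exact (is_RInt_opp (V := R_NormedModule) _ _ _ _ H2).
Qed.

Lemma is_CInt_minus f g a b l m :
  is_CInt f a b l -> is_CInt g a b m -> is_CInt (fun t => f t - g t)%C a b (l - m)%C.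
Proof. intros; apply is_CInt_plus; [|apply is_CInt_opp]; assumption. Qed.

Lemma is_CInt_Chasles f a b c l m :
  is_CInt f a b l -> is_CInt f b c m -> is_CInt f a c (l + m)%C.
Proof.
  intros [H1 H2] [H3 H4]; split.
  - exact (is_RInt_Chasles (V := R_NormedModule) _ _ _ _ _ _ H1 H3).
  - exact (is_RInt_Chasles (V := R_NormedModule) _ _ _ _ _ _ H2 H4).
Qed.

(** The factor 2 is the price of bounding the real and the imaginary part separately. Every use has
    room for it. *)
Lemma is_CInt_bound f a b l M : a <= b ->
  (forall t, a <= t <= b -> Cmod (f t) <= M) -> is_CInt f a b l ->
  Cmod l <= 2 * ((b - a) * M).
Proof.
  intros Hab HM [H1 H2].
  eapply Rle_trans; [apply Cmod_le_abs|].
  assert (Rabs (fst l) <= (b - a) * M).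
  { refine (norm_RInt_le_const (V := R_NormedModule) _ a b _ M Hab _ H1).
    intros t Ht. eapply Rle_trans; [apply Cmod_fst|now apply HM]. }
  assert (Rabs (snd l) <= (b - a) * M).
  { refine (norm_RInt_le_const (V := R_NormedModule) _ a b _ M Hab _ H2).
    intros t Ht. eapply Rle_trans; [apply Cmod_snd|now apply HM]. }
  lra.
Qed.

Lemma is_CInt_zero a b : is_CInt (fun _ => 0%C) a b 0.
Proof.
  assert (H0 : is_RInt (V := R_NormedModule) (fun _ => 0) a b 0).
  { evar_last. apply (is_RInt_const (V := R_NormedModule)).
    change ((b - a) * 0 = 0); ring. }
  split; exact H0.
Qed.

(** * Integrals depending on a parameter, and Fubini's theorem *)

Lemma tube {T : UniformSpace} (k : R -> T -> R) a b (x0 : T) (eps : R) : 0 < eps ->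
  (forall t, a <= t <= b ->
     continuous (fun p : prod_UniformSpace R_UniformSpace T => k (fst p) (snd p)) (t, x0)) ->
  locally x0 (fun x => forall t, a <= t <= b -> Rabs (k t x - k t x0) < eps).
Proof.
  intros Heps Hk.
  assert (He2 : 0 < eps / 2) by lra.
  assert (Hd : forall t, exists d : posreal, a <= t <= b -> forall s x,
            Rabs (s - t) < d -> ball x0 d x -> Rabs (k s x - k t x0) < eps / 2).
  { intros t. destruct (excluded_middle_informative (a <= t <= b)) as [Ht|Ht].
    - specialize (Hk t Ht). apply (proj1 (filterlim_locally _ _)) with (eps := mkposreal _ He2) in Hk.
      destruct Hk as [d Hd]. exists d. intros _ s x Hs Hx.
      apply (Hd (s, x)). split; assumption.
    - exists (mkposreal _ Heps). intros; contradiction. }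
  (* Compactness needs the pointwise radii as a function; choice extracts it, with irrelevant values
     outside [[a, b]]. *)
  set (delta := fun t => proj1_sig (constructive_indefinite_description _ (Hd t))).
  assert (Hdelta : forall t, a <= t <= b -> forall s x,
            Rabs (s - t) < delta t -> ball x0 (delta t) x -> Rabs (k s x - k t x0) < eps / 2).
  { intros t. unfold delta. destruct (constructive_indefinite_description _ (Hd t)); assumption. }
  destruct (compactness_value_1d a b delta) as [d Hc].
  exists d. intros x Hx t Ht.
  (* [compactness_value_1d] yields the covering point only under a double negation, so the estimate
     is proved by contradiction. *)
  apply Rnot_le_lt; intros Hbad. apply (Hc t Ht). intros (s & Hs & Hst & Hds).
  apply Rle_not_lt in Hbad; apply Hbad.
  assert (B : ball x0 (delta s) x) by (eapply ball_le; eassumption).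
  generalize (Hdelta s Hs t x Hst B) (Hdelta s Hs t x0 Hst (ball_center _ _)).
  unfold Rabs; repeat destruct Rcase_abs; lra.
Qed.

Lemma continuous_RInt_param {T : UniformSpace} (k : R -> T -> R) a b (x0 : T) : a <= b ->
  (forall t, a <= t <= b ->
     continuous (fun p : prod_UniformSpace R_UniformSpace T => k (fst p) (snd p)) (t, x0)) ->
  locally x0 (fun x => ex_RInt (fun t => k t x) a b) ->
  continuous (fun x => RInt (fun t => k t x) a b) x0.
Proof.
  intros Hab Hk Hex. apply filterlim_locally. intros eps.
  (* The added 1 keeps the denominator positive when [a = b]. *)
  assert (He : 0 < eps / (2 * (b - a + 1))).
  { apply Rdiv_lt_0_compat; [apply cond_pos|lra]. }
  generalize (filter_and _ _ (tube k a b x0 _ He Hk) Hex). apply filter_imp.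
  intros x [Hx Hxi].
  assert (Hx0i := locally_singleton _ _ Hex). simpl in Hx0i.
  change (Rabs (RInt (fun t => k t x) a b - RInt (fun t => k t x0) a b) < eps).
  assert (D : is_RInt (fun t => k t x - k t x0) a b
                (RInt (fun t => k t x) a b - RInt (fun t => k t x0) a b)).
  { apply (is_RInt_minus (V := R_NormedModule));
    apply (RInt_correct (V := R_CompleteNormedModule)); assumption. }
  eapply Rle_lt_trans.
  - refine (norm_RInt_le_const (V := R_NormedModule) _ a b _ _ Hab _ D).
    intros t Ht. apply Rlt_le. exact (Hx t Ht).
  - replace ((b - a) * (eps / (2 * (b - a + 1)))) with (eps / 2 * ((b - a) / (b - a + 1)))
      by (field; lra).
    assert ((b - a) / (b - a + 1) <= 1).
    { apply Rmult_le_reg_r with (b - a + 1); [lra|].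
      unfold Rdiv; rewrite Rmult_assoc, Rinv_l by lra. lra. }
    generalize (cond_pos eps). intros. nra.
Qed.

Lemma ccont_CInt_param {T : UniformSpace} (k : R -> T -> C) a b (x0 : T) : a <= b ->
  locally x0 (fun x => forall t, a <= t <= b -> ccont (fun s => k s x) t) ->
  (forall t, a <= t <= b ->
     ccont (T := prod_UniformSpace R_UniformSpace T) (fun p => k (fst p) (snd p)) (t, x0)) ->
  ccont (fun x => CInt (fun t => k t x) a b) x0.
Proof.
  intros Hab Hloc Hk. split; simpl.
  - apply (continuous_RInt_param (fun t x => fst (k t x))); [assumption|apply Hk|].
    generalize Hloc; apply filter_imp; intros x Hx.
    apply (ex_RInt_continuous (V := R_CompleteNormedModule)).
    intros t; segment; intros Ht; apply (Hx t Ht).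
  - apply (continuous_RInt_param (fun t x => snd (k t x))); [assumption|apply Hk|].
    generalize Hloc; apply filter_imp; intros x Hx.
    apply (ex_RInt_continuous (V := R_CompleteNormedModule)).
    intros t; segment; intros Ht; apply (Hx t Ht).
Qed.

Lemma ccont_slice_l {S T : UniformSpace} (k : S -> T -> C) (s : S) (x : T) :
  ccont (T := prod_UniformSpace S T) (fun p => k (fst p) (snd p)) (s, x) ->
  ccont (fun s => k s x) s.
Proof.
  intros [a b]; split.
  - exact (continuous_comp_2 (fun s : S => s) (fun _ : S => x) (fun s x => fst (k s x)) s
      (continuous_id _) (continuous_const _ _) a).
  - exact (continuous_comp_2 (fun s : S => s) (fun _ : S => x) (fun s x => snd (k s x)) s
      (continuous_id _) (continuous_const _ _) b).
Qed.

Lemma ccont_slice_r {S T : UniformSpace} (s : S) (x : T) (k : S -> T -> C) :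
  ccont (T := prod_UniformSpace S T) (fun p => k (fst p) (snd p)) (s, x) ->
  ccont (fun x => k s x) x.
Proof.
  intros [a b]; split.
  - exact (continuous_comp_2 (fun _ : T => s) (fun x : T => x) (fun s x => fst (k s x)) x
      (continuous_const _ _) (continuous_id _) a).
  - exact (continuous_comp_2 (fun _ : T => s) (fun x : T => x) (fun s x => snd (k s x)) x
      (continuous_const _ _) (continuous_id _) b).
Qed.

Lemma ccont_prod_swap {S T : UniformSpace} (k : S -> T -> C) (s : S) (x : T) :
  ccont (T := prod_UniformSpace S T) (fun p => k (fst p) (snd p)) (s, x) ->
  ccont (T := prod_UniformSpace T S) (fun p => k (snd p) (fst p)) (x, s).
Proof.
  intros [a b]; split.
  - exact (continuous_comp_2 (snd : prod_UniformSpace T S -> S) (fst : prod_UniformSpace T S -> T)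
      (fun s x => fst (k s x)) (x, s) (continuous_snd _ _) (continuous_fst _ _) a).
  - exact (continuous_comp_2 (snd : prod_UniformSpace T S -> S) (fst : prod_UniformSpace T S -> T)
      (fun s x => snd (k s x)) (x, s) (continuous_snd _ _) (continuous_fst _ _) b).
Qed.

(** Let [Phi x] be the double integral with the [x]-range cut at [x]. Differentiation under the
    integral sign gives [Phi' x = int_c^d k x y dy], and the fundamental theorem of calculus gives
    the exchange. Continuity on the whole plane provides the neighbourhoods of the end points that
    differentiation needs. *)
Lemma RInt_Fubini_continuous (k : R -> R -> R) a b c d : a <= b -> c <= d ->
  (forall x y, continuous (fun p : R2 =>
                             k (fst p) (snd p)) (x, y)) ->
  RInt (fun x => RInt (fun y => k x y) c d) a b = RInt (fun y => RInt (fun x => k x y) a b) c d.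
Proof.
  intros Hab Hcd Hk.
  assert (Hk1 : forall x y, continuous (fun x => k x y) x).
  { intros x y. exact (continuous_comp_2 (fun s : R_UniformSpace => s) (fun _ => y) k x
      (continuous_id _) (continuous_const _ _) (Hk x y)). }
  assert (Hk2 : forall x y, continuous (fun y => k x y) y).
  { intros x y. exact (continuous_comp_2 (fun _ : R_UniformSpace => x) (fun y => y) k y
      (continuous_const _ _) (continuous_id _) (Hk x y)). }
  assert (Hk' : forall x y, continuous (fun p : R2 =>
                             k (snd p) (fst p)) (x, y)).
  { intros x y. exact (continuous_comp_2 (snd : R2 -> _) fst k (x, y)
      (continuous_snd _ _) (continuous_fst _ _) (Hk y x)). }
  assert (Ex1 : forall y u v, ex_RInt (fun x => k x y) u v).
  { intros; apply (ex_RInt_continuous (V := R_CompleteNormedModule)); intros; apply Hk1. }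
  assert (Ex2 : forall x u v, ex_RInt (fun y => k x y) u v).
  { intros; apply (ex_RInt_continuous (V := R_CompleteNormedModule)); intros; apply Hk2. }
  set (Phi := fun x => RInt (fun y => RInt (fun s => k s y) a x) c d).
  assert (D1 : forall y x, is_derive (fun z => RInt (fun s => k s y) a z) x (k x y)).
  { intros y x. apply (is_derive_RInt (V := R_NormedModule) (fun s => k s y) _ a).
    - apply filter_forall. intros z. apply (RInt_correct (V := R_CompleteNormedModule)), Ex1.
    - apply Hk1. }
  assert (D2 : forall y x, Derive (fun z => RInt (fun s => k s y) a z) x = k x y).
  { intros; apply is_derive_unique, D1. }
  assert (DPhi : forall x, a <= x <= b -> is_derive Phi x (RInt (fun y => k x y) c d)).
  { intros x Hx.
    rewrite (RInt_ext _ (fun y => Derive (fun z => RInt (fun s => k s y) a z) x)) by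
      (intros; rewrite D2; reflexivity).
    apply is_derive_RInt_param.
    - apply filter_forall. intros z y _. eexists; apply D1.
    - intros y _. apply continuity_2d_pt_filterlim.
      apply (continuous_ext (fun p : R2 =>
                             k (fst p) (snd p))).
      + intros [u v]; simpl; rewrite D2; reflexivity.
      + apply Hk.
    - exists (mkposreal 1 Rlt_0_1). intros z _.
      apply (ex_RInt_continuous (V := R_CompleteNormedModule)). intros y _.
      destruct (Rle_dec a z) as [L|L].
      + apply (continuous_RInt_param (fun s y => k s y)); [exact L|intros; apply Hk|].
        apply filter_forall; intros; apply Ex1.
      + apply (continuous_ext (fun y => - RInt (fun s => k s y) z a)).
        * intros w. exact (opp_RInt_swap (V := R_CompleteNormedModule) (fun s => k s w) z a (Ex1 _ _ _)).
        * apply continuous_Ropp.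
          apply (continuous_RInt_param (fun s y => k s y)); [lra|intros; apply Hk|].
          apply filter_forall; intros; apply Ex1. }
  transitivity (Phi b - Phi a).
  - apply is_RInt_unique. apply (is_RInt_derive (V := R_CompleteNormedModule)).
    + intros x; segment. apply DPhi.
    + intros x _. apply (continuous_RInt_param (fun y x => k x y)); [assumption|intros; apply Hk'|].
      apply filter_forall; intros; apply Ex2.
  - assert (E0 : Phi a = 0).
    { unfold Phi. rewrite (RInt_ext (fun y => RInt (fun s => k s y) a a) (fun _ => 0)).
      - rewrite RInt_const. apply Rmult_0_r.
      - intros y _. exact (RInt_point (V := R_CompleteNormedModule) a (fun s => k s y)). }
    rewrite E0. apply Rminus_0_r.
Qed.

(** Composing with this retraction extends a function continuous on [[a, b]] to the whole line
    without changing it there. It serves Fubini on a rectangle and the extension of smooth pieces of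
    curves. *)
Definition clamp (a b t : R) := Rmax a (Rmin b t).

Lemma clamp_in a b t : a <= b -> a <= clamp a b t <= b.
Proof. unfold clamp, Rmax, Rmin; repeat destruct Rle_dec; lra. Qed.

Lemma clamp_id a b t : a <= t <= b -> clamp a b t = t.
Proof. unfold clamp, Rmax, Rmin; repeat destruct Rle_dec; lra. Qed.

Lemma clamp_continuous a b t : a <= b -> continuous (clamp a b) t.
Proof.
  intros Hab. apply filterlim_locally. intros eps. exists eps. intros s Hs.
  change (Rabs (s - t) < eps) in Hs. change (Rabs (clamp a b s - clamp a b t) < eps).
  revert Hs. unfold clamp, Rmax, Rmin, Rabs; repeat destruct Rle_dec; repeat destruct Rcase_abs; lra.
Qed.

Lemma RInt_Fubini (k : R -> R -> R) a b c d : a <= b -> c <= d ->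
  (forall x y, a <= x <= b -> c <= y <= d ->
     continuous (fun p : R2 =>
                             k (fst p) (snd p)) (x, y)) ->
  RInt (fun x => RInt (fun y => k x y) c d) a b = RInt (fun y => RInt (fun x => k x y) a b) c d.
Proof.
  intros Hab Hcd Hk.
  generalize (RInt_Fubini_continuous (fun x y => k (clamp a b x) (clamp c d y)) a b c d Hab Hcd).
  intros E.
  rewrite (RInt_ext _ (fun x => RInt (fun y => k (clamp a b x) (clamp c d y)) c d)).
  rewrite E. apply RInt_ext.
  - intros y; segment; intros Hy. apply RInt_ext.
    intros x; segment; intros Hx.
    now rewrite !clamp_id by lra.
  - intros x y.
    apply (continuous_comp_2 (fun p : R2 => clamp a b (fst p))
       (fun p => clamp c d (snd p)) k).
    + apply (continuous_comp fst (clamp a b)); [apply continuous_fst|now apply clamp_continuous].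
    + apply (continuous_comp snd (clamp c d)); [apply continuous_snd|now apply clamp_continuous].
    + apply Hk; now apply clamp_in.
  - intros x; segment; intros Hx. apply RInt_ext.
    intros y; segment; intros Hy.
    now rewrite !clamp_id by lra.
Qed.

Lemma CInt_Fubini (k : R -> R -> C) a b c d : a <= b -> c <= d ->
  (forall x y, a <= x <= b -> c <= y <= d ->
     ccont (T := R2)
       (fun p => k (fst p) (snd p)) (x, y)) ->
  CInt (fun x => CInt (fun y => k x y) c d) a b = CInt (fun y => CInt (fun x => k x y) a b) c d.
Proof.
  intros Hab Hcd Hk. unfold CInt at 1 3. simpl.
  f_equal; apply (RInt_Fubini (fun x y => _ (k x y))); try assumption; intros; now apply Hk.
Qed.

(** * Complex differentiability *)

(** The bound is not strict, so it also holds at [w = z] and no punctured neighbourhood is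
    needed. *)
Definition Cdiff (f : C -> C) (z l : C) : Prop :=
  forall eps, 0 < eps -> exists d, 0 < d /\
    forall w, Cmod (w - z) < d -> Cmod (f w - f z - l * (w - z)) <= eps * Cmod (w - z).

Lemma Cminus_eq_0 (z w : C) : (z - w)%C = 0 -> z = w.
Proof. apply Ceq_minus. Qed.

Lemma Cminus_neq_0 (z w : C) : z <> w -> (z - w)%C <> 0.
Proof. intros H E; apply H; now apply Cminus_eq_0. Qed.

(** Caratheodory's form of differentiability: a slope function continuous at [z]. Together with the
    converse [Cdiff_slope] it reduces the rules for sums, products and inverses to continuity of
    slopes. *)
Lemma Cdiff_of_slope (f psi : C -> C) (z : C) :
  locally (T := CT) z (fun w => f w - f z = psi w * (w - z))%C ->
  ccont (T := CT) psi z -> Cdiff f z (psi z).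
Proof.
  intros E Hc eps Heps.
  apply ccont_eps with (eps := eps) in Hc; [|assumption].
  destruct (proj2 (locally_Cmod _ _) (filter_and _ _ E Hc)) as (d & Hd & Hw).
  exists d; split; [assumption|]. intros w Hwd. destruct (Hw w Hwd) as [E1 E2].
  rewrite E1. replace (psi w * (w - z) - psi z * (w - z))%C with ((psi w - psi z) * (w - z))%C by ring.
  rewrite Cmod_mult. apply Rmult_le_compat_r; [apply Cmod_ge_0|lra].
Qed.

Definition dquot (f : C -> C) (l : C) (z w : C) : C :=
  if Ceq_dec w z then l else ((f w - f z) / (w - z))%C.

Lemma dquot_spec f l z w : (f w - f z = dquot f l z w * (w - z))%C.
Proof.
  unfold dquot. destruct (Ceq_dec w z) as [->|N]; [ring|].
  field. now apply Cminus_neq_0.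
Qed.

Lemma dquot_diag f l z : dquot f l z z = l.
Proof. unfold dquot. destruct (Ceq_dec z z); [reflexivity|congruence]. Qed.

Lemma Cdiff_slope (f : C -> C) (z l : C) : Cdiff f z l -> ccont (T := CT) (dquot f l z) z.
Proof.
  intros Hf. apply ccont_eps. intros eps Heps.
  assert (He2 : 0 < eps / 2) by lra.
  destruct (Hf _ He2) as (d & Hd & Hw). apply locally_Cmod. exists d; split; [assumption|].
  intros w Hwd. rewrite dquot_diag. unfold dquot. destruct (Ceq_dec w z) as [E|N].
  - replace (l - l)%C with (RtoC 0) by ring. now rewrite Cmod_0.
  - specialize (Hw w Hwd). apply Cminus_neq_0 in N.
    replace ((f w - f z) / (w - z) - l)%C with ((f w - f z - l * (w - z)) / (w - z))%C by (field; assumption).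
    rewrite Cmod_div by assumption. apply Cmod_gt_0 in N.
    apply Rmult_lt_reg_r with (Cmod (w - z)); [assumption|].
    unfold Rdiv; rewrite Rmult_assoc, Rinv_l by lra. rewrite Rmult_1_r. nra.
Qed.

Lemma Cdiff_ccont f z l : Cdiff f z l -> ccont (T := CT) f z.
Proof.
  intros H; apply Cdiff_slope in H.
  apply (ccont_ext (fun w => f z + dquot f l z w * (w - z)))%C.
  - intros w. rewrite <- dquot_spec. ring.
  - apply ccont_plus; [apply ccont_const|]. apply ccont_mult; [assumption|].
    apply ccont_minus; [apply ccont_id|apply ccont_const].
Qed.

Lemma Cdiff_ext_loc f g z l :
  locally (T := CT) z (fun w => f w = g w) -> Cdiff f z l -> Cdiff g z l.
Proof.
  intros E Hf eps Heps. destruct (Hf eps Heps) as (d & Hd & Hw).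
  destruct (proj2 (locally_Cmod _ _) E) as (d' & Hd' & Hw').
  assert (E0 := locally_singleton _ _ E). simpl in E0.
  exists (Rmin d d'). split; [now apply Rmin_pos|]. intros w Hm.
  rewrite <- E0, <- Hw'.
  - apply Hw. eapply Rlt_le_trans; [exact Hm|apply Rmin_l].
  - eapply Rlt_le_trans; [exact Hm|apply Rmin_r].
Qed.

Lemma Cdiff_unique f z l m : Cdiff f z l -> Cdiff f z m -> l = m.
Proof.
  intros Hl Hm. apply NNPP. intros N.
  apply Cminus_neq_0, Cmod_gt_0 in N.
  assert (Hp : 0 < Cmod (l - m) / 4) by lra.
  destruct (Hl _ Hp) as (d1 & Hd1 & H1). destruct (Hm _ Hp) as (d2 & Hd2 & H2).
  set (d := Rmin d1 d2 / 2).
  assert (Hd : 0 < d) by (unfold d; generalize (Rmin_pos _ _ Hd1 Hd2); lra).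
  assert (Ld1 : d < d1) by (unfold d; generalize (Rmin_l d1 d2); unfold d in Hd; lra).
  assert (Ld2 : d < d2) by (unfold d; generalize (Rmin_r d1 d2); unfold d in Hd; lra).
  assert (E : (z + RtoC d - z)%C = RtoC d) by ring.
  assert (Ed : Cmod (RtoC d) = d) by (rewrite Cmod_R, Rabs_pos_eq; lra).
  specialize (H1 (z + RtoC d)%C). specialize (H2 (z + RtoC d)%C).
  rewrite E, Ed in H1, H2. specialize (H1 Ld1). specialize (H2 Ld2).
  set (w := (z + RtoC d)%C) in *.
  generalize (Cmod_triangle (f w - f z - m * RtoC d) (- (f w - f z - l * RtoC d))).
  rewrite Cmod_opp.
  replace (f w - f z - m * d + - (f w - f z - l * d))%C with ((l - m) * d)%C by ring.
  rewrite Cmod_mult, Ed. nra.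
Qed.

Lemma Cdiff_const c z : Cdiff (fun _ => c) z 0.
Proof.
  apply (Cdiff_of_slope _ (fun _ => RtoC 0)); [|apply ccont_const].
  apply filter_forall. intros w; simpl; ring.
Qed.

Lemma Cdiff_id z : Cdiff (fun w => w) z 1.
Proof.
  apply (Cdiff_of_slope _ (fun _ => RtoC 1)); [|apply ccont_const].
  apply filter_forall. intros w; simpl; ring.
Qed.

Lemma Cdiff_plus f g z l m : Cdiff f z l -> Cdiff g z m -> Cdiff (fun w => f w + g w)%C z (l + m).
Proof.
  intros Hf Hg. apply Cdiff_slope in Hf. apply Cdiff_slope in Hg.
  assert (S := Cdiff_of_slope (fun w => f w + g w)%C (fun w => dquot f l z w + dquot g m z w)%C z).
  cbv beta in S; rewrite !dquot_diag in S. apply S.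
  - apply filter_forall. intros w. simpl.
    replace (f w + g w - (f z + g z))%C with ((f w - f z) + (g w - g z))%C by ring.
    rewrite (dquot_spec f l z w), (dquot_spec g m z w). ring.
  - now apply ccont_plus.
Qed.

Lemma Cdiff_mult f g z l m : Cdiff f z l -> Cdiff g z m ->
  Cdiff (fun w => f w * g w)%C z (l * g z + f z * m).
Proof.
  intros Hf Hg. assert (Cg := Cdiff_ccont _ _ _ Hg). apply Cdiff_slope in Hf. apply Cdiff_slope in Hg.
  assert (S := Cdiff_of_slope (fun w => f w * g w)%C
     (fun w => dquot f l z w * g w + f z * dquot g m z w)%C z).
  cbv beta in S; rewrite !dquot_diag in S. apply S.
  - apply filter_forall. intros w. simpl.
    replace (f w * g w - f z * g z)%C with ((f w - f z) * g w + f z * (g w - g z))%C by ring.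
    rewrite (dquot_spec f l z w), (dquot_spec g m z w). ring.
  - apply ccont_plus; apply ccont_mult; try assumption. apply ccont_const.
Qed.

Lemma Cdiff_scal f c z l : Cdiff f z l -> Cdiff (fun w => c * f w)%C z (c * l).
Proof.
  intros Hf. generalize (Cdiff_mult _ _ _ _ _ (Cdiff_const c z) Hf).
  replace (0 * f z + c * l)%C with (c * l)%C by ring. easy.
Qed.

Lemma Cdiff_minus f g z l m : Cdiff f z l -> Cdiff g z m -> Cdiff (fun w => f w - g w)%C z (l - m).
Proof.
  intros Hf Hg. apply (Cdiff_ext_loc (fun w => f w + (-(1)) * g w)%C).
  - apply filter_forall. intros w; ring.
  - replace (l - m)%C with (l + (-(1)) * m)%C by ring. apply Cdiff_plus; [assumption|].
    now apply Cdiff_scal.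
Qed.

Lemma locally_Cneq (z c : C) : z <> c -> locally (T := CT) z (fun w => w <> c).
Proof.
  intros N. apply locally_Cmod. exists (Cmod (z - c)). split.
  - now apply Cmod_gt_0, Cminus_neq_0.
  - intros w Hw ->. replace (c - z)%C with (- (z - c))%C in Hw by ring.
    rewrite Cmod_opp in Hw. lra.
Qed.

Lemma Cdiff_inv (c z : C) : z <> c -> Cdiff (fun w => / (w - c))%C z (- ((/ (z - c)) * (/ (z - c)))).
Proof.
  intros N.
  assert (S := Cdiff_of_slope (fun w => / (w - c))%C (fun w => - ((/ (w - c)) * (/ (z - c))))%C z).
  simpl in S. apply S.
  - generalize (locally_Cneq z c N). apply filter_imp. intros w Hw.
    field. split; now apply Cminus_neq_0.
  - apply ccont_opp, ccont_mult; [|apply ccont_const].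
    apply ccont_inv; [|now apply Cminus_neq_0].
    apply ccont_minus; [apply ccont_id|apply ccont_const].
Qed.

(** The pattern of the four partial derivatives is the Cauchy-Riemann system. This is the passage
    from the real differentiability of [alpha] and [beta] to complex differentiability, and back for
    the chain rule. *)
Lemma Cdiff_differentiable f z l :
  Cdiff f z l <->
  differentiable_pt_lim (fun x y => fst (f (x, y))) (fst z) (snd z) (fst l) (- snd l) /\
  differentiable_pt_lim (fun x y => snd (f (x, y))) (fst z) (snd z) (snd l) (fst l).
Proof.
  destruct z as [x y]. simpl. split.
  - intros Hf.
    assert (Hm : forall u v, Cmod ((u, v) - (x, y)) <= 2 * Rmax (Rabs (u - x)) (Rabs (v - y))).
    { intros u v. eapply Rle_trans; [apply Cmod_le_abs|]. simpl.
      change (u + - x) with (u - x). change (v + - y) with (v - y).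
      generalize (Rmax_l (Rabs (u - x)) (Rabs (v - y))) (Rmax_r (Rabs (u - x)) (Rabs (v - y))). lra. }
    assert (Hl : forall eps : posreal, locally_2d (fun u v =>
       Cmod (f (u, v) - f (x, y) - l * ((u, v) - (x, y))) <= eps * Rmax (Rabs (u - x)) (Rabs (v - y))) x y).
    { intros eps. assert (He : 0 < eps / 2) by (generalize (cond_pos eps); lra).
      destruct (Hf _ He) as (d & Hd & Hw). assert (Hd2 : 0 < d / 2) by lra.
      exists (mkposreal _ Hd2). simpl. intros u v Hu Hv.
      assert (M := Hm u v).
      assert (Rmax (Rabs (u - x)) (Rabs (v - y)) < d / 2) by (now apply Rmax_lub_lt).
      eapply Rle_trans; [apply Hw; lra|]. nra. }
    split; intros eps; generalize (Hl eps); apply locally_2d_impl, locally_2d_forall;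
    intros u v Huv; (eapply Rle_trans; [|exact Huv]).
    + eapply Rle_trans; [|apply Cmod_fst]. apply Req_le. f_equal. simpl. ring.
    + eapply Rle_trans; [|apply Cmod_snd]. apply Req_le. f_equal. simpl. ring.
  - intros [H1 H2] eps Heps. assert (He : 0 < eps / 2) by lra.
    generalize (locally_2d_and _ _ _ _ (H1 (mkposreal _ He)) (H2 (mkposreal _ He))).
    intros [d Hd]. exists d. split; [apply cond_pos|]. intros [u v] Hw.
    assert (A1 := Cmod_fst ((u, v) - (x, y))). assert (A2 := Cmod_snd ((u, v) - (x, y))).
    simpl in A1, A2. change (u + - x) with (u - x) in A1. change (v + - y) with (v - y) in A2.
    destruct (Hd u v) as [B1 B2]; [lra|lra|]. simpl in B1, B2.
    eapply Rle_trans; [apply Cmod_le_abs|].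
    assert (Rmax (Rabs (u - x)) (Rabs (v - y)) <= Cmod ((u, v) - (x, y))) by (now apply Rmax_lub).
    replace (fst (f (u, v) - f (x, y) - l * ((u, v) - (x, y)))%C) with
      (fst (f (u, v)) - fst (f (x, y)) - (fst l * (u - x) + - snd l * (v - y))) by (simpl; ring).
    replace (snd (f (u, v) - f (x, y) - l * ((u, v) - (x, y)))%C) with
      (snd (f (u, v)) - snd (f (x, y)) - (snd l * (u - x) + fst l * (v - y))) by (simpl; ring).
    nra.
Qed.

(** * Paths and the fundamental theorem of calculus *)

Definition Cpath (gamma : R -> C) (t : R) (l : C) : Prop :=
  is_derive (fun s => fst (gamma s)) t (fst l) /\ is_derive (fun s => snd (gamma s)) t (snd l).

Lemma Cpath_ccont gamma t l : Cpath gamma t l -> ccont gamma t.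
Proof.
  intros [H1 H2]; split.
  - apply (ex_derive_continuous (V := R_NormedModule)). eexists; exact H1.
  - apply (ex_derive_continuous (V := R_NormedModule)). eexists; exact H2.
Qed.

Lemma Cpath_comp f gamma t l d : Cpath gamma t l -> Cdiff f (gamma t) d ->
  Cpath (fun s => f (gamma s)) t (d * l).
Proof.
  intros [H1 H2] Hf. apply Cdiff_differentiable in Hf. destruct Hf as [F1 F2].
  apply is_derive_Reals in H1. apply is_derive_Reals in H2.
  assert (E : forall s, f (gamma s) = f (fst (gamma s), snd (gamma s))).
  { intros s. now destruct (gamma s). }
  split.
  - apply (is_derive_ext (fun s => fst (f (fst (gamma s), snd (gamma s))))).
    { intros s; now rewrite E. }
    apply is_derive_Reals. replace (fst (d * l)%C) with (fst d * fst l + - snd d * snd l) by (simpl; ring).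
    exact (derivable_pt_lim_comp_2d (fun x y => fst (f (x, y))) _ _ _ _ _ _ _ F1 H1 H2).
  - apply (is_derive_ext (fun s => snd (f (fst (gamma s), snd (gamma s))))).
    { intros s; now rewrite E. }
    apply is_derive_Reals. replace (snd (d * l)%C) with (snd d * fst l + fst d * snd l) by (simpl; ring).
    exact (derivable_pt_lim_comp_2d (fun x y => snd (f (x, y))) _ _ _ _ _ _ _ F2 H1 H2).
Qed.

Lemma is_CInt_FTC (P g : C -> C) (gamma gamma' : R -> C) a b : a <= b ->
  (forall t, a <= t <= b -> Cpath gamma t (gamma' t)) ->
  (forall t, a <= t <= b -> Cdiff P (gamma t) (g (gamma t))) ->
  (forall t, a <= t <= b -> ccont (fun s => g (gamma s) * gamma' s)%C t) ->
  is_CInt (fun t => g (gamma t) * gamma' t)%C a b (P (gamma b) - P (gamma a))%C.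
Proof.
  intros Hab Hg HP Hc.
  assert (D : forall t, a <= t <= b -> Cpath (fun s => P (gamma s)) t (g (gamma t) * gamma' t)).
  { intros t Ht. apply Cpath_comp; auto. }
  split.
  - apply (is_RInt_derive (V := R_CompleteNormedModule) (fun t => fst (P (gamma t)))
      (fun t => fst (g (gamma t) * gamma' t)%C)); intros t;
    segment; intros Ht; [apply (D t Ht)|apply (Hc t Ht)].
  - apply (is_RInt_derive (V := R_CompleteNormedModule) (fun t => snd (P (gamma t)))
      (fun t => snd (g (gamma t) * gamma' t)%C)); intros t;
    segment; intros Ht; [apply (D t Ht)|apply (Hc t Ht)].
Qed.

(** * Integrals of [K / D ^ n] as functions of [D] *)

Lemma ccont_bounded (f : R -> C) a b :
  (forall t, a <= t <= b -> ccont f t) -> exists B, 0 < B /\ forall t, a <= t <= b -> Cmod (f t) <= B.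
Proof.
  intros Hf.
  destruct (bounded_continuity (K := R_AbsRing) (V := R_NormedModule) (fun t => fst (f t)) a b) as [M1 H1].
  { intros t Ht; apply (Hf t Ht). }
  destruct (bounded_continuity (K := R_AbsRing) (V := R_NormedModule) (fun t => snd (f t)) a b) as [M2 H2].
  { intros t Ht; apply (Hf t Ht). }
  exists (Rmax 1 (M1 + M2)). split.
  - eapply Rlt_le_trans; [apply Rlt_0_1|apply Rmax_l].
  - intros t Ht. eapply Rle_trans; [apply Cmod_le_abs|].
    eapply Rle_trans; [|apply Rmax_r].
    specialize (H1 t Ht). specialize (H2 t Ht).
    change (Rabs (fst (f t)) < M1) in H1. change (Rabs (snd (f t)) < M2) in H2. lra.
Qed.

(** From [|D| >= 1 / B] and [|d| <= 1 / (2 B)] follows [|D + d| >= 1 / (2 B)]. *)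
Lemma Cmod_inv_perturb (D d : C) B : D <> 0 -> 0 < B -> Cmod (/ D) <= B -> Cmod d * B <= / 2 ->
  (D + d)%C <> 0 /\ Cmod (/ (D + d)) <= 2 * B.
Proof.
  intros HD HB HDB Hd.
  assert (P : 0 < Cmod D) by now apply Cmod_gt_0.
  rewrite Cmod_inv in HDB by assumption.
  assert (H1 : 1 <= B * Cmod D).
  { apply Rmult_le_compat_r with (r := Cmod D) in HDB; [|lra]. rewrite Rinv_l in HDB by lra. lra. }
  assert (T : Cmod D <= Cmod (D + d) + Cmod d).
  { rewrite <- (Cmod_opp d). eapply Rle_trans; [|apply Cmod_triangle].
    apply Req_le. f_equal. ring. }
  assert (H2 : / 2 <= B * Cmod (D + d)) by nra.
  assert (P2 : 0 < Cmod (D + d)) by nra.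
  assert (N : (D + d)%C <> 0) by now apply Cmod_gt_0.
  split; [assumption|]. rewrite Cmod_inv by assumption.
  apply Rmult_le_reg_r with (Cmod (D + d)); [assumption|]. rewrite Rinv_l by lra. lra.
Qed.

(** The first-order expansion of [D^(-n)], with a quadratic remainder that is uniform over all [D]
    with [|1 / D| <= B]. The uniformity is what allows integration over a curve afterwards. *)
Lemma inv_pow_taylor (n : nat) (B : R) : 0 < B -> exists M, 0 <= M /\
  forall D d : C, D <> 0 -> Cmod (/ D) <= B -> Cmod d * B <= / 2 ->
  Cmod ((/ (D + d)) ^ n - (/ D) ^ n + INR n * (d * (/ D) ^ (S n))) <= M * (Cmod d * Cmod d).
Proof.
  intros HB. induction n as [|n (M & HM & IH)].
  - exists 0. split; [lra|]. intros D d _ _ _. simpl Cpow. simpl INR.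
    replace (1 - 1 + 0 * (d * (/ D * 1)))%C with (RtoC 0) by ring. rewrite Cmod_0. lra.
  - exists (2 * B * M + B ^ n * (2 * B * B * B) + INR n * (B ^ (S n) * (2 * B * B))).
    assert (Hn := pos_INR n). assert (HBn := pow_lt B n HB). assert (HBSn := pow_lt B (S n) HB).
    split.
    { assert (0 < B * B) by nra. assert (0 < B * B * B) by nra.
      assert (0 <= INR n * (B ^ S n * (2 * B * B))) by (apply Rmult_le_pos; [assumption|nra]). nra. }
    intros D d HD HDB Hd. specialize (IH D d HD HDB Hd).
    destruct (Cmod_inv_perturb D d B HD HB HDB Hd) as [N HN].
    set (a := (/ (D + d))%C) in *. set (b := (/ D)%C) in *.
    assert (E : (b - a = d * a * b)%C) by (unfold a, b; field; split; assumption).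
    assert (E2 : (a - b + d * b * b = d * d * (a * b * b))%C) by (unfold a, b; field; split; assumption).
    (* The remainder for [n + 1] splits into the remainder for [n] times [a], the remainder for
       exponent 1 times [b ^ n], and a cross term. By [E] and [E2] each contains [d] twice;
       [|a| <= 2 B] and [|b| <= B] give the three summands of the constant. *)
    replace (a ^ S n - b ^ S n + INR (S n) * (d * b ^ S (S n)))%C with
      (a * (a ^ n - b ^ n + INR n * (d * b ^ S n)) + b ^ n * (a - b + d * b * b)
        + INR n * (d * b ^ S n * (b - a)))%C.
    2: { rewrite S_INR, RtoC_plus. rewrite !Cpow_S. ring. }
    rewrite E, E2.
    eapply Rle_trans; [apply Cmod_triangle|]. eapply Rle_trans; [apply Rplus_le_compat_r, Cmod_triangle|].
    rewrite !Cmod_mult, !Cmod_pow, Cmod_R, (Rabs_pos_eq (INR n)) by assumption.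
    assert (Ha := Cmod_ge_0 a). assert (Hb := Cmod_ge_0 b). assert (Hd0 := Cmod_ge_0 d).
    assert (Pn : Cmod b ^ n <= B ^ n) by (apply pow_incr; split; assumption).
    assert (PSn : Cmod b ^ S n <= B ^ S n) by (apply pow_incr; split; assumption).
    assert (P0 : 0 <= Cmod b ^ n) by now apply pow_le.
    assert (P1 : 0 <= Cmod b ^ S n) by now apply pow_le.
    set (s := Cmod d) in *.
    assert (Hab : Cmod a * Cmod b <= 2 * B * B) by (apply Rmult_le_compat; assumption).
    assert (Hab0 : 0 <= Cmod a * Cmod b) by now apply Rmult_le_pos.
    assert (X1 : Cmod a * Cmod (a ^ n - b ^ n + INR n * (d * b ^ S n)) <= 2 * B * (M * (s * s))).
    { apply Rmult_le_compat; try assumption. apply Cmod_ge_0. }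
    assert (X2 : Cmod b ^ n * (s * s * (Cmod a * Cmod b * Cmod b)) <= B ^ n * (s * s * (2 * B * B * B))).
    { assert (0 <= s * s) by nra. apply Rmult_le_compat; try assumption; [repeat apply Rmult_le_pos; assumption|]. apply Rmult_le_compat_l; [nra|].
      apply Rmult_le_compat; assumption. }
    assert (X3 : INR n * (s * Cmod b ^ S n * (s * Cmod a * Cmod b)) <= INR n * (s * B ^ S n * (s * (2 * B * B)))).
    { apply Rmult_le_compat_l; [assumption|]. rewrite (Rmult_assoc s (Cmod a)).
      apply Rmult_le_compat; try (apply Rmult_le_pos; assumption); apply Rmult_le_compat_l; assumption. }
    eapply Rle_trans; [apply Rplus_le_compat; [apply Rplus_le_compat; [exact X1|exact X2]|exact X3]|].
    apply Req_le. ring.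
Qed.

Lemma ccont_kernel {T : UniformSpace} (K D : T -> C) n t : ccont K t -> ccont D t -> D t <> 0 ->
  ccont (fun s => K s * (/ D s) ^ n)%C t.
Proof.
  intros HK HD N. apply ccont_mult; [assumption|]. apply ccont_pow, ccont_inv; assumption.
Qed.

(** One expansion serves the Cauchy kernels, where [D = gamma - z], and the potentials, where
    [D = zeta^2 - 2 x zeta + y]; for the latter the perturbation has to depend on [t]. Compactness
    of [[a, b]] bounds [K] and [1 / D]. *)
Lemma CInt_kernel_taylor (K D : R -> C) a b n : a <= b ->
  (forall t, a <= t <= b -> ccont K t) -> (forall t, a <= t <= b -> ccont D t) ->
  (forall t, a <= t <= b -> D t <> 0) ->
  exists m M, 0 < m /\ 0 <= M /\ forall (d : R -> C) s,
    (forall t, a <= t <= b -> ccont d t) -> s <= m -> (forall t, a <= t <= b -> Cmod (d t) <= s) ->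
    (forall t, a <= t <= b -> (D t + d t)%C <> 0) /\
    Cmod (CInt (fun t => K t * (/ (D t + d t)) ^ n)%C a b - CInt (fun t => K t * (/ D t) ^ n)%C a b
          + INR n * CInt (fun t => (K t * d t) * (/ D t) ^ (S n))%C a b)%C <= M * (s * s).
Proof.
  intros Hab HK HD HN.
  destruct (ccont_bounded K a b HK) as (BK & HBK & BKb).
  destruct (ccont_bounded (fun t => / D t)%C a b) as (B & HB & Bb).
  { intros t Ht; apply ccont_inv; auto. }
  destruct (inv_pow_taylor n B HB) as (M & HM & Htay).
  exists (/ (2 * B)), (2 * ((b - a) * (BK * M))).
  assert (PB : 0 < / (2 * B)) by (apply Rinv_0_lt_compat; lra).
  split; [assumption|]. split.
  { assert (0 <= BK * M) by nra. assert (0 <= (b - a) * (BK * M)) by (apply Rmult_le_pos; lra). lra. }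
  intros d s Hd Hs Hds.
  assert (Hdb : forall t, a <= t <= b -> Cmod (d t) * B <= / 2).
  { intros t Ht. specialize (Hds t Ht). apply Rle_trans with (/ (2 * B) * B); [|apply Req_le; field; lra].
    apply Rmult_le_compat_r; lra. }
  assert (HN2 : forall t, a <= t <= b -> (D t + d t)%C <> 0).
  { intros t Ht. apply (Cmod_inv_perturb (D t) (d t) B); auto. }
  split; [assumption|].
  assert (I1 : is_CInt (fun t => K t * (/ (D t + d t)) ^ n)%C a b (CInt (fun t => K t * (/ (D t + d t)) ^ n)%C a b)).
  { apply is_CInt_ccont; [assumption|]. intros t Ht. apply ccont_kernel; auto. apply ccont_plus; auto. }
  assert (I2 : is_CInt (fun t => K t * (/ (D t)) ^ n)%C a b (CInt (fun t => K t * (/ (D t)) ^ n)%C a b)).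
  { apply is_CInt_ccont; [assumption|]. intros t Ht. apply ccont_kernel; auto. }
  assert (I3 : is_CInt (fun t => (K t * d t) * (/ (D t)) ^ (S n))%C a b (CInt (fun t => (K t * d t) * (/ (D t)) ^ (S n))%C a b)).
  { apply is_CInt_ccont; [assumption|]. intros t Ht. apply ccont_kernel; auto. apply ccont_mult; auto. }
  assert (I := is_CInt_plus _ _ _ _ _ _ (is_CInt_minus _ _ _ _ _ _ I1 I2) (is_CInt_scal _ _ _ _ (INR n) I3)).
  rewrite !Rmult_assoc.
  refine (is_CInt_bound _ _ _ _ _ Hab _ I).
  intros t Ht. simpl.
  match goal with |- Cmod ?e <= _ =>
    replace e with (K t * ((/ (D t + d t)) ^ n - (/ D t) ^ n + INR n * (d t * (/ D t) ^ (S n))))%C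
      by (rewrite Cpow_S; ring) end.
  rewrite Cmod_mult. specialize (Hds t Ht).
  apply Rmult_le_compat; [apply Cmod_ge_0|apply Cmod_ge_0|auto|].
  eapply Rle_trans; [apply Htay; auto|]. apply Rmult_le_compat_l; [assumption|].
  apply Rmult_le_compat; try apply Cmod_ge_0; assumption.
Qed.

Lemma Cdiff_quadratic f z l m M : 0 < m ->
  (forall h, Cmod h <= m -> Cmod (f (z + h)%C - f z - l * h) <= M * (Cmod h * Cmod h)) -> Cdiff f z l.
Proof.
  intros Hm H eps Heps.
  assert (HM : 0 < Rabs M + 1) by (generalize (Rabs_pos M); lra).
  exists (Rmin m (eps / (Rabs M + 1))). split.
  - apply Rmin_pos; [assumption|]. now apply Rdiv_lt_0_compat.
  - intros w Hw. assert (L1 := Rmin_l m (eps / (Rabs M + 1))). assert (L2 := Rmin_r m (eps / (Rabs M + 1))).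
    specialize (H (w - z)%C). replace (z + (w - z))%C with w in H by ring.
    eapply Rle_trans; [apply H; lra|].
    assert (P := Cmod_ge_0 (w - z)). set (s := Cmod (w - z)) in *.
    assert (s * (Rabs M + 1) <= eps).
    { apply Rle_trans with (eps / (Rabs M + 1) * (Rabs M + 1)); [apply Rmult_le_compat_r; lra|].
      apply Req_le; field; lra. }
    assert (M * s <= eps) by (generalize (Rle_abs M); nra). nra.
Qed.

(** Apply the expansion with the constant perturbation [- h]. The exponent is arbitrary, so that the
    derivative is an integral of the same kind and differentiation can be repeated. *)
Lemma Cdiff_Cauchy_kernel (K gamma : R -> C) a b n z : a <= b ->
  (forall t, a <= t <= b -> ccont K t) -> (forall t, a <= t <= b -> ccont gamma t) ->
  (forall t, a <= t <= b -> gamma t <> z) ->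
  Cdiff (fun w => CInt (fun t => K t * (/ (gamma t - w)) ^ n)%C a b) z
    (INR n * CInt (fun t => K t * (/ (gamma t - z)) ^ (S n))%C a b).
Proof.
  intros Hab HK Hg HN.
  destruct (CInt_kernel_taylor K (fun t => gamma t - z)%C a b n Hab HK) as (m & M & Hm & HM & H).
  { intros t Ht; apply ccont_minus; [auto|apply ccont_const]. }
  { intros t Ht; apply Cminus_neq_0; auto. }
  apply (Cdiff_quadratic _ _ _ m M Hm). intros h Hh.
  destruct (H (fun _ => - h)%C (Cmod h)) as [_ B].
  { intros; apply ccont_const. } { assumption. } { intros; rewrite Cmod_opp; lra. }
  eapply Rle_trans; [|exact B]. apply Req_le. f_equal.
  assert (E1 : CInt (fun t => K t * (/ (gamma t - (z + h))) ^ n)%C a b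
             = CInt (fun t => K t * (/ (gamma t - z + - h)) ^ n)%C a b).
  { unfold CInt; f_equal; apply RInt_ext; intros t _;
    replace (gamma t - (z + h))%C with (gamma t - z + - h)%C by ring; reflexivity. }
  assert (E2 : CInt (fun t => K t * - h * (/ (gamma t - z)) ^ (S n))%C a b
             = (- h * CInt (fun t => K t * (/ (gamma t - z)) ^ (S n))%C a b)%C).
  { apply is_CInt_unique.
    apply (is_CInt_ext (fun t => - h * (K t * (/ (gamma t - z)) ^ (S n)))%C); [assumption|intros; ring|].
    apply is_CInt_scal, is_CInt_ccont; [assumption|]. intros t Ht.
    apply ccont_kernel; auto. apply ccont_minus; [auto|apply ccont_const]. apply Cminus_neq_0; auto. }
  rewrite E1, E2. ring.
Qed.

(** * Goursat's lemma and primitives *)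

Lemma is_CInt_comp_lin f u v a b l : is_CInt f (u * a + v) (u * b + v) l ->
  is_CInt (fun y => RtoC u * f (u * y + v)%R)%C a b l.
Proof.
  intros [H1 H2]; split; simpl.
  - eapply (is_RInt_ext (V := R_NormedModule)).
    2: exact (is_RInt_comp_lin (V := R_NormedModule) _ _ _ _ _ _ H1).
    intros t _. change (u * fst (f (u * t + v)) = u * fst (f (u * t + v)) - 0 * snd (f (u * t + v))). ring.
  - eapply (is_RInt_ext (V := R_NormedModule)).
    2: exact (is_RInt_comp_lin (V := R_NormedModule) _ _ _ _ _ _ H2).
    intros t _. change (u * snd (f (u * t + v)) = u * snd (f (u * t + v)) + 0 * fst (f (u * t + v))). ring.
Qed.

Lemma is_CInt_swap f a b l : is_CInt f a b l -> is_CInt f b a (- l)%C.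
Proof.
  intros [H1 H2]; split.
  - exact (is_RInt_swap (V := R_NormedModule) _ _ _ _ H1).
  - exact (is_RInt_swap (V := R_NormedModule) _ _ _ _ H2).
Qed.

Lemma is_CInt_const (c : C) a b : is_CInt (fun _ => c) a b (RtoC (b - a) * c).
Proof.
  split; simpl.
  - replace ((b - a) * fst c - 0 * snd c) with ((b - a) * fst c) by ring.
    exact (is_RInt_const (V := R_NormedModule) a b (fst c)).
  - replace ((b - a) * snd c + 0 * fst c) with ((b - a) * snd c) by ring.
    exact (is_RInt_const (V := R_NormedModule) a b (snd c)).
Qed.

Definition seg (p q : C) (t : R) : C := (p + RtoC t * (q - p))%C.
Definition sint (g : C -> C) (p q : C) : C := CInt (fun t => g (seg p q t) * (q - p))%C 0 1.
Definition tri (g : C -> C) (p q r : C) : C := (sint g p q + sint g q r + sint g r p)%C.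

(** A square, because convexity is then checked coordinate by coordinate; closed, because the limit
    point of the nested triangles must stay inside. *)
Definition box (a : C) (rho : R) (z : C) : Prop :=
  Rabs (fst z - fst a) <= rho /\ Rabs (snd z - snd a) <= rho.

Lemma seg_0 p q : seg p q 0 = p.
Proof. unfold seg; ring. Qed.

Lemma seg_1 p q : seg p q 1 = q.
Proof. unfold seg; ring. Qed.

Lemma Cpath_seg p q t : Cpath (seg p q) t (q - p).
Proof. split; unfold seg; simpl; auto_derive; trivial; ring. Qed.

Lemma ccont_seg p q t : ccont (seg p q) t.
Proof. eapply Cpath_ccont, Cpath_seg. Qed.

Lemma abs_convex (x y c rho t : R) : 0 <= t <= 1 -> Rabs (x - c) <= rho -> Rabs (y - c) <= rho ->
  Rabs (x + t * (y - x) - c) <= rho.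
Proof.
  intros Ht Hx Hy. apply Rabs_le_between in Hx. apply Rabs_le_between in Hy.
  apply Rabs_le_between. nra.
Qed.

Lemma seg_box a rho p q t : 0 <= t <= 1 -> box a rho p -> box a rho q -> box a rho (seg p q t).
Proof.
  intros Ht [H1 H2] [H3 H4]; split; unfold seg; simpl.
  - replace (fst p + (t * (fst q + - fst p) - 0 * (snd q + - snd p))) with (fst p + t * (fst q - fst p)) by ring.
    now apply abs_convex.
  - replace (snd p + (t * (snd q + - snd p) + 0 * (fst q + - fst p))) with (snd p + t * (snd q - snd p)) by ring.
    now apply abs_convex.
Qed.

Lemma seg_dist p q t : 0 <= t <= 1 -> Cmod (seg p q t - p) <= Cmod (q - p).
Proof.
  intros Ht. unfold seg. replace (p + t * (q - p) - p)%C with (t * (q - p))%C by ring.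
  rewrite Cmod_mult, Cmod_R, Rabs_pos_eq by lra. generalize (Cmod_ge_0 (q - p)); nra.
Qed.

Lemma RtoC_m1 : RtoC (-1) = (- RtoC 1)%C.
Proof. unfold RtoC, Copp; simpl; f_equal; ring. Qed.

Section Segments.
Variables (g : C -> C) (a : C) (rho : R).
Hypothesis Hg : forall z, box a rho z -> ccont (T := CT) g z.

Lemma is_CInt_sint p q : box a rho p -> box a rho q ->
  is_CInt (fun t => g (seg p q t) * (q - p))%C 0 1 (sint g p q).
Proof.
  intros Hp Hq. apply is_CInt_ccont; [lra|]. intros t Ht.
  apply ccont_mult; [|apply ccont_const].
  apply ccont_comp; [apply Hg; now apply seg_box|apply ccont_seg].
Qed.

Lemma sint_swap p q : box a rho p -> box a rho q -> sint g q p = (- sint g p q)%C.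
Proof.
  intros Hp Hq. apply is_CInt_unique.
  assert (I := is_CInt_swap _ _ _ _ (is_CInt_sint p q Hp Hq)).
  assert (J := is_CInt_comp_lin (fun t => g (seg p q t) * (q - p))%C (-1) 1 0 1 (- sint g p q)%C).
  replace (-1 * 0 + 1) with 1 in J by ring. replace (-1 * 1 + 1) with 0 in J by ring.
  eapply is_CInt_ext; [lra| |exact (J I)]. intros t _. simpl.
  replace (seg p q (-1 * t + 1)) with (seg q p t).
  - rewrite RtoC_m1. ring.
  - unfold seg. rewrite RtoC_plus, RtoC_mult, RtoC_m1. ring.
Qed.

Lemma half_C : RtoC (/ 2) = (/ RtoC 2)%C.
Proof. apply RtoC_inv. lra. Qed.

Definition mid (p q : C) : C := (RtoC (/ 2) * (p + q))%C.

Lemma mid_seg p q : mid p q = seg p q (/ 2).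
Proof. unfold mid, seg. rewrite half_C. field. Qed.

Lemma mid_box p q : box a rho p -> box a rho q -> box a rho (mid p q).
Proof. rewrite mid_seg. apply seg_box. lra. Qed.

Lemma sint_mid p q : box a rho p -> box a rho q ->
  sint g p q = (sint g p (mid p q) + sint g (mid p q) q)%C.
Proof.
  intros Hp Hq.
  assert (F : forall t, 0 <= t <= 1 -> ccont (fun t => g (seg p q t) * (q - p))%C t).
  { intros t Ht. apply ccont_mult; [|apply ccont_const].
    apply ccont_comp; [apply Hg; now apply seg_box|apply ccont_seg]. }
  assert (I1 : is_CInt (fun t => g (seg p q t) * (q - p))%C 0 (/ 2) (sint g p (mid p q))).
  { replace (sint g p (mid p q)) with (CInt (fun t => g (seg p q t) * (q - p))%C 0 (/ 2)).
    { apply is_CInt_ccont; [lra|]. intros; apply F; lra. }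
    symmetry. apply is_CInt_unique.
    eapply is_CInt_ext; [lra| |refine (is_CInt_comp_lin (fun t => g (seg p q t) * (q - p))%C (/ 2) 0 0 1 _ _)].
    - intros t _. simpl.
      replace (seg p q (/ 2 * t + 0)) with (seg p (mid p q) t).
      + unfold mid. rewrite half_C. field.
      + unfold seg, mid. rewrite RtoC_plus, RtoC_mult, half_C. field.
    - replace (/ 2 * 0 + 0) with 0 by ring. replace (/ 2 * 1 + 0) with (/ 2) by ring.
      apply is_CInt_ccont; [lra|]. intros; apply F; lra. }
  assert (I2 : is_CInt (fun t => g (seg p q t) * (q - p))%C (/ 2) 1 (sint g (mid p q) q)).
  { replace (sint g (mid p q) q) with (CInt (fun t => g (seg p q t) * (q - p))%C (/ 2) 1).
    { apply is_CInt_ccont; [lra|]. intros; apply F; lra. }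
    symmetry. apply is_CInt_unique.
    eapply is_CInt_ext; [lra| |refine (is_CInt_comp_lin (fun t => g (seg p q t) * (q - p))%C (/ 2) (/ 2) 0 1 _ _)].
    - intros t _. simpl.
      replace (seg p q (/ 2 * t + / 2)) with (seg (mid p q) q t).
      + unfold mid. rewrite half_C. field.
      + unfold seg, mid. rewrite RtoC_plus, RtoC_mult, half_C. field.
    - replace (/ 2 * 0 + / 2) with (/ 2) by ring. replace (/ 2 * 1 + / 2) with 1 by field.
      apply is_CInt_ccont; [lra|]. intros; apply F; lra. }
  apply is_CInt_unique. exact (is_CInt_Chasles _ _ _ _ _ _ I1 I2).
Qed.

(** The sides of the middle triangle are each traversed twice, in opposite directions. *)
Lemma tri_split p q r : box a rho p -> box a rho q -> box a rho r ->
  tri g p q r = (tri g p (mid p q) (mid r p) + tri g (mid p q) q (mid q r)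
    + tri g (mid r p) (mid q r) r + tri g (mid p q) (mid q r) (mid r p))%C.
Proof.
  intros Hp Hq Hr. unfold tri.
  assert (H1 := mid_box _ _ Hp Hq). assert (H2 := mid_box _ _ Hq Hr). assert (H3 := mid_box _ _ Hr Hp).
  rewrite (sint_mid p q Hp Hq), (sint_mid q r Hq Hr), (sint_mid r p Hr Hp).
  rewrite (sint_swap (mid p q) (mid r p)), (sint_swap (mid q r) (mid p q)), (sint_swap (mid r p) (mid q r)) by assumption.
  ring.
Qed.
End Segments.

Lemma sint_bound g a rho p q M : (forall z, box a rho z -> ccont (T := CT) g z) ->
  box a rho p -> box a rho q -> (forall t, 0 <= t <= 1 -> Cmod (g (seg p q t)) <= M) ->
  Cmod (sint g p q) <= 2 * (M * Cmod (q - p)).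
Proof.
  intros Hg Hp Hq HM.
  replace (M * Cmod (q - p)) with ((1 - 0) * (M * Cmod (q - p))) by ring.
  refine (is_CInt_bound _ _ _ _ _ _ _ (is_CInt_sint g a rho Hg p q Hp Hq)); [lra|].
  intros t Ht. rewrite Cmod_mult. apply Rmult_le_compat_r; [apply Cmod_ge_0|auto].
Qed.

Definition aff (A l c : C) (w : C) : C := (A + l * (w - c))%C.

Lemma Cdiff_lin c z : Cdiff (fun w => w - c)%C z 1.
Proof.
  replace (RtoC 1) with (1 - 0)%C by ring. apply Cdiff_minus; [apply Cdiff_id|apply Cdiff_const].
Qed.

Lemma ccont_aff A l c z : ccont (T := CT) (aff A l c) z.
Proof.
  apply ccont_plus; [apply ccont_const|]. apply ccont_mult; [apply ccont_const|].
  apply ccont_minus; [apply ccont_id|apply ccont_const].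
Qed.

(** An affine function has the quadratic primitive [P], so the three side integrals telescope.
    Goursat's lemma compares [g] with its affine approximation at the limit point. *)
Lemma tri_aff A l c p q r : tri (aff A l c) p q r = 0.
Proof.
  set (P := fun w => (A * w + (/ 2 * l) * ((w - c) * (w - c)))%C).
  assert (HP : forall z, Cdiff P z (aff A l c z)).
  { intros z. unfold P.
    replace (aff A l c z) with (A * 1 + (/ 2 * l) * (1 * (z - c) + (z - c) * 1))%C
      by (unfold aff; field).
    apply Cdiff_plus; [apply Cdiff_scal, Cdiff_id|].
    apply Cdiff_scal, (Cdiff_mult (fun w => w - c)%C (fun w => w - c)%C); apply Cdiff_lin. }
  assert (HS : forall p q, sint (aff A l c) p q = (P q - P p)%C).
  { intros x y. rewrite <- (seg_1 x y) at 2. rewrite <- (seg_0 x y) at 3.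
    apply is_CInt_unique, (is_CInt_FTC P (aff A l c) (seg x y) (fun _ => y - x)%C); [lra| | |].
    - intros; apply Cpath_seg.
    - intros; apply HP.
    - intros t _. apply ccont_mult; [|apply ccont_const]. apply ccont_comp; [apply ccont_aff|apply ccont_seg]. }
  unfold tri. rewrite !HS. ring.
Qed.

Lemma tri_close g g' a rho p q r M L :
  (forall z, box a rho z -> ccont (T := CT) g z) -> (forall z, box a rho z -> ccont (T := CT) g' z) ->
  box a rho p -> box a rho q -> box a rho r ->
  (forall x y t, In x (p :: q :: r :: nil) -> In y (p :: q :: r :: nil) -> 0 <= t <= 1 ->
     Cmod (g (seg x y t) - g' (seg x y t)) <= M) ->
  Cmod (q - p) <= L -> Cmod (r - q) <= L -> Cmod (p - r) <= L -> 0 <= M ->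
  Cmod (tri g p q r - tri g' p q r) <= 6 * (M * L).
Proof.
  intros Hg Hg' Hp Hq Hr HM L1 L2 L3 HM0.
  assert (S : forall x y, In x (p :: q :: r :: nil) -> In y (p :: q :: r :: nil) ->
     box a rho x -> box a rho y -> Cmod (y - x) <= L ->
     Cmod (sint g x y - sint g' x y) <= 2 * (M * L)).
  { intros x y Ix Iy Hx Hy HL.
    assert (E : (sint g x y - sint g' x y)%C = sint (fun w => g w - g' w)%C x y).
    { symmetry. apply is_CInt_unique.
      eapply is_CInt_ext; [lra| |exact (is_CInt_minus _ _ _ _ _ _
         (is_CInt_sint g a rho Hg x y Hx Hy) (is_CInt_sint g' a rho Hg' x y Hx Hy))].
      intros t _. simpl. ring. }
    rewrite E. eapply Rle_trans.
    - apply (sint_bound _ a rho _ _ M); try assumption; [|intros; now apply HM].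
      intros z Hz. apply ccont_minus; auto.
    - apply Rmult_le_compat_l; [lra|]. now apply Rmult_le_compat_l. }
  unfold tri.
  replace (sint g p q + sint g q r + sint g r p - (sint g' p q + sint g' q r + sint g' r p))%C with
    ((sint g p q - sint g' p q) + (sint g q r - sint g' q r) + (sint g r p - sint g' r p))%C by ring.
  eapply Rle_trans; [apply Cmod_triangle|]. eapply Rle_trans; [apply Rplus_le_compat_r, Cmod_triangle|].
  assert (A1 := S p q). assert (A2 := S q r). assert (A3 := S r p). simpl in A1, A2, A3.
  assert (B1 : Cmod (sint g p q - sint g' p q) <= 2 * (M * L)) by (apply A1; tauto).
  assert (B2 : Cmod (sint g q r - sint g' q r) <= 2 * (M * L)) by (apply A2; tauto).
  assert (B3 : Cmod (sint g r p - sint g' r p) <= 2 * (M * L)) by (apply A3; tauto).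
  lra.
Qed.

(** * Nested bisection and Goursat's lemma *)

Lemma dependent_choice {A : Type} (Inv : nat -> A -> Prop) (Rel : nat -> A -> A -> Prop) (x0 : A) :
  Inv 0%nat x0 -> (forall n x, Inv n x -> exists y, Inv (S n) y /\ Rel n x y) ->
  exists f, f 0%nat = x0 /\ forall n, Inv n (f n) /\ Rel n (f n) (f (S n)).
Proof.
  intros H0 HS.
  (* The invariant travels with the point in a sigma type, since a successor can be chosen only
     where it holds. *)
  pose (step := fun n (x : {x | Inv n x}) =>
    let s := constructive_indefinite_description _ (HS n (proj1_sig x) (proj2_sig x)) in
    exist (Inv (S n)) (proj1_sig s) (proj1 (proj2_sig s))).
  pose (F := nat_rect (fun n => {x | Inv n x}) (exist _ x0 H0) step).
  exists (fun n => proj1_sig (F n)). split; [reflexivity|]. intros n. split.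
  - exact (proj2_sig (F n)).
  - simpl. destruct (constructive_indefinite_description _ _) as [y [Hy1 Hy2]]. exact Hy2.
Qed.

Lemma pow2_pos n : 0 < / 2 ^ n.
Proof. apply Rinv_0_lt_compat, pow_lt. lra. Qed.

Lemma pow2_S n : / 2 ^ (S n) = / 2 * / 2 ^ n.
Proof. simpl. rewrite Rinv_mult. reflexivity. Qed.

Lemma pow2_small eps : 0 < eps -> exists n, / 2 ^ n < eps.
Proof.
  intros Heps. destruct (pow_lt_1_zero (/ 2)) with (y := eps) as [N HN]; [|assumption|].
  - rewrite Rabs_pos_eq; lra.
  - exists N. specialize (HN N (le_n N)). rewrite <- pow_inv.
    eapply Rle_lt_trans; [apply Rle_abs|exact HN].
Qed.

(** The future steps from [n] on add up to at most [2 L / 2^n], so [v] increases, [w] decreases, and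
    every [v] lies below every [w]. The supremum of [v] is the limit and the envelopes give the
    rate. *)
Lemma halving_limit (u : nat -> R) L : 0 <= L ->
  (forall n, Rabs (u (S n) - u n) <= L * / 2 ^ n) ->
  exists c, forall n, Rabs (u n - c) <= 2 * L * / 2 ^ n.
Proof.
  intros HL Hu.
  set (v := fun n => u n - 2 * L * / 2 ^ n). set (w := fun n => u n + 2 * L * / 2 ^ n).
  assert (Hv : forall n k, v n <= v (n + k)%nat).
  { intros n k. induction k as [|k IH]; [rewrite Nat.add_0_r; lra|].
    rewrite Nat.add_succ_r. eapply Rle_trans; [exact IH|]. specialize (Hu (n + k)%nat). unfold v.
    apply Rabs_le_between in Hu. rewrite pow2_S. lra. }
  assert (Hw : forall n k, w (n + k)%nat <= w n).
  { intros n k. induction k as [|k IH]; [rewrite Nat.add_0_r; lra|].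
    rewrite Nat.add_succ_r. eapply Rle_trans; [|exact IH]. specialize (Hu (n + k)%nat). unfold w.
    apply Rabs_le_between in Hu. rewrite pow2_S. lra. }
  assert (Hvw : forall n m, v n <= w m).
  { intros n m. apply Rle_trans with (v (n + m)%nat); [apply Hv|].
    apply Rle_trans with (w (n + m)%nat).
    - unfold v, w. generalize (pow2_pos (n + m)). nra.
    - rewrite Nat.add_comm. apply Hw. }
  destruct (completeness (fun x => exists n, x = v n)) as [c [Hc1 Hc2]].
  - exists (w 0%nat). intros x [n ->]. apply Hvw.
  - exists (v 0%nat). now exists 0%nat.
  - exists c. intros n. apply Rabs_le_between.
    assert (v n <= c) by (apply Hc1; now exists n).
    assert (c <= w n) by (apply Hc2; intros x [m ->]; apply Hvw).
    unfold v, w in *. lra.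
Qed.

Lemma le_halving x y K : (forall n, x <= y + K * / 2 ^ n) -> x <= y.
Proof.
  intros H. apply Rnot_lt_le. intros N.
  destruct (pow2_small ((x - y) / (Rabs K + 1))) as [n Hn].
  { apply Rdiv_lt_0_compat; [lra|generalize (Rabs_pos K); lra]. }
  specialize (H n). assert (P := pow2_pos n). assert (A := Rle_abs K). assert (B := Rabs_pos K).
  assert (/ 2 ^ n * (Rabs K + 1) < x - y).
  { apply Rlt_le_trans with ((x - y) / (Rabs K + 1) * (Rabs K + 1)).
    - apply Rmult_lt_compat_r; lra.
    - apply Req_le; field; lra. }
  nra.
Qed.

Lemma Cmod_mid_l p q L : Cmod (q - p) <= L -> Cmod (mid p q - p) <= L / 2.
Proof.
  intros H. replace (mid p q - p)%C with (RtoC (/ 2) * (q - p))%C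
    by (unfold mid; rewrite half_C; field).
  rewrite Cmod_mult, Cmod_R, Rabs_pos_eq; lra.
Qed.

Lemma Cmod_sym p q : Cmod (p - q) = Cmod (q - p).
Proof. rewrite <- Cmod_opp. f_equal. ring. Qed.

Lemma mid_sym p q : mid p q = mid q p.
Proof. unfold mid. ring. Qed.

Lemma Cmod_mid_mid p q r L : Cmod (r - q) <= L -> Cmod (mid p r - mid p q) <= L / 2.
Proof.
  intros H. replace (mid p r - mid p q)%C with (RtoC (/ 2) * (r - q))%C by (unfold mid; ring).
  rewrite Cmod_mult, Cmod_R, Rabs_pos_eq; lra.
Qed.

(** If the integral is [eta] in modulus, repeated bisection keeps a triangle with integral at least
    [eta / 4^n] and sides at most [L / 2^n]. At the limit point [c], differentiability makes the
    integral of [g] minus its affine part at most [36 eps L^2 / 4^n], which is too small. *)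
Lemma goursat g a rho : (forall z, box a rho z -> exists l, Cdiff g z l) ->
  forall p q r, box a rho p -> box a rho q -> box a rho r -> tri g p q r = 0.
Proof.
  intros Hd p q r Hp Hq Hr.
  assert (Hg : forall z, box a rho z -> ccont (T := CT) g z).
  { intros z Hz. destruct (Hd z Hz) as [l Hl]. eapply Cdiff_ccont; exact Hl. }
  apply NNPP. intros N. apply Cmod_gt_0 in N. set (eta := Cmod (tri g p q r)) in *.
  set (L := Cmod (q - p) + Cmod (r - q) + Cmod (p - r)).
  assert (L1 := Cmod_ge_0 (q - p)). assert (L2 := Cmod_ge_0 (r - q)). assert (L3 := Cmod_ge_0 (p - r)).
  assert (HL : 0 <= L) by (unfold L; lra).
  set (Inv := fun n (T : C * C * C) => let '(p, q, r) := T in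
    box a rho p /\ box a rho q /\ box a rho r /\
    Cmod (q - p) <= L * / 2 ^ n /\ Cmod (r - q) <= L * / 2 ^ n /\ Cmod (p - r) <= L * / 2 ^ n /\
    eta * (/ 2 ^ n * / 2 ^ n) <= Cmod (tri g p q r)).
  (* Controlling the motion of one vertex gives a limit point; the others follow because the sides
     shrink. *)
  set (Rel := fun n (T T' : C * C * C) => Cmod (fst (fst T') - fst (fst T)) <= L * / 2 ^ n).
  destruct (dependent_choice Inv Rel (p, q, r)) as (F & _ & HF).
  { unfold Inv. simpl. rewrite Rinv_1. repeat split; try apply Hp; try apply Hq; try apply Hr;
    unfold L, eta; lra. }
  { intros n [[x y] z] (Hx & Hy & Hz & A1 & A2 & A3 & A4).
    assert (B1 := mid_box a rho _ _ Hx Hy). assert (B2 := mid_box a rho _ _ Hy Hz).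
    assert (B3 := mid_box a rho _ _ Hz Hx).
    rewrite (tri_split g a rho Hg x y z Hx Hy Hz) in A4.
    assert (HLn : 0 <= L * / 2 ^ n) by (generalize (pow2_pos n); nra).
    assert (ES : L * / 2 ^ S n = L * / 2 ^ n / 2) by (rewrite pow2_S; field; apply pow_nonzero; lra).
    assert (EE : eta * (/ 2 ^ S n * / 2 ^ S n) = eta * (/ 2 ^ n * / 2 ^ n) / 4)
      by (rewrite pow2_S; field; apply pow_nonzero; lra).
    set (Ln := L * / 2 ^ n) in *. set (En := eta * (/ 2 ^ n * / 2 ^ n)) in *.
    assert (T4 : En <= Cmod (tri g x (mid x y) (mid z x)) + Cmod (tri g (mid x y) y (mid y z))
       + Cmod (tri g (mid z x) (mid y z) z) + Cmod (tri g (mid x y) (mid y z) (mid z x))).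
    { eapply Rle_trans; [exact A4|]. eapply Rle_trans; [apply Cmod_triangle|].
      apply Rplus_le_compat_r. eapply Rle_trans; [apply Cmod_triangle|].
      apply Rplus_le_compat_r. apply Cmod_triangle. }
    assert (m1 : Cmod (mid x y - x) <= Ln / 2) by (now apply Cmod_mid_l).
    assert (m1' : Cmod (y - mid x y) <= Ln / 2) by (rewrite Cmod_sym, mid_sym; apply Cmod_mid_l; now rewrite Cmod_sym).
    assert (m2 : Cmod (mid y z - y) <= Ln / 2) by (now apply Cmod_mid_l).
    assert (m2' : Cmod (z - mid y z) <= Ln / 2) by (rewrite Cmod_sym, mid_sym; apply Cmod_mid_l; now rewrite Cmod_sym).
    assert (m3 : Cmod (mid z x - z) <= Ln / 2) by (now apply Cmod_mid_l).
    assert (m3' : Cmod (x - mid z x) <= Ln / 2) by (rewrite Cmod_sym, mid_sym; apply Cmod_mid_l; now rewrite Cmod_sym).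
    assert (k1 : Cmod (mid z x - mid x y) <= Ln / 2)
      by (rewrite (mid_sym z x); now apply Cmod_mid_mid).
    assert (k2 : Cmod (mid x y - mid y z) <= Ln / 2)
      by (rewrite (mid_sym x y); now apply Cmod_mid_mid).
    assert (k3 : Cmod (mid y z - mid z x) <= Ln / 2)
      by (rewrite (mid_sym y z); now apply Cmod_mid_mid).
    destruct (Rle_dec (En / 4) (Cmod (tri g x (mid x y) (mid z x)))) as [C1|C1].
    { exists (x, mid x y, mid z x). unfold Inv, Rel. simpl fst. rewrite ES, EE. fold Ln En.
      repeat split; try apply Hx; try apply B1; try apply B3; try assumption.
      rewrite Cmod_diag. assumption. }
    destruct (Rle_dec (En / 4) (Cmod (tri g (mid x y) y (mid y z)))) as [C2|C2].
    { exists (mid x y, y, mid y z). unfold Inv, Rel. simpl fst. rewrite ES, EE. fold Ln En.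
      repeat split; try apply Hy; try apply B1; try apply B2; try assumption; lra. }
    destruct (Rle_dec (En / 4) (Cmod (tri g (mid z x) (mid y z) z))) as [C3|C3].
    { exists (mid z x, mid y z, z). unfold Inv, Rel. simpl fst. rewrite ES, EE. fold Ln En.
      repeat split; try apply Hz; try apply B3; try apply B2; try assumption.
      rewrite Cmod_sym. lra. }
    (* By [T4], when all three corner triangles fall short of a quarter of [En], the middle one does
       not. *)
    exists (mid x y, mid y z, mid z x). unfold Inv, Rel. simpl fst. rewrite ES, EE. fold Ln En.
    repeat split; try apply B1; try apply B3; try apply B2; try (rewrite Cmod_sym; assumption); lra. }
  set (P := fun n => fst (fst (F n))).
  assert (HPn : forall n, Cmod (P (S n) - P n) <= L * / 2 ^ n) by (intros n; apply HF).
  destruct (halving_limit (fun n => fst (P n)) L HL) as [c1 Hc1].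
  { intros n. eapply Rle_trans; [|apply HPn]. eapply Rle_trans; [|apply Cmod_fst]. apply Req_le; reflexivity. }
  destruct (halving_limit (fun n => snd (P n)) L HL) as [c2 Hc2].
  { intros n. eapply Rle_trans; [|apply HPn]. eapply Rle_trans; [|apply Cmod_snd]. apply Req_le; reflexivity. }
  set (c := (c1, c2) : C).
  assert (HPc : forall n, Cmod (P n - c) <= 4 * (L * / 2 ^ n)).
  { intros n. eapply Rle_trans; [apply Cmod_le_abs|]. specialize (Hc1 n). specialize (Hc2 n).
    change (Rabs (fst (P n) - c1) + Rabs (snd (P n) - c2) <= 4 * (L * / 2 ^ n)). lra. }
  assert (HPb : forall n, box a rho (P n)).
  { intros n. destruct (HF n) as [I _]. unfold P. destruct (F n) as [[x y] z]. apply I. }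
  assert (Hcb : box a rho c).
  { split; apply le_halving with (2 * L); intros n; destruct (HPb n) as [Q1 Q2].
    - specialize (Hc1 n). simpl. revert Q1 Hc1. unfold Rabs; repeat destruct Rcase_abs; lra.
    - specialize (Hc2 n). simpl. revert Q2 Hc2. unfold Rabs; repeat destruct Rcase_abs; lra. }
  destruct (Hd c Hcb) as [l Hl].
  (* The three sides, the factor 2 of [sint_bound] and the distance [6 * Ln] to [c] make 36; with 72
     the bound is at most half of [eta / 4^n]. The added 1 covers [L = 0]. *)
  assert (Heps : 0 < eta / (72 * (L * L + 1))) by (apply Rdiv_lt_0_compat; nra).
  destruct (Hl _ Heps) as (d & Hdp & Hw). set (eps := eta / (72 * (L * L + 1))) in *.
  destruct (pow2_small (d / (6 * L + 1))) as [n Hn].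
  { apply Rdiv_lt_0_compat; lra. }
  assert (Pn := pow2_pos n).
  assert (Hn6 : 6 * (L * / 2 ^ n) < d).
  { apply Rlt_le_trans with (d / (6 * L + 1) * (6 * L + 1)); [|apply Req_le; field; lra].
    nra. }
  destruct (HF n) as [I _]. specialize (HPc n). unfold P in HPc. destruct (F n) as [[x y] z]. simpl in HPc.
  destruct I as (Hx & Hy & Hz & A1 & A2 & A3 & A4).
  set (Ln := L * / 2 ^ n) in *.
  assert (HLn : 0 <= Ln) by (unfold Ln; nra).
  assert (Vx : forall v, In v (x :: y :: z :: nil) -> Cmod (v - x) <= Ln).
  { simpl. intros v [<-|[<-|[<-|[]]]].
    - rewrite Cmod_diag; assumption.
    - assumption.
    - now rewrite Cmod_sym. }
  assert (VV : forall v w, In v (x :: y :: z :: nil) -> In w (x :: y :: z :: nil) -> Cmod (w - v) <= Ln).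
  { assert (Z : forall v : C, Cmod (v - v) <= Ln).
    { intros v. rewrite Cmod_diag; assumption. }
    simpl. intros v w [<-|[<-|[<-|[]]]] [<-|[<-|[<-|[]]]]; try apply Z; try assumption; now rewrite Cmod_sym. }
  assert (B := tri_close g (aff (g c) l c) a rho x y z (eps * (6 * Ln)) Ln Hg
     (fun z _ => ccont_aff _ _ _ z) Hx Hy Hz).
  rewrite tri_aff in B. replace (tri g x y z - 0)%C with (tri g x y z) in B by ring.
  assert (B' : Cmod (tri g x y z) <= 6 * (eps * (6 * Ln) * Ln)).
  { apply B; try assumption.
    - intros v w t Iv Iw Ht. unfold aff.
      (* At most [Ln] along the side, [Ln] from [v] to the first vertex, and [4 * Ln] from there to
         [c]. *)
      assert (D : Cmod (seg v w t - c) <= 6 * Ln).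
      { replace (seg v w t - c)%C with ((seg v w t - v) + ((v - x) + (x - c)))%C by ring.
        eapply Rle_trans; [apply Cmod_triangle|]. eapply Rle_trans; [apply Rplus_le_compat_l, Cmod_triangle|].
        generalize (seg_dist v w t Ht) (VV v w Iv Iw) (Vx v Iv). lra. }
      replace (g (seg v w t) - (g c + l * (seg v w t - c)))%C with
        (g (seg v w t) - g c - l * (seg v w t - c))%C by ring.
      eapply Rle_trans; [apply Hw; lra|]. apply Rmult_le_compat_l; lra.
    - apply Rmult_le_pos; lra. }
  assert (E : 6 * (eps * (6 * Ln) * Ln) = 36 * eps * (L * L) * (/ 2 ^ n * / 2 ^ n)) by (unfold Ln; ring).
  rewrite E in B'.
  assert (P2 : 0 < / 2 ^ n * / 2 ^ n) by nra.
  assert (36 * eps * (L * L) < eta).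
  { apply Rle_lt_trans with (eta / 2); [|lra]. unfold eps.
    replace (36 * (eta / (72 * (L * L + 1))) * (L * L)) with (eta / 2 * (L * L / (L * L + 1))) by (field; nra).
    assert (L * L / (L * L + 1) <= 1).
    { apply Rmult_le_reg_r with (L * L + 1); [nra|]. unfold Rdiv; rewrite Rmult_assoc, Rinv_l by nra. nra. }
    nra. }
  assert (36 * eps * (L * L) * (/ 2 ^ n * / 2 ^ n) < eta * (/ 2 ^ n * / 2 ^ n)) by now apply Rmult_lt_compat_r.
  lra.
Qed.

Lemma box_of_Cmod a rho z : Cmod (z - a) <= rho -> box a rho z.
Proof.
  intros H. split.
  - eapply Rle_trans; [|exact H]. exact (Cmod_fst (z - a)).
  - eapply Rle_trans; [|exact H]. exact (Cmod_snd (z - a)).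
Qed.

(** The primitive integrates along the segment from the centre. Goursat's lemma on the triangle [a],
    [z], [w] turns its increment into the integral over the segment from [z] to [w], where [g] is
    close to [g z]. *)
Lemma Cprimitive g a rho : (forall z, box a rho z -> exists l, Cdiff g z l) ->
  exists P, forall z, Cmod (z - a) < rho -> Cdiff P z (g z).
Proof.
  intros Hd. exists (sint g a). intros z Hz.
  assert (Hg : forall z, box a rho z -> ccont (T := CT) g z).
  { intros w Hw. destruct (Hd w Hw) as [l Hl]. eapply Cdiff_ccont; exact Hl. }
  assert (Hrho : 0 < rho) by (generalize (Cmod_ge_0 (z - a)); lra).
  assert (Ha : box a rho a).
  { apply box_of_Cmod. rewrite Cmod_diag; lra. }
  assert (Hzb : box a rho z) by (apply box_of_Cmod; lra).
  intros eps Heps. assert (He4 : 0 < eps / 4) by lra.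
  assert (Hc := Hg z Hzb). apply ccont_eps with (eps := eps / 4) in Hc; [|assumption].
  apply locally_Cmod in Hc. destruct Hc as (d & Hdp & Hw).
  exists (Rmin d (rho - Cmod (z - a))). split; [apply Rmin_pos; lra|].
  intros w Hwd.
  assert (W1 : Cmod (w - z) < d) by (eapply Rlt_le_trans; [exact Hwd|apply Rmin_l]).
  assert (W2 : Cmod (w - z) < rho - Cmod (z - a)) by (eapply Rlt_le_trans; [exact Hwd|apply Rmin_r]).
  assert (Hwb : box a rho w).
  { apply box_of_Cmod. replace (w - a)%C with ((w - z) + (z - a))%C by ring.
    eapply Rle_trans; [apply Cmod_triangle|]. lra. }
  assert (E : (sint g a w - sint g a z)%C = sint g z w).
  { assert (G := goursat g a rho Hd a z w Ha Hzb Hwb). unfold tri in G.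
    rewrite (sint_swap g a rho Hg a w Ha Hwb) in G.
    replace (sint g z w) with (sint g a z + sint g z w + - sint g a w + (sint g a w - sint g a z))%C by ring.
    rewrite G. ring. }
  rewrite E.
  assert (I := is_CInt_minus _ _ _ _ _ _ (is_CInt_sint g a rho Hg z w Hzb Hwb)
     (is_CInt_ccont (fun _ => g z * (w - z))%C 0 1 Rle_0_1 (fun t _ => ccont_const _ t))).
  assert (Ec : CInt (fun _ => g z * (w - z))%C 0 1 = (g z * (w - z))%C).
  { apply is_CInt_unique. assert (X := is_CInt_const (g z * (w - z))%C 0 1).
    replace (RtoC (1 - 0) * (g z * (w - z)))%C with (g z * (w - z))%C in X by (rewrite RtoC_minus; ring).
    exact X. }
  rewrite Ec in I.
  eapply Rle_trans.
  - refine (is_CInt_bound _ _ _ _ (eps / 4 * Cmod (w - z)) Rle_0_1 _ I).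
    intros t Ht. simpl.
    replace (g (seg z w t) * (w - z) - g z * (w - z))%C with ((g (seg z w t) - g z) * (w - z))%C by ring.
    rewrite Cmod_mult. apply Rmult_le_compat_r; [apply Cmod_ge_0|].
    apply Rlt_le, Hw. eapply Rle_lt_trans; [apply seg_dist; assumption|assumption].
  - generalize (Cmod_ge_0 (w - z)); nra.
Qed.

(** * Cauchy's formula for circles *)

Definition circ (a : C) (r t : R) : C := (fst a + r * cos t, snd a + r * sin t).
Definition circ' (r t : R) : C := (- r * sin t, r * cos t).
Definition tpi : C := (0, 2 * PI).

Lemma tpi_neq_0 : tpi <> 0.
Proof. intros E. apply (f_equal snd) in E. simpl in E. generalize PI_RGT_0. lra. Qed.

Lemma two_PI_pos : 0 <= 2 * PI.
Proof. generalize PI_RGT_0. lra. Qed.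

Lemma Cpath_circ a r t : Cpath (circ a r) t (circ' r t).
Proof. split; unfold circ, circ'; simpl; auto_derive; trivial; ring. Qed.

Lemma ccont_circ a r t : ccont (circ a r) t.
Proof. eapply Cpath_ccont, Cpath_circ. Qed.

Lemma ccont_circ' r t : ccont (circ' r) t.
Proof.
  apply (Cpath_ccont _ _ (- r * cos t, - r * sin t)).
  split; unfold circ'; simpl; auto_derive; trivial; ring.
Qed.

Lemma circ_closed a r : circ a r (2 * PI) = circ a r 0.
Proof. unfold circ. rewrite cos_2PI, sin_2PI, cos_0, sin_0. reflexivity. Qed.

Lemma circ_dist a r t : 0 <= r -> Cmod (circ a r t - a) = r.
Proof.
  intros Hr. unfold Cmod, circ. simpl.
  replace ((fst a + r * cos t + - fst a) * ((fst a + r * cos t + - fst a) * 1) +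
    (snd a + r * sin t + - snd a) * ((snd a + r * sin t + - snd a) * 1))
   with (r * r * (Rsqr (sin t) + Rsqr (cos t))) by (unfold Rsqr; ring).
  rewrite sin2_cos2, Rmult_1_r. now apply sqrt_square.
Qed.

Lemma circ_neq a r t z : Cmod (z - a) < r -> circ a r t <> z.
Proof.
  intros H E. assert (D := circ_dist a r t). rewrite E in D.
  generalize (Cmod_ge_0 (z - a)). intros. rewrite D in H; lra.
Qed.

Lemma circ'_circ a r t : circ' r t = (Ci * (circ a r t - a))%C.
Proof. unfold circ', circ, Ci, Cmult, Cminus, Cplus, Copp; simpl. f_equal; ring. Qed.

(** Not divided by [2 pi i]. The exponent makes the family stable under differentiation in [z],
    which sends [n] to [n] times the integral with exponent [n + 1]. *)
Definition Cauchy_int (g : C -> C) (a : C) (r : R) (n : nat) (z : C) : C :=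
  CInt (fun t => (g (circ a r t) * circ' r t) * (/ (circ a r t - z)) ^ n)%C 0 (2 * PI).

Lemma ccont_g_circ g a r t : ccont (T := CT) g (circ a r t) ->
  ccont (fun t => g (circ a r t) * circ' r t)%C t.
Proof.
  intros H. apply ccont_mult; [|apply ccont_circ'].
  apply ccont_comp; [exact H|apply ccont_circ].
Qed.

Lemma is_CInt_Cauchy_int g a r n z : (forall t, ccont (T := CT) g (circ a r t)) ->
  Cmod (z - a) < r ->
  is_CInt (fun t => (g (circ a r t) * circ' r t) * (/ (circ a r t - z)) ^ n)%C 0 (2 * PI)
    (Cauchy_int g a r n z).
Proof.
  intros Hg Hz. apply is_CInt_ccont; [apply two_PI_pos|]. intros t _.
  apply ccont_kernel; [now apply ccont_g_circ| |].
  - apply ccont_minus; [apply ccont_circ|apply ccont_const].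
  - now apply Cminus_neq_0, circ_neq.
Qed.

Lemma Cdiff_Cauchy_int g a r n z : (forall t, ccont (T := CT) g (circ a r t)) ->
  Cmod (z - a) < r -> Cdiff (Cauchy_int g a r n) z (INR n * Cauchy_int g a r (S n) z).
Proof.
  intros Hg Hz. apply Cdiff_Cauchy_kernel; [apply two_PI_pos| | |].
  - intros; now apply ccont_g_circ.
  - intros; apply ccont_circ.
  - intros; now apply circ_neq.
Qed.

Lemma seg_disc a r p q t : 0 <= t <= 1 -> Cmod (p - a) < r -> Cmod (q - a) < r -> Cmod (seg p q t - a) < r.
Proof.
  intros Ht Hp Hq. unfold seg.
  replace (p + t * (q - p) - a)%C with (RtoC (1 - t) * (p - a) + RtoC t * (q - a))%C
    by (rewrite RtoC_minus; ring).
  eapply Rle_lt_trans; [apply Cmod_triangle|]. rewrite !Cmod_mult, !Cmod_R, !Rabs_pos_eq by lra.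
  destruct (Req_dec t 0) as [->|]; [lra|]. nra.
Qed.

Definition Cone (_ : C) : C := RtoC 1.

Lemma ccont_Cone z : ccont (T := CT) Cone z.
Proof. apply ccont_const. Qed.

(** The [z]-derivative is the integral with exponent 2, whose integrand has a primitive along the
    closed circle; so the integral is constant on the disc. At the centre the integrand is the
    constant [i]. *)
Lemma Cauchy_int_1 a r z : Cmod (z - a) < r -> Cauchy_int Cone a r 1 z = tpi.
Proof.
  intros Hz.
  assert (H2 : forall w, Cmod (w - a) < r -> Cauchy_int Cone a r 2 w = 0).
  { intros w Hw. apply is_CInt_unique.
    assert (I := is_CInt_FTC (fun v => - (1) * / (v - w))%C (fun v => (/ (v - w)) ^ 2)%C
      (circ a r) (circ' r) 0 (2 * PI) two_PI_pos).
    rewrite circ_closed in I.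
    replace (- (1) * / (circ a r 0 - w) - - (1) * / (circ a r 0 - w))%C with (RtoC 0) in I by ring.
    refine (is_CInt_ext _ _ _ _ _ two_PI_pos _ (I _ _ _)).
    - intros t _. unfold Cone. simpl. ring.
    - intros; apply Cpath_circ.
    - intros t _. replace ((/ (circ a r t - w)) ^ 2)%C with
       (- (1) * - (/ (circ a r t - w) * / (circ a r t - w)))%C by (simpl; ring).
      apply Cdiff_scal, Cdiff_inv. now apply circ_neq.
    - intros t _. apply ccont_mult; [|apply ccont_circ'].
      apply ccont_pow, ccont_inv.
      + apply ccont_minus; [apply ccont_circ|apply ccont_const].
      + now apply Cminus_neq_0, circ_neq. }
  assert (Ha : Cmod (a - a) < r).
  { rewrite Cmod_diag. generalize (Cmod_ge_0 (z - a)); lra. }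
  assert (Hcst : Cauchy_int Cone a r 1 z = Cauchy_int Cone a r 1 a).
  { apply Cminus_eq_0.
    assert (I := is_CInt_FTC (Cauchy_int Cone a r 1) (fun _ => RtoC 0)
      (seg a z) (fun _ => z - a)%C 0 1 Rle_0_1).
    rewrite seg_0, seg_1 in I.
    assert (D : forall t, 0 <= t <= 1 -> Cdiff (Cauchy_int Cone a r 1) (seg a z t) 0).
    { intros t Ht. assert (Hs := seg_disc a r a z t Ht Ha Hz).
      assert (X := Cdiff_Cauchy_int Cone a r 1 (seg a z t) (fun _ => ccont_Cone _) Hs).
      rewrite (H2 _ Hs), Cmult_0_r in X. exact X. }
    rewrite <- (is_CInt_unique _ _ _ _ (I (fun t _ => Cpath_seg a z t) D
       (fun t _ => ccont_mult _ _ _ (ccont_const _ _) (ccont_const _ _)))).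
    apply is_CInt_unique.
    eapply is_CInt_ext; [lra| |apply is_CInt_zero]. intros t _. simpl. ring. }
  rewrite Hcst. apply is_CInt_unique.
  assert (I := is_CInt_const Ci 0 (2 * PI)).
  replace (RtoC (2 * PI - 0) * Ci)%C with tpi in I
    by (unfold tpi, RtoC, Ci, Cmult; simpl; f_equal; ring).
  eapply is_CInt_ext; [apply two_PI_pos| |exact I]. intros t _.
  rewrite (circ'_circ a). unfold Cone. simpl. field. now apply Cminus_neq_0, circ_neq.
Qed.

(** Write [g (s) - g (z)] as the integral of [g' * (s - z)] along the segment from [z] to [s]; the
    factor [s - z] cancels the kernel. After exchanging the integrals, the inner one runs, for fixed
    [t], over the circle contracted towards [z] and vanishes because this path is closed. *)
Lemma Cauchy_formula_C1 g g' a rho r z :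
  (forall w, Cmod (w - a) < rho -> Cdiff g w (g' w)) ->
  (forall w, Cmod (w - a) < rho -> ccont (T := CT) g' w) ->
  r < rho -> Cmod (z - a) < r -> Cauchy_int g a r 1 z = (tpi * g z)%C.
Proof.
  intros Hd Hc Hr Hz.
  assert (Hr0 : 0 <= r) by (generalize (Cmod_ge_0 (z - a)); lra).
  assert (Hcirc : forall t, Cmod (circ a r t - a) < rho) by (intros; rewrite circ_dist; lra).
  assert (Hz' : Cmod (z - a) < rho) by lra.
  assert (Hgc : forall t, ccont (T := CT) g (circ a r t)) by (intros; eapply Cdiff_ccont, Hd, Hcirc).
  assert (Hseg : forall th t, 0 <= t <= 1 -> Cmod (seg z (circ a r th) t - a) < rho)
    by (intros; apply seg_disc; auto).
  assert (HK : forall th t, 0 <= t <= 1 -> ccont (T := R2)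
     (fun p => g' (seg z (circ a r (fst p)) (snd p)) * circ' r (fst p))%C (th, t)).
  { intros th t Ht. apply ccont_mult.
    - apply ccont_comp; [apply Hc, Hseg, Ht|].
      unfold seg. apply ccont_plus; [apply ccont_const|]. apply ccont_mult.
      + apply (ccont_snd RtoC (th, t)). apply ccont_RtoC, continuous_id.
      + apply ccont_minus; [|apply ccont_const]. apply (ccont_fst (circ a r) (th, t)), ccont_circ.
    - apply (ccont_fst (circ' r) (th, t)), ccont_circ'. }
  assert (F := CInt_Fubini (fun th t => g' (seg z (circ a r th) t) * circ' r th)%C
     0 (2 * PI) 0 1 two_PI_pos Rle_0_1 (fun th t _ Ht => HK th t Ht)).
  assert (E1 : CInt (fun th => CInt (fun t => g' (seg z (circ a r th) t) * circ' r th)%C 0 1) 0 (2 * PI)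
      = (Cauchy_int g a r 1 z - g z * tpi)%C).
  { apply is_CInt_unique. rewrite <- (Cauchy_int_1 a r z Hz).
    eapply is_CInt_ext; [apply two_PI_pos| |exact (is_CInt_minus _ _ _ _ _ _
      (is_CInt_Cauchy_int g a r 1 z Hgc Hz)
      (is_CInt_scal _ _ _ _ (g z) (is_CInt_Cauchy_int Cone a r 1 z (fun _ => ccont_Cone _) Hz)))].
    intros th _. unfold Cone. simpl. symmetry. apply is_CInt_unique.
    assert (I := is_CInt_FTC g g' (seg z (circ a r th)) (fun _ => circ a r th - z)%C 0 1 Rle_0_1
       (fun t _ => Cpath_seg _ _ t) (fun t Ht => Hd _ (Hseg th t Ht))).
    rewrite seg_0, seg_1 in I.
    assert (N : (circ a r th - z)%C <> 0) by now apply Cminus_neq_0, circ_neq.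
    replace (g (circ a r th) * circ' r th * (/ (circ a r th - z) * 1) -
      g z * (1 * circ' r th * (/ (circ a r th - z) * 1)))%C with
      ((circ' r th * / (circ a r th - z)) * (g (circ a r th) - g z))%C by ring.
    eapply is_CInt_ext; [lra| |apply is_CInt_scal; apply I].
    - intros t _. simpl. field. assumption.
    - intros t Ht. apply ccont_mult; [|apply ccont_const].
      apply ccont_comp; [apply Hc, Hseg, Ht|apply ccont_seg]. }
  assert (E2 : CInt (fun t => CInt (fun th => g' (seg z (circ a r th) t) * circ' r th)%C 0 (2 * PI)) 0 1 = 0).
  { apply is_CInt_unique. eapply is_CInt_ext; [lra| |apply is_CInt_zero].
    intros t Ht. symmetry. apply is_CInt_unique.
    (* The contracted path has velocity [t * circ'], hence a division by [t]. Integrands are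
       compared on the open interval only, which leaves out [t = 0]. *)
    assert (Nt : RtoC t <> 0) by (intros E; apply RtoC_inj in E; lra).
    assert (I := is_CInt_FTC g g' (fun th => seg z (circ a r th) t) (fun th => RtoC t * circ' r th)%C 0 (2 * PI)
       two_PI_pos).
    cbv beta in I; rewrite circ_closed in I.
    replace (g (seg z (circ a r 0) t) - g (seg z (circ a r 0) t))%C with (RtoC 0) in I by ring.
    assert (J := is_CInt_scal _ _ _ _ (/ RtoC t)%C (I ltac:(clear I;
      intros th _; split; unfold seg, circ, circ'; simpl; auto_derive; trivial; ring)
      (fun th _ => Hd _ (Hseg th t ltac:(lra))) ltac:(clear I; intros th _;
        apply ccont_mult; [exact (ccont_comp g' (fun th => seg z (circ a r th) t) th (Hc _ (Hseg th t ltac:(lra)))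
          ltac:(unfold seg; apply ccont_plus; [apply ccont_const|]; apply ccont_mult; [apply ccont_const|];
             apply ccont_minus; [apply ccont_circ|apply ccont_const]))|];
        apply ccont_mult; [apply ccont_const|apply ccont_circ']))).
    rewrite Cmult_0_r in J.
    eapply is_CInt_ext; [apply two_PI_pos| |exact J]. intros th _. simpl. field. assumption. }
  assert (E3 := eq_trans (eq_sym E1) (eq_trans F E2)). apply Cminus_eq_0. rewrite <- E3. ring.
Qed.

(** The primitive [P] is continuously differentiable, so Cauchy's formula holds for it.
    Differentiating that formula twice shows that [g = P'] has a derivative, and that this
    derivative is continuous. *)
Lemma Cauchy_primitive_derivs g P a rho r :
  (forall w, Cmod (w - a) < rho -> Cdiff P w (g w)) ->
  (forall w, Cmod (w - a) < rho -> ccont (T := CT) g w) ->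
  r < rho -> forall z, Cmod (z - a) < r ->
  Cdiff g z (/ tpi * (2 * Cauchy_int P a r 3 z))%C /\
  ccont (T := CT) (fun w => / tpi * (2 * Cauchy_int P a r 3 w))%C z.
Proof.
  intros HP Hg Hr z Hz.
  assert (Hr0 : 0 <= r) by (generalize (Cmod_ge_0 (z - a)); lra).
  assert (HPc : forall t, ccont (T := CT) P (circ a r t)).
  { intros t. eapply Cdiff_ccont, HP. rewrite circ_dist; lra. }
  assert (Hdisc : forall w, Cmod (w - a) < r -> locally (T := CT) w (fun w => Cmod (w - a) < r)).
  { intros w Hw. apply locally_Cmod. exists (r - Cmod (w - a)). split; [lra|]. intros v Hv.
    replace (v - a)%C with ((v - w) + (w - a))%C by ring.
    eapply Rle_lt_trans; [apply Cmod_triangle|]. lra. }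
  assert (Hg2 : forall w, Cmod (w - a) < r -> g w = (/ tpi * Cauchy_int P a r 2 w)%C).
  { intros w Hw. apply (Cdiff_unique P w); [apply HP; lra|].
    apply (Cdiff_ext_loc (fun v => / tpi * Cauchy_int P a r 1 v)%C).
    - generalize (Hdisc w Hw). apply filter_imp. intros v Hv.
      rewrite (Cauchy_formula_C1 P g a rho r v HP Hg Hr Hv). field. apply tpi_neq_0.
    - replace (Cauchy_int P a r 2 w) with (INR 1 * Cauchy_int P a r 2 w)%C by (simpl; ring).
      apply Cdiff_scal, Cdiff_Cauchy_int; assumption. }
  split.
  - apply (Cdiff_ext_loc (fun v => / tpi * Cauchy_int P a r 2 v)%C).
    + generalize (Hdisc z Hz). apply filter_imp. intros v Hv. symmetry. now apply Hg2.
    + apply Cdiff_scal. replace (RtoC 2) with (RtoC (INR 2)) by (simpl; f_equal; ring).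
      apply Cdiff_Cauchy_int; assumption.
  - apply ccont_mult; [apply ccont_const|]. apply ccont_mult; [apply ccont_const|].
    eapply Cdiff_ccont, Cdiff_Cauchy_int; assumption.
Qed.

(** Mere differentiability is upgraded: Goursat gives a primitive, the primitive gives a continuous
    derivative. The radius [(r + rho) / 2] leaves room on both sides. *)
Theorem Cauchy_formula g a rho r z : (forall w, box a rho w -> exists l, Cdiff g w l) ->
  r < rho -> Cmod (z - a) < r -> Cauchy_int g a r 1 z = (tpi * g z)%C.
Proof.
  intros Hd Hr Hz. destruct (Cprimitive g a rho Hd) as [P HP].
  assert (Hg : forall w, Cmod (w - a) < rho -> ccont (T := CT) g w).
  { intros w Hw. destruct (Hd w) as [l Hl]; [apply box_of_Cmod; lra|]. eapply Cdiff_ccont; exact Hl. }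
  assert (D := Cauchy_primitive_derivs g P a rho ((r + rho) / 2) HP Hg ltac:(lra)).
  apply (Cauchy_formula_C1 g (fun w => / tpi * (2 * Cauchy_int P a ((r + rho) / 2) 3 w))%C a ((r + rho) / 2)).
  - intros; now apply D.
  - intros; now apply D.
  - lra.
  - assumption.
Qed.

(** * Holomorphic functions and their difference quotients *)

(** A total function obtained without choice: the derivative is read off along the horizontal
    line. *)
Definition Cder (f : C -> C) (z : C) : C :=
  (Derive (fun x => fst (f (x, snd z))) (fst z), Derive (fun x => snd (f (x, snd z))) (fst z)).

Lemma Cder_unique f z l : Cdiff f z l -> Cder f z = l.
Proof.
  intros H. apply Cdiff_differentiable in H. destruct H as [H1 H2].
  apply differentiable_pt_lim_unique in H1. apply differentiable_pt_lim_unique in H2.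
  unfold Cder. destruct l as [l1 l2]. simpl in *. f_equal; tauto.
Qed.

Definition copen (O : C -> Prop) : Prop := forall z, O z -> locally (T := CT) z O.
Definition holo (O : C -> Prop) (f : C -> C) : Prop := forall z, O z -> Cdiff f z (Cder f z).

Lemma holo_of_ex (O : C -> Prop) f : (forall z, O z -> exists l, Cdiff f z l) -> holo O f.
Proof. intros H z Hz. destruct (H z Hz) as [l Hl]. rewrite (Cder_unique _ _ _ Hl). exact Hl. Qed.

Lemma copen_box O a : copen O -> O a -> exists rho, 0 < rho /\ forall w, box a rho w -> O w.
Proof.
  intros HO Ha. apply HO, locally_Cmod in Ha. destruct Ha as (d & Hd & H).
  exists (d / 4). split; [lra|]. intros w [H1 H2]. apply H.
  eapply Rle_lt_trans; [apply Cmod_le_abs|].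
  change (Rabs (fst w - fst a) + Rabs (snd w - snd a) < d). lra.
Qed.

(** The difference quotient [g[z, w]], completed on the diagonal by the derivative. *)
Definition phi (g : C -> C) (z w : C) : C := dquot g (Cder g z) z w.

Lemma phi_neq g z w : w <> z -> phi g z w = ((g w - g z) / (w - z))%C.
Proof. intros N. unfold phi, dquot. destruct (Ceq_dec w z); [contradiction|reflexivity]. Qed.

Lemma phi_diag g z : phi g z z = Cder g z.
Proof. apply dquot_diag. Qed.

Lemma locally_disc (a z : C) r : Cmod (z - a) < r -> locally (T := CT) z (fun w => Cmod (w - a) < r).
Proof.
  intros Hw. apply locally_Cmod. exists (r - Cmod (z - a)). split; [lra|]. intros v Hv.
  replace (v - a)%C with ((v - z) + (z - a))%C by ring.
  eapply Rle_lt_trans; [apply Cmod_triangle|]. lra.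
Qed.

Lemma Cauchy_formula_deriv g a rho r z : (forall w, box a rho w -> exists l, Cdiff g w l) ->
  r < rho -> Cmod (z - a) < r -> Cauchy_int g a r 2 z = (tpi * Cder g z)%C.
Proof.
  intros Hd Hr Hz.
  assert (Hr0 : 0 <= r) by (generalize (Cmod_ge_0 (z - a)); lra).
  assert (D : Cdiff g z (/ tpi * Cauchy_int g a r 2 z)).
  { apply (Cdiff_ext_loc (fun v => / tpi * Cauchy_int g a r 1 v)%C).
    - generalize (locally_disc a z r Hz). apply filter_imp. intros v Hv.
      rewrite (Cauchy_formula g a rho r v Hd Hr Hv). field. apply tpi_neq_0.
    - replace (Cauchy_int g a r 2 z) with (INR 1 * Cauchy_int g a r 2 z)%C by (simpl; ring).
      apply Cdiff_scal, Cdiff_Cauchy_int; [|assumption].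
      intros t. destruct (Hd (circ a r t)) as [l Hl]; [|eapply Cdiff_ccont; exact Hl].
      apply box_of_Cmod. rewrite circ_dist; lra. }
  rewrite (Cder_unique _ _ _ D). field. apply tpi_neq_0.
Qed.

(** The kernel [1 / ((s - z) (s - w))] is the difference quotient of [1 / (s - z)] and its
    derivative on the diagonal. One integral thus covers both cases of [phi], and its regularity at
    the diagonal can be read off. *)
Lemma phi_Cauchy g a rho r z w : (forall w, box a rho w -> exists l, Cdiff g w l) ->
  r < rho -> Cmod (z - a) < r -> Cmod (w - a) < r ->
  phi g z w = (/ tpi * CInt (fun t => (g (circ a r t) * circ' r t) *
     (/ (circ a r t - z)) * / (circ a r t - w))%C 0 (2 * PI))%C.
Proof.
  intros Hd Hr Hz Hw.
  assert (Hr0 : 0 <= r) by (generalize (Cmod_ge_0 (z - a)); lra).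
  assert (Hgc : forall t, ccont (T := CT) g (circ a r t)).
  { intros t. destruct (Hd (circ a r t)) as [l Hl]; [|eapply Cdiff_ccont; exact Hl].
    apply box_of_Cmod. rewrite circ_dist; lra. }
  destruct (Ceq_dec w z) as [->|N].
  - rewrite phi_diag, <- (Cmult_1_l (Cder g z)), <- (Cinv_l tpi tpi_neq_0), <- Cmult_assoc.
    rewrite <- (Cauchy_formula_deriv g a rho r z Hd Hr Hz). f_equal.
    symmetry. apply is_CInt_unique.
    eapply is_CInt_ext; [apply two_PI_pos| |apply (is_CInt_Cauchy_int g a r 2 z Hgc Hz)].
    intros t _. simpl. ring.
  - rewrite phi_neq by assumption.
    replace (CInt (fun t => (g (circ a r t) * circ' r t) *
     (/ (circ a r t - z)) * / (circ a r t - w))%C 0 (2 * PI))%C with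
     (/ (w - z) * (Cauchy_int g a r 1 w - Cauchy_int g a r 1 z))%C.
    + rewrite !(Cauchy_formula g a rho r) by assumption. field.
      split; [now apply Cminus_neq_0|apply tpi_neq_0].
    + symmetry. apply is_CInt_unique.
      eapply is_CInt_ext; [apply two_PI_pos| |apply is_CInt_scal, is_CInt_minus; apply is_CInt_Cauchy_int; assumption].
      intros t _. simpl. field.
      repeat split; apply Cminus_neq_0; try assumption; now apply circ_neq.
Qed.

Lemma ccont_neq_0 {T : UniformSpace} (f : T -> C) (x : T) : ccont f x -> f x <> 0 ->
  locally x (fun y => f y <> 0).
Proof.
  intros Hf N. apply Cmod_gt_0 in N. apply ccont_eps with (eps := Cmod (f x)) in Hf; [|assumption].
  revert Hf. apply filter_imp. intros y Hy E. rewrite E in Hy.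
  replace (0 - f x)%C with (- f x)%C in Hy by ring. rewrite Cmod_opp in Hy. lra.
Qed.

Lemma locally_prod {S T : UniformSpace} (x : S) (y : T) (P : S -> Prop) (Q : T -> Prop) :
  locally x P -> locally y Q ->
  locally (T := prod_UniformSpace S T) (x, y) (fun p => P (fst p) /\ Q (snd p)).
Proof.
  intros [d1 H1] [d2 H2].
  exists (mkposreal _ (Rmin_pos _ _ (cond_pos d1) (cond_pos d2))). intros [u v] [Hu Hv]. split.
  - apply H1. eapply ball_le; [|exact Hu]. apply Rmin_l.
  - apply H2. eapply ball_le; [|exact Hv]. apply Rmin_r.
Qed.

(** Joint continuity in both points is needed to integrate in one variable and to exchange
    integrals. Near the diagonal it comes from [phi_Cauchy], elsewhere from the quotient. *)
Lemma phi_ccont O g z w : copen O -> holo O g -> O z -> O w ->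
  ccont (T := CT2) (fun p => phi g (fst p) (snd p)) (z, w).
Proof.
  intros HO Hg Hz Hw.
  destruct (Ceq_dec w z) as [->|N].
  - destruct (copen_box O z HO Hz) as (rho & Hrho & Hbox).
    set (r := rho / 2).
    assert (Hr : 0 < r < rho) by (unfold r; lra).
    assert (Hd : forall w, box z rho w -> exists l, Cdiff g w l) by (intros v Hv; eexists; apply Hg, Hbox, Hv).
    assert (Hzz : Cmod (z - z) < r) by (rewrite Cmod_diag; lra).
    assert (Hgc : forall t, ccont (T := CT) g (circ z r t)).
    { intros t. eapply Cdiff_ccont, Hg, Hbox, box_of_Cmod. rewrite circ_dist; lra. }
    assert (Hloc := locally_prod (S := CT) (T := CT) z z _ _ (locally_disc z z r Hzz) (locally_disc z z r Hzz)).
    apply (ccont_ext_loc (T := CT2) (fun p => / tpi * CInt (fun t => (g (circ z r t) * circ' r t) *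
     (/ (circ z r t - fst p)) * / (circ z r t - snd p))%C 0 (2 * PI))%C).
    { generalize Hloc. apply filter_imp. intros [u v] [Hu Hv]. simpl in *.
      symmetry. exact (phi_Cauchy g z rho r u v Hd ltac:(lra) Hu Hv). }
    apply ccont_mult; [apply ccont_const|].
    apply (ccont_CInt_param (T := CT2) (fun t p => (g (circ z r t) * circ' r t) *
     (/ (circ z r t - fst p)) * / (circ z r t - snd p))%C); [apply two_PI_pos| |].
    + generalize Hloc. apply filter_imp. intros [u v] [Hu Hv] t _. simpl in *.
      apply ccont_mult; [apply ccont_mult; [now apply ccont_g_circ|]|];
      (apply ccont_inv; [apply ccont_minus; [apply ccont_circ|apply ccont_const]|now apply Cminus_neq_0, circ_neq]).
    + intros t _.
      apply ccont_mult; [apply ccont_mult|].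
      * apply (ccont_fst (T := R_UniformSpace) (S := CT2) (fun t => g (circ z r t) * circ' r t)%C). now apply ccont_g_circ.
      * apply ccont_inv; [apply ccont_minus|now apply Cminus_neq_0, circ_neq].
        -- apply (ccont_fst (T := R_UniformSpace) (S := CT2) (circ z r)), ccont_circ.
        -- apply (ccont_snd (T := R_UniformSpace) (S := CT2) (fun p => fst p)).
           apply (ccont_fst (T := CT) (S := CT) (fun v => v)), ccont_id.
      * apply ccont_inv; [apply ccont_minus|now apply Cminus_neq_0, circ_neq].
        -- apply (ccont_fst (T := R_UniformSpace) (S := CT2) (circ z r)), ccont_circ.
        -- apply (ccont_snd (T := R_UniformSpace) (S := CT2) (fun p => snd p)).
           apply (ccont_snd (T := CT) (S := CT) (fun v => v)), ccont_id.
  - assert (C1 : ccont (T := CT2) (fun p => fst p) (z, w))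
      by (apply (ccont_fst (T := CT) (S := CT) (fun v => v)), ccont_id).
    assert (C2 : ccont (T := CT2) (fun p => snd p) (z, w))
      by (apply (ccont_snd (T := CT) (S := CT) (fun v => v)), ccont_id).
    assert (C3 : ccont (T := CT2) (fun p => snd p - fst p)%C (z, w))
      by now apply ccont_minus.
    assert (N' : (w - z)%C <> 0) by now apply Cminus_neq_0.
    apply (ccont_ext_loc (T := CT2) (fun p => (g (snd p) - g (fst p)) / (snd p - fst p))%C).
    + generalize (ccont_neq_0 _ _ C3 N'). apply filter_imp. intros [u v] Huv. simpl in *.
      symmetry. apply phi_neq. intros E. apply Huv. rewrite E. ring.
    + apply ccont_mult; [apply ccont_minus|now apply ccont_inv].
      * apply (ccont_snd (T := CT) (S := CT) g). eapply Cdiff_ccont, Hg, Hw.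
      * apply (ccont_fst (T := CT) (S := CT) g). eapply Cdiff_ccont, Hg, Hz.
Qed.

(** At [w = z] this is the removable singularity theorem, obtained from the Cauchy integral for
    [phi]. *)
Lemma phi_holo O g z : copen O -> holo O g -> O z -> holo O (phi g z).
Proof.
  intros HO Hg Hz. apply holo_of_ex. intros w Hw.
  destruct (Ceq_dec w z) as [->|N].
  - destruct (copen_box O z HO Hz) as (rho & Hrho & Hbox).
    set (r := rho / 2).
    assert (Hr : 0 < r < rho) by (unfold r; lra).
    assert (Hd : forall w, box z rho w -> exists l, Cdiff g w l) by (intros v Hv; eexists; apply Hg, Hbox, Hv).
    assert (Hzz : Cmod (z - z) < r) by (rewrite Cmod_diag; lra).
    assert (Hgc : forall t, ccont (T := CT) g (circ z r t)).
    { intros t. eapply Cdiff_ccont, Hg, Hbox, box_of_Cmod. rewrite circ_dist; lra. }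
    assert (Hkc : forall t, ccont (fun t => (g (circ z r t) * circ' r t) * (/ (circ z r t - z)))%C t).
    { intros t. apply ccont_mult; [now apply ccont_g_circ|].
      apply ccont_inv; [apply ccont_minus; [apply ccont_circ|apply ccont_const]|now apply Cminus_neq_0, circ_neq]. }
    eexists. eapply Cdiff_ext_loc.
    2: { apply Cdiff_scal with (c := (/ tpi)%C).
      apply (Cdiff_Cauchy_kernel (fun t => (g (circ z r t) * circ' r t) * (/ (circ z r t - z)))%C (circ z r) 0 (2 * PI) 1 z).
      - apply two_PI_pos.
      - intros; apply Hkc.
      - intros; apply ccont_circ.
      - intros; now apply circ_neq. }
    generalize (locally_disc z z r Hzz). apply filter_imp. intros w' Hw'.
    rewrite (phi_Cauchy g z rho r z w' Hd ltac:(lra) Hzz Hw'). f_equal.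
    unfold CInt; f_equal; apply RInt_ext; intros t _; rewrite Cpow_1_r; reflexivity.
  - eexists. eapply Cdiff_ext_loc.
    2: { apply Cdiff_mult; [apply Cdiff_minus; [apply (Hg w Hw)|apply (Cdiff_const (g z))]|].
         apply (Cdiff_inv z w N). }
    generalize (locally_Cneq w z N). apply filter_imp. intros v Hv. symmetry. now apply phi_neq.
Qed.

(** * Cauchy's theorem for cycles *)

(* Pieces extend beyond their end points, so that integrands are continuous there in the
   two-sided sense. *)
Record piece := mkPiece {
  pa : R; pb : R; pg : R -> C; pg' : R -> C;
  pab : pa <= pb;
  pg_path : forall t, Cpath pg t (pg' t);
  pg'_ccont : forall t, ccont pg' t }.

Definition on_piece (p : piece) (z : C) : Prop := exists t, pa p <= t <= pb p /\ pg p t = z.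
Definition pint (p : piece) (f : C -> C) : C :=
  CInt (fun t => f (pg p t) * pg' p t)%C (pa p) (pb p).

Fixpoint chint (ps : list piece) (f : C -> C) : C :=
  match ps with nil => RtoC 0 | cons p ps => (pint p f + chint ps f)%C end.
Fixpoint chbd (ps : list piece) (P : C -> C) : C :=
  match ps with nil => RtoC 0 | cons p ps => (P (pg p (pb p)) - P (pg p (pa p)) + chbd ps P)%C end.
Definition on_chain (ps : list piece) (z : C) : Prop := exists p, In p ps /\ on_piece p z.
(** The formal boundary vanishes when tested against every function, continuous or not. Closedness
    can so be used without matching the end points of pieces. *)
Definition closed_chain (ps : list piece) : Prop := forall P, chbd ps P = 0.

Lemma on_pg p t : pa p <= t <= pb p -> on_piece p (pg p t).
Proof. intros Ht; now exists t. Qed.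

Lemma ccont_pg p t : ccont (pg p) t.
Proof. eapply Cpath_ccont, pg_path. Qed.

Lemma ccont_pint p f t : ccont (T := CT) f (pg p t) -> ccont (fun t => f (pg p t) * pg' p t)%C t.
Proof.
  intros H. apply ccont_mult; [|apply pg'_ccont]. apply ccont_comp; [exact H|apply ccont_pg].
Qed.

Lemma is_CInt_pint p f : (forall z, on_piece p z -> ccont (T := CT) f z) ->
  is_CInt (fun t => f (pg p t) * pg' p t)%C (pa p) (pb p) (pint p f).
Proof.
  intros Hf. apply is_CInt_ccont; [apply pab|]. intros t Ht. apply ccont_pint, Hf, on_pg, Ht.
Qed.

Lemma pint_lin p f g c : (forall z, on_piece p z -> ccont (T := CT) f z) ->
  (forall z, on_piece p z -> ccont (T := CT) g z) ->
  pint p (fun w => f w + c * g w)%C = (pint p f + c * pint p g)%C.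
Proof.
  intros Hf Hg. apply is_CInt_unique.
  eapply is_CInt_ext; [apply pab| |apply is_CInt_plus; [apply (is_CInt_pint p f Hf)|
     apply is_CInt_scal, (is_CInt_pint p g Hg)]].
  intros t _. simpl. ring.
Qed.

Lemma pint_ext p f g : (forall z, on_piece p z -> f z = g z) -> pint p f = pint p g.
Proof.
  intros E. unfold pint, CInt. f_equal; apply RInt_ext; intros t;
  rewrite Rmin_left, Rmax_right by apply pab; intros Ht; rewrite E by (apply on_pg; lra); reflexivity.
Qed.

Lemma on_chain_head p ps z : on_piece p z -> on_chain (p :: ps) z.
Proof. intros H. exists p. split; [now left|assumption]. Qed.

Lemma on_chain_tail p ps z : on_chain ps z -> on_chain (p :: ps) z.
Proof. intros (q & Hq & H). exists q. split; [now right|assumption]. Qed.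

Lemma chint_lin ps f g c : (forall z, on_chain ps z -> ccont (T := CT) f z) ->
  (forall z, on_chain ps z -> ccont (T := CT) g z) ->
  chint ps (fun w => f w + c * g w)%C = (chint ps f + c * chint ps g)%C.
Proof.
  induction ps as [|p ps IH]; intros Hf Hg; simpl; [ring|].
  rewrite IH by (intros; auto using on_chain_tail).
  rewrite pint_lin by (intros; auto using on_chain_head). ring.
Qed.

Lemma chint_ext ps f g : (forall z, on_chain ps z -> f z = g z) -> chint ps f = chint ps g.
Proof.
  induction ps as [|p ps IH]; intros E; simpl; [reflexivity|].
  rewrite IH by (intros; auto using on_chain_tail).
  rewrite (pint_ext p f g) by (intros; auto using on_chain_head). reflexivity.
Qed.

Lemma chint_FTC ps P g : (forall z, on_chain ps z -> Cdiff P z (g z)) ->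
  (forall z, on_chain ps z -> ccont (T := CT) g z) -> chint ps g = chbd ps P.
Proof.
  induction ps as [|p ps IH]; intros HP Hg; simpl; [reflexivity|].
  rewrite IH by (intros; auto using on_chain_tail). f_equal.
  apply is_CInt_unique, is_CInt_FTC; [apply pab|intros; apply pg_path| |].
  - intros t Ht. apply HP, on_chain_head, on_pg, Ht.
  - intros t Ht. apply ccont_pint, Hg, on_chain_head, on_pg, Ht.
Qed.

Lemma ccont_inv_sub z w : w <> z -> ccont (T := CT) (fun w => / (w - z))%C w.
Proof. intros N. eapply Cdiff_ccont, Cdiff_inv, N. Qed.

(** * Dixon's proof of the homological Cauchy formula *)

Section Dixon.
Variables (O V : C -> Prop) (g : C -> C).
Hypotheses (HO : copen O) (HV : copen V) (HOV : forall z, O z \/ V z) (Hg : holo O g).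

Lemma g_ccont z : O z -> ccont (T := CT) g z.
Proof. intros Hz; eapply Cdiff_ccont, Hg, Hz. Qed.

Lemma phi_ccont_1 z w : O z -> O w -> ccont (T := CT) (fun w => phi g w z) w.
Proof. intros Hz Hw. exact (ccont_slice_l (S := CT) (T := CT) (phi g) w z (phi_ccont O g w z HO Hg Hw Hz)). Qed.

Section Piece.
Variable p : piece.
Hypothesis Hp : forall z, on_piece p z -> O z.

Lemma ccont_dixon_kernel z t : O z -> pa p <= t <= pb p ->
  ccont (T := prod_UniformSpace R_UniformSpace CT)
    (fun q => phi g (pg p (fst q)) (snd q) * pg' p (fst q))%C (t, z).
Proof.
  intros Hz Ht. apply ccont_mult.
  - apply ccont_comp_2.
    + simpl. apply (phi_ccont O); auto. apply Hp, on_pg, Ht.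
    + apply (ccont_fst (T := R_UniformSpace) (S := CT) (pg p)), ccont_pg.
    + apply (ccont_snd (T := R_UniformSpace) (S := CT) (fun v => v)), ccont_id.
  - apply (ccont_fst (T := R_UniformSpace) (S := CT) (pg' p)), pg'_ccont.
Qed.

Lemma ccont_dixon z : O z -> ccont (T := CT) (fun z => pint p (fun w => phi g w z)) z.
Proof.
  intros Hz. unfold pint.
  apply (ccont_CInt_param (T := CT) (fun t z => phi g (pg p t) z * pg' p t)%C); [apply pab| |].
  - generalize (HO z Hz). apply filter_imp. intros x Hx t Ht.
    exact (ccont_slice_l (S := R_UniformSpace) (T := CT) (fun t z => phi g (pg p t) z * pg' p t)%C t x
      (ccont_dixon_kernel x t Hx Ht)).
  - intros t Ht. now apply ccont_dixon_kernel.
Qed.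

(** Exchange the circle with the piece. For each fixed [w] on the piece [z |-> phi g w z] is
    holomorphic by [phi_holo], so Cauchy's formula reproduces it under the integral. *)
Lemma dixon_reproduce a rho r z : (forall w, box a rho w -> O w) -> r < rho -> Cmod (z - a) < r ->
  Cauchy_int (fun z => pint p (fun w => phi g w z)) a r 1 z = (tpi * pint p (fun w => phi g w z))%C.
Proof.
  intros Hbox Hr Hz.
  assert (Hr0 : 0 <= r) by (generalize (Cmod_ge_0 (z - a)); lra).
  assert (HcO : forall th, O (circ a r th)).
  { intros th. apply Hbox, box_of_Cmod. rewrite circ_dist; lra. }
  assert (HzO : O z) by (apply Hbox, box_of_Cmod; lra).
  set (k := fun th t => (phi g (pg p t) (circ a r th) * pg' p t * (circ' r th * / (circ a r th - z)))%C).
  assert (Hk : forall th t, pa p <= t <= pb p ->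
    ccont (T := R2) (fun q => k (fst q) (snd q)) (th, t)).
  { intros th t Ht. unfold k. apply ccont_mult; [apply ccont_mult|].
    - apply ccont_comp_2.
      + simpl. apply (phi_ccont O); auto. apply Hp, on_pg, Ht.
      + apply (ccont_snd (T := R_UniformSpace) (S := R_UniformSpace) (pg p)), ccont_pg.
      + apply (ccont_fst (T := R_UniformSpace) (S := R_UniformSpace) (circ a r)), ccont_circ.
    - apply (ccont_snd (T := R_UniformSpace) (S := R_UniformSpace) (pg' p)), pg'_ccont.
    - apply (ccont_fst (T := R_UniformSpace) (S := R_UniformSpace) (fun th => circ' r th * / (circ a r th - z))%C).
      apply ccont_mult; [apply ccont_circ'|].
      apply ccont_inv; [apply ccont_minus; [apply ccont_circ|apply ccont_const]|now apply Cminus_neq_0, circ_neq]. }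
  assert (F := CInt_Fubini k 0 (2 * PI) (pa p) (pb p) two_PI_pos (pab p) (fun th t _ Ht => Hk th t Ht)).
  assert (E1 : CInt (fun th => CInt (fun t => k th t) (pa p) (pb p)) 0 (2 * PI) =
     Cauchy_int (fun z => pint p (fun w => phi g w z)) a r 1 z).
  { symmetry. apply is_CInt_unique.
    assert (I : is_CInt (fun th => CInt (fun t => k th t) (pa p) (pb p)) 0 (2 * PI)
       (CInt (fun th => CInt (fun t => k th t) (pa p) (pb p)) 0 (2 * PI))).
    { apply is_CInt_ccont; [apply two_PI_pos|]. intros th _.
      apply (ccont_CInt_param (T := R_UniformSpace) (fun t th => k th t)); [apply pab| |].
      - apply filter_forall. intros th' t Ht.
        exact (ccont_slice_r th' t k (Hk th' t Ht)).
      - intros t Ht. exact (ccont_prod_swap k th t (Hk th t Ht)). }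
    eapply is_CInt_ext; [apply two_PI_pos| |exact I]. intros th _. simpl.
    apply is_CInt_unique.
    assert (J := is_CInt_scal _ _ _ _ (circ' r th * / (circ a r th - z))%C
       (is_CInt_pint p (fun w => phi g w (circ a r th)) (fun w Hw => phi_ccont_1 _ _ (HcO th) (Hp w Hw)))).
    replace (pint p (fun w => phi g w (circ a r th)) * circ' r th * (/ (circ a r th - z) * 1))%C with
      (circ' r th * / (circ a r th - z) * pint p (fun w => phi g w (circ a r th)))%C by ring.
    eapply is_CInt_ext; [apply pab| |exact J]. intros t _. unfold k. simpl. ring. }
  assert (E2 : CInt (fun t => CInt (fun th => k th t) 0 (2 * PI)) (pa p) (pb p) =
     (tpi * pint p (fun w => phi g w z))%C).
  { apply is_CInt_unique.
    eapply is_CInt_ext; [apply pab| |apply is_CInt_scal, (is_CInt_pint p (fun w => phi g w z)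
       (fun w Hw => phi_ccont_1 _ _ HzO (Hp w Hw)))].
    intros t Ht. simpl. symmetry. apply is_CInt_unique.
    assert (HtO : O (pg p t)) by (apply Hp, on_pg; lra).
    assert (Hh := phi_holo O g (pg p t) HO Hg HtO).
    assert (CF := Cauchy_formula (phi g (pg p t)) a rho r z
      (fun w Hw => ex_intro _ _ (Hh w (Hbox w Hw))) Hr Hz).
    assert (J := is_CInt_scal _ _ _ _ (pg' p t) (is_CInt_Cauchy_int (phi g (pg p t)) a r 1 z
       (fun th => Cdiff_ccont _ _ _ (Hh _ (HcO th))) Hz)).
    rewrite CF in J.
    replace (tpi * (phi g (pg p t) z * pg' p t))%C with (pg' p t * (tpi * phi g (pg p t) z))%C by ring.
    eapply is_CInt_ext; [apply two_PI_pos| |exact J]. intros th _. unfold k. simpl. ring. }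
  rewrite <- E1, <- E2. exact F.
Qed.

(** A continuous function that equals its own Cauchy integral is holomorphic, since Cauchy integrals
    are. This stands in for Morera's theorem. *)
Lemma Cdiff_dixon z : O z -> exists l, Cdiff (fun z => pint p (fun w => phi g w z)) z l.
Proof.
  intros Hz. destruct (copen_box O z HO Hz) as (rho & Hrho & Hbox).
  assert (Hzz : Cmod (z - z) < rho / 2) by (rewrite Cmod_diag; lra).
  eexists. eapply Cdiff_ext_loc.
  2: { apply Cdiff_scal with (c := (/ tpi)%C); apply (Cdiff_Cauchy_int (fun z => pint p (fun w => phi g w z)) z (rho / 2) 1 z); [|assumption].
       intros t. apply ccont_dixon, Hbox, box_of_Cmod. rewrite circ_dist; lra. }
  generalize (locally_disc z z (rho / 2) Hzz). apply filter_imp. intros w Hw.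
  transitivity (/ tpi * (tpi * pint p (fun v => phi g v w)))%C.
  - f_equal. exact (dixon_reproduce z rho (rho / 2) w Hbox ltac:(lra) Hw).
  - field. apply tpi_neq_0.
Qed.

Lemma Cdiff_cauchy_transform z : ~ on_piece p z ->
  exists l, Cdiff (fun z => pint p (fun w => g w * / (w - z))%C) z l.
Proof.
  intros Hz. eexists.
  assert (D := Cdiff_Cauchy_kernel (fun t => g (pg p t) * pg' p t)%C (pg p) (pa p) (pb p) 1 z (pab p)).
  eapply Cdiff_ext_loc; [|apply D].
  - apply filter_forall. intros w. unfold pint, CInt. f_equal; apply RInt_ext; intros t _; f_equal; rewrite Cpow_1_r; ring.
  - intros t Ht. apply ccont_pint, g_ccont, Hp, on_pg, Ht.
  - intros; apply ccont_pg.
  - intros t Ht E. apply Hz. now exists t.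
Qed.

Lemma cauchy_transform_small eps : 0 < eps -> exists B, forall z, B < Cmod z ->
  Cmod (pint p (fun w => g w * / (w - z))%C) <= eps.
Proof.
  intros Heps.
  destruct (ccont_bounded (pg p) (pa p) (pb p)) as (B1 & HB1 & H1); [intros; apply ccont_pg|].
  destruct (ccont_bounded (fun t => g (pg p t) * pg' p t)%C (pa p) (pb p)) as (B2 & HB2 & H2).
  { intros t Ht. apply ccont_pint, g_ccont, Hp, on_pg, Ht. }
  assert (Hab := pab p).
  set (L := 2 * ((pb p - pa p) * B2)). assert (HL : 0 <= L) by (unfold L; nra).
  (* Beyond this radius the piece is at distance at least [1 + L / eps] from [z], and
     [L / (1 + L / eps) <= eps]. The 1 keeps this distance positive when [L = 0]. *)
  exists (B1 + 1 + L / eps). intros z Hz.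
  assert (HLe : 0 <= L / eps) by (apply Rmult_le_pos; [assumption|]; left; now apply Rinv_0_lt_compat).
  assert (Hfar : forall t, pa p <= t <= pb p -> 1 + L / eps <= Cmod (pg p t - z)).
  { intros t Ht. specialize (H1 t Ht).
    assert (T := Cmod_triangle (pg p t - z) (- pg p t)). rewrite Cmod_opp in T.
    replace (pg p t - z + - pg p t)%C with (- z)%C in T by ring. rewrite Cmod_opp in T. lra. }
  assert (Hn : forall t, pa p <= t <= pb p -> (pg p t - z)%C <> 0).
  { intros t Ht. apply Cmod_gt_0. specialize (Hfar t Ht). lra. }
  assert (I : is_CInt (fun t => g (pg p t) * / (pg p t - z) * pg' p t)%C (pa p) (pb p)
    (pint p (fun w => g w * / (w - z))%C)).
  { apply (is_CInt_pint p (fun w => g w * / (w - z))%C). intros w Hw.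
    apply ccont_mult; [now apply g_ccont, Hp|]. destruct Hw as (t & Ht & <-).
    apply ccont_inv_sub. intros E. apply (Hn t Ht). rewrite E. ring. }
  eapply Rle_trans; [refine (is_CInt_bound _ _ _ _ (B2 * / (1 + L / eps)) Hab _ I)|].
  - intros t Ht.
    replace (g (pg p t) * / (pg p t - z) * pg' p t)%C with (g (pg p t) * pg' p t * / (pg p t - z))%C by ring.
    rewrite Cmod_mult, Cmod_inv by auto.
    apply Rmult_le_compat; [apply Cmod_ge_0| |auto|].
    + left. apply Rinv_0_lt_compat, Cmod_gt_0. auto.
    + apply Rinv_le_contravar; [lra|auto].
  - replace (2 * ((pb p - pa p) * (B2 * / (1 + L / eps)))) with (L * / (1 + L / eps)) by (unfold L; ring).
    apply Rmult_le_reg_r with (1 + L / eps); [lra|]. rewrite Rmult_assoc, Rinv_l by lra.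
    replace (eps * (1 + L / eps)) with (eps + L) by (field; lra). lra.
Qed.
End Piece.

Variable ps : list piece.
Hypothesis Hps : forall z, on_chain ps z -> O z.

Lemma chain_sum_Cdiff (F : piece -> C -> C) z : (forall p, In p ps -> exists l, Cdiff (F p) z l) ->
  exists l, Cdiff (fun z => fold_right (fun p s => F p z + s)%C 0 ps) z l.
Proof.
  clear Hps. induction ps as [|p qs IH]; intros H; simpl.
  - eexists. apply Cdiff_const.
  - destruct (H p) as [l Hl]; [now left|]. destruct IH as [m Hm]; [intros; apply H; now right|].
    eexists. apply Cdiff_plus; eassumption.
Qed.

Lemma chint_fold f : chint ps f = fold_right (fun p s => pint p f + s)%C 0 ps.
Proof. clear Hps. induction ps as [|p qs IH]; simpl; [reflexivity|now rewrite IH]. Qed.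

Lemma chain_transform_small eps : 0 < eps -> exists B, forall z, B < Cmod z ->
  Cmod (chint ps (fun w => g w * / (w - z))%C) <= eps.
Proof.
  revert eps. induction ps as [|p qs IH]; intros eps Heps; simpl.
  - exists 0. intros z _. rewrite Cmod_0. lra.
  - destruct (cauchy_transform_small p (fun z Hz => Hps z (on_chain_head p qs z Hz)) (eps / 2)) as [B1 H1]; [lra|].
    destruct (IH (fun z Hz => Hps z (on_chain_tail p qs z Hz)) (eps / 2)) as [B2 H2]; [lra|].
    exists (Rmax B1 B2). intros z Hz.
    eapply Rle_trans; [apply Cmod_triangle|].
    specialize (H1 z). specialize (H2 z).
    assert (M1 := Rmax_l B1 B2). assert (M2 := Rmax_r B1 B2).
    assert (Cmod (pint p (fun w => g w * / (w - z))%C) <= eps / 2) by (apply H1; lra).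
    assert (Cmod (chint qs (fun w => g w * / (w - z))%C) <= eps / 2) by (apply H2; lra). lra.
Qed.

Hypothesis HpV : forall z, on_chain ps z -> ~ V z.
Hypothesis Hwind : forall z, V z -> chint ps (fun w => / (w - z))%C = 0.
Hypothesis Hinf : exists B, forall z, B < Cmod z -> V z.

(** Where [O] and [V] overlap the two formulas agree, because the winding number is zero on [V]. The
    [phi] formula takes precedence: it has no singularity on the chain, which lies in [O]. *)
Definition dixon (z : C) : C :=
  if excluded_middle_informative (O z) then chint ps (fun w => phi g w z)
  else chint ps (fun w => g w * / (w - z))%C.

Lemma chint_phi z : O z -> ~ on_chain ps z ->
  chint ps (fun w => phi g w z) =
  (chint ps (fun w => g w * / (w - z)) - g z * chint ps (fun w => / (w - z)))%C.
Proof.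
  intros Hz Hnz.
  assert (N : forall w, on_chain ps w -> w <> z) by (intros w Hw ->; contradiction).
  transitivity (chint ps (fun w => g w * / (w - z))%C + (- g z) * chint ps (fun w => / (w - z))%C)%C; [|ring].
  rewrite <- chint_lin.
  - apply chint_ext. intros w Hw. specialize (N w Hw). rewrite phi_neq by congruence.
    field. split; apply Cminus_neq_0; congruence.
  - intros w Hw. apply ccont_mult; [now apply g_ccont, Hps|now apply ccont_inv_sub, N].
  - intros w Hw. now apply ccont_inv_sub, N.
Qed.

Lemma dixon_V z : V z -> dixon z = chint ps (fun w => g w * / (w - z))%C.
Proof.
  intros Hz. unfold dixon. destruct (excluded_middle_informative (O z)) as [HzO|]; [|reflexivity].
  rewrite chint_phi, (Hwind z Hz); [ring|assumption|]. intros H. now apply (HpV z).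
Qed.

Lemma dixon_O z : O z -> dixon z = chint ps (fun w => phi g w z).
Proof.
  intros Hz. unfold dixon. destruct (excluded_middle_informative (O z)); [reflexivity|contradiction].
Qed.

Lemma Cdiff_dixon_entire z : exists l, Cdiff dixon z l.
Proof.
  destruct (HOV z) as [Hz|Hz].
  - destruct (chain_sum_Cdiff (fun p z => pint p (fun w => phi g w z)) z) as [l Hl].
    { intros p Hp. apply Cdiff_dixon; [|assumption]. intros w Hw. apply Hps. now exists p. }
    exists l. eapply Cdiff_ext_loc; [|exact Hl]. generalize (HO z Hz). apply filter_imp.
    intros w Hw. rewrite dixon_O by assumption. symmetry. apply chint_fold.
  - destruct (chain_sum_Cdiff (fun p z => pint p (fun w => g w * / (w - z))%C) z) as [l Hl].
    { intros p Hp. apply Cdiff_cauchy_transform.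
      - intros w Hw. apply Hps. now exists p.
      - intros Hw. apply (HpV z); [|assumption]. now exists p. }
    exists l. eapply Cdiff_ext_loc; [|exact Hl]. generalize (HV z Hz). apply filter_imp.
    intros w Hw. rewrite dixon_V by assumption. symmetry. apply chint_fold.
Qed.

(** Liouville's argument for a function vanishing at infinity: Cauchy's formula makes the value at
    [z] its mean over a circle so large that the function is small on it. *)
Lemma dixon_zero z : dixon z = 0.
Proof.
  apply Cmod_eq_0. apply Rle_antisym; [|apply Cmod_ge_0].
  apply Rnot_lt_le. intros Hpos.
  (* A quarter, because [is_CInt_bound] loses a factor 2: the integral is then at most half of
     [2 * PI * Cmod (dixon z)]. *)
  assert (He : 0 < Cmod (dixon z) / 4) by lra.
  destruct (chain_transform_small _ He) as [B1 H1]. destruct Hinf as [B2 H2].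
  set (r := Rabs B1 + Rabs B2 + Cmod z + 1).
  assert (P1 := Rabs_pos B1). assert (P2 := Rabs_pos B2). assert (P3 := Cmod_ge_0 z).
  assert (Q1 := Rle_abs B1). assert (Q2 := Rle_abs B2).
  assert (Er : r = Rabs B1 + Rabs B2 + Cmod z + 1) by reflexivity. clearbody r.
  assert (Hr : 0 < r) by lra.
  assert (Hzz : Cmod (z - z) < r) by (rewrite Cmod_diag; lra).
  assert (CF := Cauchy_formula dixon z (r + 1) r z (fun w _ => Cdiff_dixon_entire w) ltac:(lra) Hzz).
  assert (I := is_CInt_Cauchy_int dixon z r 1 z
     (fun t => let (l, Hl) := Cdiff_dixon_entire (circ z r t) in Cdiff_ccont _ _ _ Hl) Hzz).
  rewrite CF in I.
  apply (is_CInt_bound _ _ _ _ (Cmod (dixon z) / 4) two_PI_pos) in I.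
  - rewrite Cmod_mult in I.
    replace (Cmod tpi) with (2 * PI) in I.
    + generalize PI_RGT_0; intros. nra.
    + unfold tpi, Cmod. simpl. replace (0 * (0 * 1) + 2 * PI * (2 * PI * 1)) with (2 * PI * (2 * PI)) by ring.
      symmetry. apply sqrt_square, two_PI_pos.
  - intros t _.
    assert (Hn : (circ z r t - z)%C <> 0) by now apply Cminus_neq_0, circ_neq.
    replace (dixon (circ z r t) * circ' r t * (/ (circ z r t - z)) ^ 1)%C with (Ci * dixon (circ z r t))%C
      by (rewrite (circ'_circ z); simpl; field; assumption).
    rewrite Cmod_mult, Cmod_Ci, Rmult_1_l.
    assert (Hfar : r - Cmod z <= Cmod (circ z r t)).
    { assert (T := Cmod_triangle (circ z r t) (- z)). rewrite Cmod_opp in T.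
      change (circ z r t + - z)%C with (circ z r t - z)%C in T. rewrite circ_dist in T; lra. }
    rewrite dixon_V by (apply H2; lra).
    apply H1. lra.
Qed.

Theorem Cauchy_cycle z : O z -> ~ on_chain ps z ->
  chint ps (fun w => g w * / (w - z))%C = (g z * chint ps (fun w => / (w - z))%C)%C.
Proof.
  intros Hz Hnz. apply Cminus_eq_0. rewrite <- chint_phi by assumption.
  rewrite <- dixon_O by assumption. apply dixon_zero.
Qed.
End Dixon.

(** Cauchy's formula for the function [phi F z'] at the point [z]. Splitting [phi F z' w / (w - z)]
    leaves the wanted integral and [F z'] times the integral [E0]. *)
Lemma Cauchy_cycle_quadratic O V F ps z z' :
  copen O -> copen V -> (forall z, O z \/ V z) -> holo O F ->
  (forall z, on_chain ps z -> O z) -> (forall z, on_chain ps z -> ~ V z) ->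
  (forall z, V z -> chint ps (fun w => / (w - z))%C = 0) ->
  (exists B, forall z, B < Cmod z -> V z) -> closed_chain ps ->
  O z -> O z' -> ~ on_chain ps z -> ~ on_chain ps z' ->
  chint ps (fun w => / (w - z))%C = tpi -> chint ps (fun w => / (w - z'))%C = tpi ->
  chint ps (fun w => F w * / ((w - z) * (w - z')))%C = (tpi * phi F z' z)%C.
Proof.
  intros HO HV HOV HF Hps HpV Hwind Hinf Hcl Hz Hz' Hnz Hnz' Wz Wz'.
  assert (N : forall w, on_chain ps w -> w <> z) by (intros w Hw ->; contradiction).
  assert (N' : forall w, on_chain ps w -> w <> z') by (intros w Hw ->; contradiction).
  (* For [z = z'] the integrand has the primitive [- 1 / (w - z)]; otherwise partial fractions
     reduce it to the difference of the two equal winding integrals. *)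
  assert (E0 : chint ps (fun w => / ((w - z) * (w - z')))%C = 0).
  { destruct (Ceq_dec z z') as [<-|D].
    - rewrite <- (Hcl (fun w => - (1) * / (w - z))%C).
      rewrite (chint_ext ps _ (fun w => / (w - z) * / (w - z))%C).
      2: { intros w Hw. field. now apply Cminus_neq_0, N. }
      apply chint_FTC.
      + intros w Hw. replace (/ (w - z) * / (w - z))%C with (- (1) * - (/ (w - z) * / (w - z)))%C by ring.
        apply Cdiff_scal, Cdiff_inv, N, Hw.
      + intros w Hw. apply ccont_mult; apply ccont_inv_sub, N, Hw.
    - rewrite (chint_ext ps _ (fun w => (/ (z - z') * / (w - z)) + (- / (z - z')) * / (w - z'))%C).
      2: { intros w Hw. field. repeat split; apply Cminus_neq_0; auto. }
      rewrite chint_lin.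
      2: { intros w Hw. apply ccont_mult; [apply ccont_const|apply ccont_inv_sub, N, Hw]. }
      2: { intros w Hw. apply ccont_inv_sub, N', Hw. }
      rewrite (chint_ext ps _ (fun w => RtoC 0 + / (z - z') * / (w - z))%C) by (intros; ring).
      rewrite chint_lin.
      2: { intros; apply ccont_const. }
      2: { intros w Hw. apply ccont_inv_sub, N, Hw. }
      rewrite Wz, Wz'.
      replace (chint ps (fun _ => RtoC 0)) with (RtoC 0); [ring|].
      rewrite (chint_FTC ps (fun _ => RtoC 0) (fun _ => RtoC 0)); [now rewrite Hcl| |].
      + intros; apply Cdiff_const.
      + intros; apply ccont_const. }
  assert (CC := Cauchy_cycle O V (phi F z') HO HV HOV (phi_holo O F z' HO HF Hz') ps Hps HpV Hwind Hinf z Hz Hnz).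
  rewrite Wz in CC. rewrite Cmult_comm, <- CC.
  rewrite (chint_ext ps (fun w => phi F z' w * / (w - z))%C
    (fun w => F w * / ((w - z) * (w - z')) + (- F z') * / ((w - z) * (w - z')))%C).
  2: { intros w Hw. rewrite phi_neq by auto. field. split; apply Cminus_neq_0; auto. }
  assert (HQ : forall w, on_chain ps w -> ccont (T := CT) (fun w => / ((w - z) * (w - z')))%C w).
  { intros w Hw. apply ccont_inv.
    - apply ccont_mult; (apply ccont_minus; [apply ccont_id|apply ccont_const]).
    - apply Cmult_neq_0; apply Cminus_neq_0; auto. }
  rewrite chint_lin, E0; [ring| |assumption].
  intros w Hw. apply ccont_mult; [|auto]. eapply Cdiff_ccont, HF, Hps, Hw.
Qed.

(** * Piecewise continuously differentiable curves *)

(** The extension integrates the derivative, frozen outside [[a, b]] at its end values by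
    [clamp]. *)
Lemma C1_extend (h : R -> R) a b : a <= b -> (forall t, a <= t <= b -> C1_at h t) ->
  exists k k', (forall t, is_derive k t (k' t)) /\ (forall t, continuous k' t) /\
    forall t, a <= t <= b -> k t = h t /\ k' t = Derive h t.
Proof.
  intros Hab Hh.
  set (k' := fun t => Derive h (clamp a b t)).
  assert (Hk' : forall t, continuous k' t).
  { intros t. apply (continuous_comp (clamp a b) (Derive h)); [now apply clamp_continuous|].
    apply continuity_pt_filterlim. apply (Hh (clamp a b t)). now apply clamp_in. }
  assert (Ex : forall x y, ex_RInt k' x y).
  { intros; apply (ex_RInt_continuous (V := R_CompleteNormedModule)); intros; apply Hk'. }
  exists (fun t => h a + RInt k' a t), k'. split; [|split; [|intros t Ht; split]].
  - intros t. evar_last.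
    + apply @is_derive_plus; [apply is_derive_const|].
      apply (is_derive_RInt (V := R_NormedModule) k' _ a); [|apply Hk'].
      apply filter_forall. intros z. apply (RInt_correct (V := R_CompleteNormedModule)), Ex.
    + apply Rplus_0_l.
  - assumption.
  - rewrite (RInt_ext k' (Derive h)).
    + rewrite RInt_Derive; [apply Rplus_minus| |].
      * intros x; segment. intros Hx.
        destruct (Hh x ltac:(lra)) as [(d & Hd & He) _]. apply He.
        rewrite Rminus_diag, Rabs_R0. assumption.
      * intros x; segment. intros Hx.
        apply continuity_pt_filterlim. apply (Hh x ltac:(lra)).
    + intros x; segment. intros Hx. unfold k'. now rewrite clamp_id by lra.
  - unfold k'. now rewrite clamp_id.
Qed.

Definition ccurve (g : curve) (t : R) : C := (cu g t, cv g t).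
Definition ccurve' (g : curve) (t : R) : C := (Derive (cu g) t, Derive (cv g) t).
Definition cint (g : curve) (f : C -> C) : C := CInt (fun t => f (ccurve g t) * ccurve' g t)%C 0 1.
Definition is_cint (g : curve) (f : C -> C) (a b : R) (l : C) : Prop :=
  is_CInt (fun t => f (ccurve g t) * ccurve' g t)%C a b l.

Lemma curve_piece (g : curve) (pu pv : R -> R) a b : a < b ->
  (forall t, a <= t <= b -> pu t = cu g t /\ pv t = cv g t /\ C1_at pu t /\ C1_at pv t) ->
  exists p, (forall z, on_piece p z -> exists t, a <= t <= b /\ ccurve g t = z) /\
    pg p (pa p) = ccurve g a /\ pg p (pb p) = ccurve g b /\
    forall f, (forall z, on_piece p z -> ccont (T := CT) f z) -> is_cint g f a b (pint p f).
Proof.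
  intros Hab H.
  destruct (C1_extend pu a b) as (ku & ku' & Du & Cu & Eu); [lra|intros; now apply H|].
  destruct (C1_extend pv a b) as (kv & kv' & Dv & Cv & Ev); [lra|intros; now apply H|].
  exists (mkPiece a b (fun t => (ku t, kv t)) (fun t => (ku' t, kv' t)) (Rlt_le _ _ Hab)
    (fun t => conj (Du t) (Dv t)) (fun t => conj (Cu t) (Cv t))).
  assert (EQ : forall t, a <= t <= b -> (ku t, kv t) = ccurve g t).
  { intros t Ht. unfold ccurve. destruct (H t Ht) as (<- & <- & _). f_equal; [now apply Eu|now apply Ev]. }
  split; [|split; [|split]]; simpl.
  - intros z (t & Ht & E). exists t. split; [assumption|]. simpl in *. rewrite <- EQ; assumption.
  - apply EQ; lra.
  - apply EQ; lra.
  - intros f Hf.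
    match goal with |- is_cint _ _ _ _ (pint ?p _) => assert (I := is_CInt_pint p f Hf) end.
    refine (is_CInt_ext _ _ _ _ _ (Rlt_le _ _ Hab) _ I).
    intros t Ht. simpl. rewrite EQ by lra. f_equal. unfold ccurve'.
    (* At a break point [Derive (cu g)] need not be a derivative at all. Inside the interval [pu]
       and [cu g] agree in a neighbourhood, so their derivatives agree, and the integral ignores the
       end points. *)
    assert (L : locally t (fun s => a < s < b)).
    { apply (open_and _ _ (open_gt a) (open_lt b)). assumption. }
    f_equal.
    + rewrite (proj2 (Eu t ltac:(lra))). apply Derive_ext_loc. revert L. apply filter_imp.
      intros s Hs. apply (H s ltac:(lra)).
    + rewrite (proj2 (Ev t ltac:(lra))). apply Derive_ext_loc. revert L. apply filter_imp.
      intros s Hs. apply (H s ltac:(lra)).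
Qed.

(** Pieces are appended at successive break points; their boundaries telescope to the end points of
    [g]. *)
Lemma curve_chain (g : curve) : piecewise_C1 g -> exists ps,
  (forall z, on_chain ps z -> on_curve g (fst z) (snd z)) /\
  (forall P, chbd ps P = P (ccurve g 1) - P (ccurve g 0))%C /\
  forall f, (forall z, on_chain ps z -> ccont (T := CT) f z) -> is_cint g f 0 1 (chint ps f).
Proof.
  intros (n & tk & T0 & T1 & Hinc & Hpc).
  assert (Hmono : forall k m, (k + m <= n)%nat -> tk k <= tk (k + m)%nat).
  { intros k m. induction m as [|m IH]; intros Hm; [rewrite Nat.add_0_r; lra|].
    rewrite Nat.add_succ_r. specialize (Hinc (k + m)%nat ltac:(lia)). specialize (IH ltac:(lia)). lra. }
  assert (Hin : forall k, (k <= n)%nat -> 0 <= tk k <= 1).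
  { intros k Hk. rewrite <- T0 at 1. rewrite <- T1. split.
    - exact (Hmono 0%nat k Hk).
    - replace n with (k + (n - k))%nat at 1 by lia. apply Hmono. lia. }
  assert (Q : forall k, (k <= n)%nat -> exists ps,
    (forall z, on_chain ps z -> on_curve g (fst z) (snd z)) /\
    (forall P, chbd ps P = P (ccurve g (tk k)) - P (ccurve g 0))%C /\
    forall f, (forall z, on_chain ps z -> ccont (T := CT) f z) -> is_cint g f 0 (tk k) (chint ps f)).
  { induction k as [|k IH]; intros Hk.
    - exists nil. split; [|split].
      + intros z (p & [] & _).
      + intros P. simpl. rewrite T0. ring.
      + intros f _. simpl. rewrite T0. split; exact (is_RInt_point (V := R_NormedModule) _ 0).
    - destruct (IH ltac:(lia)) as (ps & A1 & A2 & A3).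
      destruct (Hpc k ltac:(lia)) as (pu & pv & Hp).
      destruct (curve_piece g pu pv (tk k) (tk (S k)) (Hinc k ltac:(lia)) Hp) as (p & B1 & B2 & B3 & B4).
      assert (H1 := Hin k ltac:(lia)). assert (H2 := Hin (S k) Hk).
      exists (p :: ps). split; [|split].
      + intros z (q & [<-|Hq] & Hz).
        * destruct (B1 z Hz) as (t & Ht & <-). exists t. simpl. repeat split; lra.
        * apply A1. now exists q.
      + intros P. simpl. rewrite A2, B2, B3. ring.
      + intros f Hf. simpl. rewrite Cplus_comm. eapply is_CInt_Chasles.
        * apply A3. intros; auto using on_chain_tail.
        * apply B4. intros; auto using on_chain_head. }
  destruct (Q n (le_n n)) as (ps & A1 & A2 & A3). rewrite T1 in A2, A3. exists ps. auto.
Qed.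

Lemma chbd_app ps qs P : chbd (ps ++ qs) P = (chbd ps P + chbd qs P)%C.
Proof. induction ps as [|p ps IH]; simpl; [ring|]. rewrite IH. ring. Qed.

Lemma chint_app ps qs f : chint (ps ++ qs) f = (chint ps f + chint qs f)%C.
Proof. induction ps as [|p ps IH]; simpl; [ring|]. rewrite IH. ring. Qed.

Fixpoint lint (l : list curve) (f : C -> C) : C :=
  match l with nil => RtoC 0 | cons g l => (cint g f + lint l f)%C end.

(** The chain is closed because each Jordan curve ends where it starts. Integrability on the single
    curves is recorded too: the quaternionic integrals later are split curve by curve and coordinate
    by coordinate. *)
Lemma curves_chain (l : list curve) : (forall g, In g l -> jordan g /\ piecewise_C1 g) -> exists ps,
  (forall z, on_chain ps z -> exists g, In g l /\ on_curve g (fst z) (snd z)) /\ closed_chain ps /\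
  forall f, (forall z, on_chain ps z -> ccont (T := CT) f z) ->
    (forall g, In g l -> is_cint g f 0 1 (cint g f)) /\ lint l f = chint ps f.
Proof.
  induction l as [|g l IH]; intros Hl.
  - exists nil. split; [|split].
    + intros z (p & [] & _).
    + intros P. reflexivity.
    + intros f _. split; [intros g []|reflexivity].
  - destruct IH as (ps & A1 & A2 & A3); [intros; apply Hl; now right|].
    destruct (Hl g (or_introl eq_refl)) as [(_ & J1 & J2 & _) Hpc].
    destruct (curve_chain g Hpc) as (qs & B1 & B2 & B3).
    assert (Happ : forall z, on_chain (qs ++ ps) z -> on_chain qs z \/ on_chain ps z).
    { intros z (p & Hp & Hz). apply in_app_or in Hp. destruct Hp; [left|right]; now exists p. }
    exists (qs ++ ps). split; [|split].
    + intros z Hz. destruct (Happ z Hz) as [H|H].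
      * exists g. split; [now left|now apply B1].
      * destruct (A1 z H) as (g' & H1 & H2). exists g'. split; [now right|assumption].
    + intros P. rewrite chbd_app, A2, B2. unfold ccurve. rewrite J1, J2. ring.
    + intros f Hf.
      assert (Hq : forall z, on_chain qs z -> ccont (T := CT) f z).
      { intros z (p & Hp & Hz). apply Hf. exists p. split; [apply in_or_app; now left|assumption]. }
      assert (Hp : forall z, on_chain ps z -> ccont (T := CT) f z).
      { intros z (p & Hp & Hz). apply Hf. exists p. split; [apply in_or_app; now right|assumption]. }
      destruct (A3 f Hp) as [C1 C2]. specialize (B3 f Hq).
      assert (E : cint g f = chint qs f) by now apply is_CInt_unique.
      split.
      * intros g' [<-|Hg']; [rewrite E; exact B3|now apply C1].
      * simpl. rewrite chint_app, C2, E. reflexivity.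
Qed.

(** * Winding numbers as values of [int dw / (w - z)] *)

Lemma ln_sqrt_half x : 0 < x -> ln (sqrt x) = / 2 * ln x.
Proof.
  intros Hx. assert (P := sqrt_lt_R0 x Hx).
  rewrite <- (sqrt_sqrt x) at 2 by lra. rewrite ln_mult by assumption. field.
Qed.

Lemma is_derive_ln_dist (x y : R -> R) a b t x' y' : is_derive x t x' -> is_derive y t y' ->
  0 < (x t - a) ^ 2 + (y t - b) ^ 2 ->
  is_derive (fun s => / 2 * ln ((x s - a) ^ 2 + (y s - b) ^ 2)) t
    ((x' * (x t - a) + y' * (y t - b)) / ((x t - a) ^ 2 + (y t - b) ^ 2)).
Proof.
  intros D1 D2 P. auto_derive.
  - split; [eexists; exact D1|]. split; [eexists; exact D2|]. split; [|exact I]. unfold Rminus in P. simpl in P. lra.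
  - change (Derive (fun x0 => x x0) t) with (Derive x t). change (Derive (fun x0 => y x0) t) with (Derive y t).
    rewrite (is_derive_unique _ _ _ D1), (is_derive_unique _ _ _ D2). field. simpl in *. lra.
Qed.

(* The real part of [dw / (w - z)] is the differential of [ln |w - z|]. *)
Lemma pint_inv_re p z : ~ on_piece p z ->
  fst (pint p (fun w => / (w - z))%C) = ln (Cmod (pg p (pb p) - z)) - ln (Cmod (pg p (pa p) - z)).
Proof.
  intros Hz.
  assert (N : forall t, pa p <= t <= pb p -> (pg p t - z)%C <> 0).
  { intros t Ht. apply Cminus_neq_0. intros E. apply Hz. now exists t. }
  assert (Hab := pab p).
  set (L := fun t => / 2 * ln ((fst (pg p t) - fst z) ^ 2 + (snd (pg p t) - snd z) ^ 2)).
  assert (EL : forall t, pa p <= t <= pb p -> L t = ln (Cmod (pg p t - z))).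
  { intros t Ht. unfold L, Cmod.
    assert (P : 0 < fst (pg p t - z)%C ^ 2 + snd (pg p t - z)%C ^ 2).
    { generalize (Cnorm2_neq_0 _ (N t Ht)). set (x := fst _). set (y := snd _). nra. }
    rewrite ln_sqrt_half by exact P. change (fst (pg p t - z)%C) with (fst (pg p t) - fst z).
    change (snd (pg p t - z)%C) with (snd (pg p t) - snd z). reflexivity. }
  rewrite <- !EL by lra.
  unfold pint. simpl. apply is_RInt_unique.
  apply (is_RInt_derive (V := R_CompleteNormedModule) L).
  - intros t; segment; intros Ht.
    assert (P := Cnorm2_neq_0 _ (N t Ht)).
    change (fst (pg p t - z)%C) with (fst (pg p t) - fst z) in P.
    change (snd (pg p t - z)%C) with (snd (pg p t) - snd z) in P.
    destruct (pg_path p t) as [D1 D2].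
    assert (Q1 := pow2_ge_0 (fst (pg p t) - fst z)). assert (Q2 := pow2_ge_0 (snd (pg p t) - snd z)).
    assert (D := is_derive_ln_dist _ _ (fst z) (snd z) t _ _ D1 D2 ltac:(lra)).
    assert (El : fst (/ (pg p t - z) * pg' p t)%C =
      (fst (pg' p t) * (fst (pg p t) - fst z) + snd (pg' p t) * (snd (pg p t) - snd z)) /
        ((fst (pg p t) - fst z) ^ 2 + (snd (pg p t) - snd z) ^ 2)).
    { simpl. unfold Rdiv, Rminus. ring. }
    cbv beta in D. rewrite <- El in D. exact D.
  - intros t; segment; intros Ht.
    apply (ccont_pint p (fun w => / (w - z))%C t). apply ccont_inv_sub.
    intros E. apply (N t Ht). rewrite E. ring.
Qed.

(** The increments of [ln |w - z|] along a closed chain cancel. With this the real integral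
    [winding], which is only an imaginary part, determines the complex integral. *)
Lemma chint_inv_re ps z : closed_chain ps -> ~ on_chain ps z -> fst (chint ps (fun w => / (w - z))%C) = 0.
Proof.
  intros Hcl Hz. transitivity (fst (chbd ps (fun w => RtoC (ln (Cmod (w - z)))))).
  2: { now rewrite Hcl. }
  clear Hcl. induction ps as [|p ps IH]; [reflexivity|].
  simpl chint. simpl chbd. change (fst (?a + ?b)%C) with (fst a + fst b).
  rewrite IH by (intros H; apply Hz; now apply on_chain_tail).
  f_equal. rewrite pint_inv_re by (intros H; apply Hz; now apply on_chain_head). reflexivity.
Qed.

Lemma lint_inv_im l z :
  snd (lint l (fun w => / (w - z))%C) = 2 * PI * sum_curves (fun g => winding g (fst z) (snd z)) l.
Proof.
  induction l as [|g l IH]; simpl; [ring|]. rewrite IH, Rmult_plus_distr_l. f_equal.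
  unfold winding. rewrite <- Rmult_assoc, Rinv_r, Rmult_1_l by (generalize PI_RGT_0; lra).
  apply RInt_ext. intros t _. simpl. unfold Rdiv, Rminus. Req_type; ring.
Qed.

Lemma chain_winding l ps z : closed_chain ps -> ~ on_chain ps z ->
  (lint l (fun w => / (w - z))%C = chint ps (fun w => / (w - z))%C) ->
  chint ps (fun w => / (w - z))%C = (RtoC (sum_curves (fun g => winding g (fst z) (snd z)) l) * tpi)%C.
Proof.
  intros Hcl Hz E.
  assert (E1 := chint_inv_re ps z Hcl Hz). assert (E2 := lint_inv_im l z). rewrite E in E2.
  destruct (chint ps _) as [x y]. simpl in E1, E2. rewrite E1, E2.
  unfold tpi, RtoC, Cmult; simpl. f_equal; ring.
Qed.

(** * Neighbourhoods and continuity in the space of quaternions *)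

(** The neighbourhood filter in coordinate form, with cubes for balls, so that limit theorems for
    filters apply and coordinates are visibly continuous. [Hnear_dist] compares it with the
    Euclidean distance. *)
Definition Hnear (q : H) (P : H -> Prop) : Prop := exists eps, 0 < eps /\ forall p,
  Rabs (h0 p - h0 q) < eps -> Rabs (h1 p - h1 q) < eps -> Rabs (h2 p - h2 q) < eps ->
  Rabs (h3 p - h3 q) < eps -> P p.

Lemma Rabs_le_sqrt x y : x ^ 2 <= y -> Rabs x <= sqrt y.
Proof. intros Hxy. rewrite <- sqrt_Rsqr_abs. apply sqrt_le_1_alt. unfold Rsqr. simpl in Hxy. lra. Qed.

Lemma Hnear_dist q P : Hnear q P <-> exists eps, 0 < eps /\ forall p, Hdist p q < eps -> P p.
Proof.
  split.
  - intros (eps & He & HP). exists eps. split; [assumption|]. intros p Hp.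
    unfold Hdist, Hnorm, Hnorm2 in Hp. simpl in Hp.
    apply HP; (eapply Rle_lt_trans; [apply Rabs_le_sqrt|exact Hp]);
    generalize (Rle_0_sqr (h0 p - h0 q)) (Rle_0_sqr (h1 p - h1 q)) (Rle_0_sqr (h2 p - h2 q))
      (Rle_0_sqr (h3 p - h3 q)); unfold Rsqr; simpl; unfold Rminus; lra.
  - intros (eps & He & HP). exists (eps / 4). split; [lra|]. intros p A0 A1 A2 A3. apply HP.
    unfold Hdist, Hnorm, Hnorm2. simpl.
    apply Rabs_def2 in A0. apply Rabs_def2 in A1. apply Rabs_def2 in A2. apply Rabs_def2 in A3.
    rewrite <- (sqrt_square eps) by lra. unfold Rminus in *.
    set (x := h0 p + - h0 q) in *. set (y := h1 p + - h1 q) in *.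
    set (z := h2 p + - h2 q) in *. set (w := h3 p + - h3 q) in *.
    assert (Sq : forall v, v < eps / 4 /\ - (eps / 4) < v -> 0 <= v * v <= eps * eps / 16) by (intros; nra).
    apply Sq in A0. apply Sq in A1. apply Sq in A2. apply Sq in A3.
    assert (0 < eps * eps) by nra. apply sqrt_lt_1_alt. lra.
Qed.

Global Instance Hnear_filter q : ProperFilter (Hnear q).
Proof.
  constructor.
  - intros P (eps & He & HP). exists q. apply HP; rewrite Rminus_diag, Rabs_R0; assumption.
  - constructor.
    + exists 1. split; [lra|trivial].
    + intros P Q (e1 & He1 & HP) (e2 & He2 & HQ). exists (Rmin e1 e2). split; [now apply Rmin_pos|].
      assert (M1 := Rmin_l e1 e2). assert (M2 := Rmin_r e1 e2).
      intros p A0 A1 A2 A3. split; [apply HP|apply HQ]; lra.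
    + intros P Q HPQ (e1 & He1 & HP). exists e1. auto.
Qed.

(** An identity near [q] is also an identity near each point close to [q], where it can be
    differentiated again. Second partial derivatives depend on this. *)
Lemma Hnear_Hnear q P : Hnear q P -> Hnear q (fun p => Hnear p P).
Proof.
  intros (eps & He & HP). exists (eps / 2). split; [lra|]. intros p A0 A1 A2 A3.
  exists (eps / 2). split; [lra|]. intros r B0 B1 B2 B3.
  apply HP; [clear - A0 B0|clear - A1 B1|clear - A2 B2|clear - A3 B3];
  match goal with H1 : _ < _, H2 : _ < _ |- _ => revert H1 H2 end;
  unfold Rabs; repeat destruct Rcase_abs; lra.
Qed.

Lemma Hnear_self q P : Hnear q P -> P q.
Proof. intros (eps & He & HP). apply HP; rewrite Rminus_diag, Rabs_R0; assumption. Qed.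

Lemma Hnear_line q i P : Hnear q P -> locally 0 (fun t => P (Hadd q (Hscal t (He i)))).
Proof.
  intros (eps & He & HP).
  assert (Z : forall x t : R, Rabs (x + t * 0 - x) < eps).
  { intros x t. replace (x + t * 0 - x) with 0 by ring. now rewrite Rabs_R0. }
  assert (O : forall x t : R, Rabs t < eps -> Rabs (x + t * 1 - x) < eps).
  { intros x t Ht. replace (x + t * 1 - x) with t by ring. assumption. }
  exists (mkposreal _ He). intros t Ht.
  change (Rabs (t - 0) < eps) in Ht. rewrite Rminus_0_r in Ht.
  apply HP; destruct i as [|[|[|i]]]; simpl; auto.
Qed.

Definition hcont (g : H -> R) (q : H) : Prop := filterlim g (Hnear q) (locally (g q)).

Lemma hcont_H_cont_at g q : hcont g q -> H_cont_at g q.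
Proof.
  intros Hg eps He. apply Hnear_dist.
  exact (proj1 (filterlim_locally g (g q)) Hg (mkposreal _ He)).
Qed.

Lemma hcont_const c q : hcont (fun _ => c) q.
Proof. apply filterlim_const. Qed.

Lemma hcont_plus f g q : hcont f q -> hcont g q -> hcont (fun p => f p + g p) q.
Proof.
  intros Hf Hg. exact (filterlim_comp_2 _ _ _ Hf Hg (filterlim_plus (V := R_NormedModule) (f q) (g q))).
Qed.

Lemma hcont_mult f g q : hcont f q -> hcont g q -> hcont (fun p => f p * g p) q.
Proof.
  intros Hf Hg. exact (filterlim_comp_2 _ _ _ Hf Hg (filterlim_mult (K := R_AbsRing) (f q) (g q))).
Qed.

Lemma hcont_ext_loc f g q : Hnear q (fun p => f p = g p) -> hcont f q -> hcont g q.
Proof.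
  intros E Hf. unfold hcont. rewrite <- (Hnear_self _ _ E).
  eapply filterlim_ext_loc; [exact E|exact Hf].
Qed.

Lemma hcont_coord i q : hcont (fun p => Hc p i) q.
Proof.
  apply filterlim_locally. intros eps. exists eps. split; [apply cond_pos|].
  intros p A0 A1 A2 A3. destruct i as [|[|[|i]]]; assumption.
Qed.

Lemma hcont_comp_2 (k : R -> R -> R) f g q : continuity_2d_pt k (f q) (g q) ->
  hcont f q -> hcont g q -> hcont (fun p => k (f p) (g p)) q.
Proof.
  intros Hk Hf Hg. apply continuity_2d_pt_filterlim in Hk.
  assert (L := filterlim_pair _ _ Hf Hg).
  refine (filterlim_comp _ _ _ (fun p => (f p, g p)) (fun z => k (fst z) (snd z)) _ _ _ L _).
  revert Hk. apply filterlim_filter_le_1. intros P [eps HP].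
  exists (ball (f q) eps) (ball (g q) eps); [now exists eps|now exists eps|].
  intros u v Hu Hv. apply HP. now split.
Qed.

Lemma hcont_Hnorm2 q : hcont Hnorm2 q.
Proof.
  assert (S : forall i, hcont (fun p => Hc p i ^ 2) q).
  { intros i. simpl. apply hcont_mult; [apply hcont_coord|]. apply hcont_mult; [apply hcont_coord|apply hcont_const]. }
  exact (hcont_plus _ _ q (hcont_plus _ _ q (hcont_plus _ _ q (S 0%nat) (S 1%nat)) (S 2%nat)) (S 3%nat)).
Qed.

(** * Potentials [Re (int K / (zeta^2 - 2 q0 zeta + |q|^2)^n)] *)

Section Potential.
Variable zeta : R -> C.
Hypothesis Hzeta : forall t, ccont zeta t.

(** Here [x] stands for [q0] and [y] for [|q|^2]. As independent variables they enter affinely, so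
    [CInt_kernel_taylor] gives all derivatives. *)
Definition Qz (x y : R) (t : R) : C := (zeta t * zeta t - RtoC (2 * x) * zeta t + RtoC y)%C.
Definition EK (n : nat) (K : R -> C) (x y : R) : C :=
  CInt (fun t => K t * (/ Qz x y t) ^ n)%C 0 (2 * PI).
Definition regular (x y : R) : Prop := forall t, 0 <= t <= 2 * PI -> Qz x y t <> 0.

Lemma ccont_Qz x y t : ccont (Qz x y) t.
Proof.
  apply ccont_plus; [|apply ccont_const]. apply ccont_minus; apply ccont_mult; try apply Hzeta. apply ccont_const.
Qed.

Lemma EK_taylor n K x y : (forall t, ccont K t) -> regular x y -> exists m M, 0 < m /\ 0 <= M /\
  forall h k, Rabs h + Rabs k <= m -> regular (x + h) (y + k) /\
  Cmod (EK n K (x + h) (y + k) - EK n K x y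
    - (RtoC (2 * INR n * h) * EK (S n) (fun t => K t * zeta t)%C x y - RtoC (INR n * k) * EK (S n) K x y))
  <= M * ((Rabs h + Rabs k) * (Rabs h + Rabs k)).
Proof.
  intros HK Hr.
  destruct (CInt_kernel_taylor K (Qz x y) 0 (2 * PI) n two_PI_pos (fun t _ => HK t) (fun t _ => ccont_Qz x y t) Hr)
    as (m & M & Hm & HM & H).
  destruct (ccont_bounded zeta 0 (2 * PI) (fun t _ => Hzeta t)) as (Z & HZ & Zb).
  (* The perturbation of the denominator is [k - 2 h zeta], which is at most [c * (|h| + |k|)]. *)
  set (c := 2 * Z + 1).
  assert (Hc : 0 < c) by (unfold c; lra).
  exists (m / c), (M * (c * c)). split; [now apply Rdiv_lt_0_compat|]. split; [nra|].
  intros h k Hhk.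
  set (d := fun t => (RtoC k - RtoC (2 * h) * zeta t)%C).
  assert (Ph := Rabs_pos h). assert (Pk := Rabs_pos k).
  destruct (H d (c * (Rabs h + Rabs k))) as [H1 H2].
  - intros t _. apply ccont_minus; [apply ccont_const|]. apply ccont_mult; [apply ccont_const|apply Hzeta].
  - apply Rle_trans with (c * (m / c)); [apply Rmult_le_compat_l; lra|]. apply Req_le. field. lra.
  - intros t Ht. unfold d. eapply Rle_trans; [apply Cmod_triangle|].
    rewrite Cmod_opp, Cmod_mult, !Cmod_R, Rabs_mult, (Rabs_pos_eq 2) by lra.
    specialize (Zb t Ht). unfold c. assert (Rabs h * Cmod (zeta t) <= Rabs h * Z) by now apply Rmult_le_compat_l. nra.
  - assert (EQ : forall t, (Qz x y t + d t)%C = Qz (x + h) (y + k) t).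
    { intros t. unfold Qz, d. rewrite Rmult_plus_distr_l, !RtoC_plus. ring. }
    split.
    + intros t Ht. rewrite <- EQ. now apply H1.
    + assert (E1 : CInt (fun t => K t * (/ (Qz x y t + d t)) ^ n)%C 0 (2 * PI) = EK n K (x + h) (y + k)).
      { unfold EK, CInt. f_equal; apply RInt_ext; intros t _; now rewrite EQ. }
      assert (E2 : CInt (fun t => K t * d t * (/ Qz x y t) ^ S n)%C 0 (2 * PI) =
        (RtoC k * EK (S n) K x y - RtoC (2 * h) * EK (S n) (fun t => K t * zeta t)%C x y)%C).
      { apply is_CInt_unique.
        assert (I1 : is_CInt (fun t => K t * (/ Qz x y t) ^ S n)%C 0 (2 * PI) (EK (S n) K x y)).
        { apply is_CInt_ccont; [apply two_PI_pos|]. intros t Ht. apply ccont_kernel; auto. apply ccont_Qz. }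
        assert (I2 : is_CInt (fun t => K t * zeta t * (/ Qz x y t) ^ S n)%C 0 (2 * PI)
           (EK (S n) (fun t => K t * zeta t)%C x y)).
        { apply is_CInt_ccont; [apply two_PI_pos|]. intros t Ht.
          apply (ccont_kernel (fun t => K t * zeta t)%C); auto; [|apply ccont_Qz]. apply ccont_mult; auto. }
        eapply is_CInt_ext; [apply two_PI_pos| |exact (is_CInt_minus _ _ _ _ _ _
          (is_CInt_scal _ _ _ _ (RtoC k) I1) (is_CInt_scal _ _ _ _ (RtoC (2 * h)) I2))].
        intros t _. unfold d. simpl. ring. }
      rewrite E1, E2 in H2. fold (EK n K x y) in H2.
      eapply Rle_trans; [|eapply Rle_trans; [exact H2|apply Req_le; ring]].
      apply Req_le. f_equal. rewrite !RtoC_mult. ring.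
Qed.

Definition ak (n : nat) (K : R -> C) (x y : R) : R := fst (EK n K x y).

Lemma ak_differentiable n K x y : (forall t, ccont K t) -> regular x y ->
  differentiable_pt_lim (ak n K) x y (2 * INR n * ak (S n) (fun t => K t * zeta t)%C x y) (- INR n * ak (S n) K x y).
Proof.
  intros HK Hr. destruct (EK_taylor n K x y HK Hr) as (m & M & Hm & HM & H). intros eps.
  (* With [s] the larger increment the remainder is at most [4 * M * s^2], and
     [s * (4 * M + 1) <= eps] makes it at most [eps * s]. *)
  set (dd := Rmin (m / 2) (eps / (4 * M + 1))).
  assert (Hdd : 0 < dd).
  { apply Rmin_pos; [lra|]. apply Rdiv_lt_0_compat; [apply cond_pos|lra]. }
  assert (L1 : dd <= m / 2) by apply Rmin_l. assert (L2 : dd <= eps / (4 * M + 1)) by apply Rmin_r.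
  exists (mkposreal _ Hdd). simpl. intros u v Hu Hv.
  destruct (H (u - x) (v - y)) as [_ B]; [lra|].
  replace (x + (u - x)) with u in B by ring. replace (y + (v - y)) with v in B by ring.
  set (s := Rmax (Rabs (u - x)) (Rabs (v - y))).
  assert (S1 : Rabs (u - x) <= s) by apply Rmax_l. assert (S2 : Rabs (v - y) <= s) by apply Rmax_r.
  assert (S3 : s < dd) by now apply Rmax_lub_lt.
  assert (P1 := Rabs_pos (u - x)). assert (P2 := Rabs_pos (v - y)).
  eapply Rle_trans; [|eapply Rle_trans; [eapply Rle_trans; [apply Cmod_fst|exact B]|]].
  - apply Req_le. f_equal. unfold ak. simpl. ring.
  - assert (M * ((Rabs (u - x) + Rabs (v - y)) * (Rabs (u - x) + Rabs (v - y))) <= M * (2 * s * (2 * s))).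
    { apply Rmult_le_compat_l; [assumption|]. apply Rmult_le_compat; lra. }
    assert (s * (4 * M + 1) <= eps).
    { apply Rle_trans with (eps / (4 * M + 1) * (4 * M + 1)); [apply Rmult_le_compat_r; lra|].
      apply Req_le. field. lra. }
    assert (4 * M * s <= eps) by nra. nra.
Qed.

Lemma ak_continuous n K x y : (forall t, ccont K t) -> regular x y -> continuity_2d_pt (ak n K) x y.
Proof.
  intros HK Hr. apply differentiable_continuity_pt. eexists. eexists. now apply ak_differentiable.
Qed.

Definition AH (n : nat) (K : R -> C) (q : H) : R := ak n K (h0 q) (Hnorm2 q).
Definition regularH (q : H) : Prop := regular (h0 q) (Hnorm2 q).
Definition del (i j : nat) : R := Hc (He i) j.

Lemma is_derive_coord q i j : is_derive (fun t => Hc (Hadd q (Hscal t (He i))) j) 0 (del i j).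
Proof.
  unfold del. destruct i as [|[|[|i]]], j as [|[|[|j]]]; simpl; auto_derive; trivial; ring.
Qed.

Lemma is_derive_Hnorm2 q i : is_derive (fun t => Hnorm2 (Hadd q (Hscal t (He i)))) 0 (2 * Hc q i).
Proof.
  unfold Hnorm2. destruct i as [|[|[|i]]]; simpl; auto_derive; trivial; ring.
Qed.

Lemma Hadd_scal_0 q v : Hadd q (Hscal 0 v) = q.
Proof. destruct q, v. unfold Hadd, Hscal. simpl. f_equal; ring. Qed.

Lemma is_derive_AH n K q i : (forall t, ccont K t) -> regularH q ->
  is_derive (fun t => AH n K (Hadd q (Hscal t (He i)))) 0
    (2 * INR n * (del i 0 * AH (S n) (fun t => K t * zeta t)%C q - Hc q i * AH (S n) K q)).
Proof.
  intros HK Hr. apply is_derive_Reals. unfold AH.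
  assert (D := ak_differentiable n K _ _ HK Hr).
  assert (D1 := is_derive_coord q i 0). assert (D2 := is_derive_Hnorm2 q i).
  apply is_derive_Reals in D1. apply is_derive_Reals in D2.
  assert (X := derivable_pt_lim_comp_2d (ak n K) (fun t => h0 (Hadd q (Hscal t (He i))))
    (fun t => Hnorm2 (Hadd q (Hscal t (He i)))) 0
    (2 * INR n * ak (S n) (fun t => K t * zeta t)%C (h0 q) (Hnorm2 q)) (- INR n * ak (S n) K (h0 q) (Hnorm2 q)) (del i 0) (2 * Hc q i)).
  cbv beta in X; rewrite Hadd_scal_0 in X. specialize (X D D1 D2).
  match goal with |- derivable_pt_lim _ _ ?l => match type of X with derivable_pt_lim _ _ ?l' => replace l with l' by ring end end.
  exact X.
Qed.

Lemma hcont_AH n K q : (forall t, ccont K t) -> regularH q -> hcont (AH n K) q.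
Proof.
  intros HK Hr. apply (hcont_comp_2 (ak n K) h0 Hnorm2).
  - now apply ak_continuous.
  - exact (hcont_coord 0 q).
  - apply hcont_Hnorm2.
Qed.

Lemma regularH_near q : regularH q -> Hnear q regularH.
Proof.
  (* The zero kernel is enough, since only the conclusion on [regular] is used. *)
  intros Hr. destruct (EK_taylor 0 (fun _ => RtoC 0) _ _ (fun _ => ccont_const _ _) Hr) as (m & M & Hm & _ & H).
  assert (Hm2 : 0 < m / 2) by lra.
  assert (C1 := proj1 (filterlim_locally _ _) (hcont_coord 0 q) (mkposreal _ Hm2)).
  assert (C2 := proj1 (filterlim_locally _ _) (hcont_Hnorm2 q) (mkposreal _ Hm2)).
  generalize (filter_and _ _ C1 C2). apply filter_imp. intros p [B1 B2].
  change (Rabs (h0 p - h0 q) < m / 2) in B1. change (Rabs (Hnorm2 p - Hnorm2 q) < m / 2) in B2.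
  destruct (H (h0 p - h0 q) (Hnorm2 p - Hnorm2 q)) as [R _]; [lra|].
  unfold regularH. replace (h0 p) with (h0 q + (h0 p - h0 q)) by ring.
  replace (Hnorm2 p) with (Hnorm2 q + (Hnorm2 p - Hnorm2 q)) by ring. exact R.
Qed.

Variable K : R -> C.
Hypothesis HK : forall t, ccont K t.
Let K1 := fun t => (K t * zeta t)%C.
Let K2 := fun t => (K1 t * zeta t)%C.

Lemma HK1 t : ccont K1 t.
Proof. apply ccont_mult; auto. Qed.

Lemma HK2 t : ccont K2 t.
Proof. apply ccont_mult; [apply HK1|auto]. Qed.

(** Gradient and, below it, Hessian of [AH 1 K], from the partial derivatives [del i 0] of [q0] and
    [2 q_i] of [|q|^2]. The kernels [K1] and [K2] absorb the powers of [zeta] that differentiating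
    [- 2 q0 zeta] brings out. *)
Definition dpot (i : nat) (q : H) : R := 2 * (del i 0 * AH 2 K1 q - Hc q i * AH 2 K q).
Definition ddpot (i j : nat) (q : H) : R :=
  2 * (del i 0 * (4 * (del j 0 * AH 3 K2 q - Hc q j * AH 3 K1 q))
       - (del j i * AH 2 K q + Hc q i * (4 * (del j 0 * AH 3 K1 q - Hc q j * AH 3 K q)))).

Lemma is_derive_pot q i : regularH q ->
  is_derive (fun t => AH 1 K (Hadd q (Hscal t (He i)))) 0 (dpot i q).
Proof.
  intros Hr. assert (D := is_derive_AH 1 K q i HK Hr).
  unfold dpot. simpl INR in D. rewrite Rmult_1_r in D. exact D.
Qed.

Lemma is_derive_dpot q i j : regularH q ->
  is_derive (fun t => dpot i (Hadd q (Hscal t (He j)))) 0 (ddpot i j q).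
Proof.
  intros Hr.
  assert (D1 := is_derive_AH 2 K1 q j HK1 Hr). assert (D2 := is_derive_AH 2 K q j HK Hr).
  assert (D3 := is_derive_coord q j i). fold K1 in D2. fold K2 in D1.
  unfold dpot, ddpot.
  set (f1 := fun t => AH 2 K1 (Hadd q (Hscal t (He j)))).
  set (f2 := fun t => AH 2 K (Hadd q (Hscal t (He j)))).
  set (f3 := fun t => Hc (Hadd q (Hscal t (He j))) i).
  change (is_derive (fun t => 2 * (del i 0 * f1 t - f3 t * f2 t)) 0 (2 * (del i 0 * (4 * (del j 0 * AH 3 K2 q - Hc q j * AH 3 K1 q))
       - (del j i * AH 2 K q + Hc q i * (4 * (del j 0 * AH 3 K1 q - Hc q j * AH 3 K q)))))).
  assert (E2 : f2 0 = AH 2 K q) by (unfold f2; now rewrite Hadd_scal_0).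
  assert (E3 : f3 0 = Hc q i) by (unfold f3; now rewrite Hadd_scal_0).
  change (is_derive f1 0 (2 * INR 2 * (del j 0 * AH 3 K2 q - Hc q j * AH 3 K1 q))) in D1.
  change (is_derive f2 0 (2 * INR 2 * (del j 0 * AH 3 K1 q - Hc q j * AH 3 K q))) in D2.
  change (is_derive f3 0 (del j i)) in D3.
  clearbody f1 f2 f3.
  auto_derive.
  - split; [eexists; exact D1|]. split; [eexists; exact D3|]. split; [eexists; exact D2|exact I].
  - change (Derive (fun x => f1 x) 0) with (Derive f1 0). change (Derive (fun x => f2 x) 0) with (Derive f2 0).
    change (Derive (fun x => f3 x) 0) with (Derive f3 0).
    rewrite (is_derive_unique _ _ _ D1), (is_derive_unique _ _ _ D2), (is_derive_unique _ _ _ D3), E2, E3.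
    simpl INR. change (h0 (He i)) with (del i 0). ring.
Qed.

(** The trace is [8 (int K (zeta^2 - 2 q0 zeta + |q|^2) / Q^3 - int K / Q^2)], which is zero by the
    definition of [Q]. The coefficient of the last term counts the four dimensions, so the
    cancellation is specific to them. *)
Lemma ddpot_laplace q : regularH q -> ddpot 0 0 q + ddpot 1 1 q + ddpot 2 2 q + ddpot 3 3 q = 0.
Proof.
  intros Hr. unfold ddpot, del. simpl Hc.
  assert (E : AH 2 K q = AH 3 K2 q - 2 * h0 q * AH 3 K1 q + Hnorm2 q * AH 3 K q).
  { assert (I : forall L, (forall t, ccont L t) -> is_CInt (fun t => L t * (/ Qz (h0 q) (Hnorm2 q) t) ^ 3)%C 0 (2 * PI)
       (EK 3 L (h0 q) (Hnorm2 q))).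
    { intros L HL. apply is_CInt_ccont; [apply two_PI_pos|]. intros t Ht. apply ccont_kernel; auto. apply ccont_Qz. }
    assert (J := is_CInt_plus _ _ _ _ _ _ (is_CInt_minus _ _ _ _ _ _ (I K2 HK2)
       (is_CInt_scal _ _ _ _ (RtoC (2 * h0 q)) (I K1 HK1))) (is_CInt_scal _ _ _ _ (RtoC (Hnorm2 q)) (I K HK))).
    assert (E : EK 2 K (h0 q) (Hnorm2 q) = (EK 3 K2 (h0 q) (Hnorm2 q) - RtoC (2 * h0 q) * EK 3 K1 (h0 q) (Hnorm2 q)
       + RtoC (Hnorm2 q) * EK 3 K (h0 q) (Hnorm2 q))%C).
    { apply is_CInt_unique. eapply is_CInt_ext; [apply two_PI_pos| |exact J].
      intros t Ht. assert (N := Hr t ltac:(lra)). unfold K2, K1. simpl.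
      assert (Hv := Cinv_r _ N). set (v := (/ Qz (h0 q) (Hnorm2 q) t)%C) in *.
      transitivity (K t * (Qz (h0 q) (Hnorm2 q) t * v) * (v * v))%C.
      - unfold Qz. ring.
      - rewrite Hv. ring. }
    unfold AH, ak. rewrite E. simpl. ring. }
  rewrite E. unfold Hnorm2. ring.
Qed.

(** The equality with the potential holds near [q]; it is transported to first partial derivatives
    near [q], and from these to second ones. *)
Lemma harmonic_of_potential (g : H -> R) q : regularH q -> Hnear q (fun p => g p = AH 1 K p) ->
  H_cont_at g q /\
    (forall i j, (i <= 3)%nat -> (j <= 3)%nat ->
       Rpartial_ex i g q /\ H_cont_at (Rpartial i g) q /\
       Rpartial_ex j (Rpartial i g) q /\ H_cont_at (Rpartial j (Rpartial i g)) q) /\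
    Rpartial 0 (Rpartial 0 g) q + Rpartial 1 (Rpartial 1 g) q
    + Rpartial 2 (Rpartial 2 g) q + Rpartial 3 (Rpartial 3 g) q = 0.
Proof.
  intros Hr0 Hg.
  assert (Hr := regularH_near q Hr0).
  assert (N : Hnear q (fun p => regularH p /\ g p = AH 1 K p)) by now apply filter_and.
  assert (D1 : forall p i, Hnear p (fun p => regularH p /\ g p = AH 1 K p) ->
     is_derive (fun t => g (Hadd p (Hscal t (He i)))) 0 (dpot i p)).
  { intros p i Hp. apply (is_derive_ext_loc (fun t => AH 1 K (Hadd p (Hscal t (He i))))).
    - generalize (Hnear_line p i _ Hp). apply filter_imp. intros t [_ E]. now symmetry.
    - apply is_derive_pot. apply (Hnear_self _ _ Hp). }
  assert (P1 : forall i, Hnear q (fun p => regularH p /\ Rpartial i g p = dpot i p)).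
  { intros i. generalize (Hnear_Hnear _ _ N). apply filter_imp. intros p Hp. split.
    - apply (Hnear_self _ _ Hp).
    - apply is_derive_unique. now apply D1. }
  assert (D2 : forall i j p, Hnear p (fun p => regularH p /\ Rpartial i g p = dpot i p) ->
     is_derive (fun t => Rpartial i g (Hadd p (Hscal t (He j)))) 0 (ddpot i j p)).
  { intros i j p Hp. apply (is_derive_ext_loc (fun t => dpot i (Hadd p (Hscal t (He j))))).
    - generalize (Hnear_line p j _ Hp). apply filter_imp. intros t [_ E]. now symmetry.
    - apply is_derive_dpot. apply (Hnear_self _ _ Hp). }
  assert (P2 : forall i j, Hnear q (fun p => Rpartial j (Rpartial i g) p = ddpot i j p)).
  { intros i j. generalize (Hnear_Hnear _ _ (P1 i)). apply filter_imp. intros p Hp.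
    apply is_derive_unique. now apply D2. }
  assert (CA : forall n L, (forall t, ccont L t) -> hcont (AH n L) q) by (intros; now apply hcont_AH).
  assert (Cm : forall f h, hcont f q -> hcont h q -> hcont (fun p => f p - h p) q).
  { intros f h Hf Hh. apply (hcont_ext_loc (fun p => f p + (-1) * h p)).
    - apply filter_forall. intros p. ring.
    - apply hcont_plus; [assumption|]. apply hcont_mult; [apply hcont_const|assumption]. }
  split; [|split].
  - apply hcont_H_cont_at. apply (hcont_ext_loc (AH 1 K)).
    + revert Hg. apply filter_imp. intros p Hp; now symmetry.
    + now apply CA.
  - intros i j _ _. split; [|split; [|split]].
    + eexists. now apply D1.
    + apply hcont_H_cont_at, (hcont_ext_loc (dpot i)).
      * generalize (P1 i). apply filter_imp. intros p [_ Hp]; now symmetry.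
      * unfold dpot. apply hcont_mult; [apply hcont_const|]. apply Cm.
        -- apply hcont_mult; [apply hcont_const|apply CA, HK1].
        -- apply hcont_mult; [apply hcont_coord|apply CA, HK].
    + eexists. now apply D2.
    + apply hcont_H_cont_at, (hcont_ext_loc (ddpot i j)).
      * generalize (P2 i j). apply filter_imp. intros p Hp; now symmetry.
      * unfold ddpot. apply hcont_mult; [apply hcont_const|]. apply Cm.
        -- apply hcont_mult; [apply hcont_const|]. apply hcont_mult; [apply hcont_const|]. apply Cm.
           ++ apply hcont_mult; [apply hcont_const|apply CA, HK2].
           ++ apply hcont_mult; [apply hcont_coord|apply CA, HK1].
        -- apply hcont_plus; [apply hcont_mult; [apply hcont_const|apply CA, HK]|].
           apply hcont_mult; [apply hcont_coord|]. apply hcont_mult; [apply hcont_const|]. apply Cm.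
           ++ apply hcont_mult; [apply hcont_const|apply CA, HK1].
           ++ apply hcont_mult; [apply hcont_coord|apply CA, HK].
  - rewrite <- (ddpot_laplace q Hr0).
    rewrite (Hnear_self _ _ (P2 0%nat 0%nat)), (Hnear_self _ _ (P2 1%nat 1%nat)),
      (Hnear_self _ _ (P2 2%nat 2%nat)), (Hnear_self _ _ (P2 3%nat 3%nat)). reflexivity.
Qed.
End Potential.

(** * Slice functions and the Fueter operator *)

Lemma H_ext p q : h0 p = h0 q -> h1 p = h1 q -> h2 p = h2 q -> h3 p = h3 q -> p = q.
Proof. destruct p, q; simpl; intros; subst; reflexivity. Qed.

Definition is_Hderive (f : R -> H) (t : R) (l : H) : Prop :=
  is_derive (fun s => h0 (f s)) t (h0 l) /\ is_derive (fun s => h1 (f s)) t (h1 l) /\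
  is_derive (fun s => h2 (f s)) t (h2 l) /\ is_derive (fun s => h3 (f s)) t (h3 l).

Lemma is_derive_Rmult (f g : R -> R) t f' g' : is_derive f t f' -> is_derive g t g' ->
  is_derive (fun s => f s * g s) t (f' * g t + f t * g').
Proof. intros Hf Hg. exact (is_derive_mult f g t f' g' Hf Hg Rmult_comm). Qed.

Lemma is_derive_Rplus (f g : R -> R) t f' g' : is_derive f t f' -> is_derive g t g' ->
  is_derive (fun s => f s + g s) t (f' + g').
Proof. intros Hf Hg. exact (is_derive_plus f g t f' g' Hf Hg). Qed.

Lemma is_derive_Rminus (f g : R -> R) t f' g' : is_derive f t f' -> is_derive g t g' ->
  is_derive (fun s => f s - g s) t (f' - g').
Proof. intros Hf Hg. exact (is_derive_minus f g t f' g' Hf Hg). Qed.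

Lemma is_derive_eq (f : R -> R) t l l' : is_derive f t l -> l = l' -> is_derive f t l'.
Proof. now intros D <-. Qed.

Lemma is_Hderive_add f g t l m : is_Hderive f t l -> is_Hderive g t m ->
  is_Hderive (fun s => Hadd (f s) (g s)) t (Hadd l m).
Proof.
  intros (A0 & A1 & A2 & A3) (B0 & B1 & B2 & B3). unfold is_Hderive; simpl.
  split; [|split; [|split]]; now apply is_derive_Rplus.
Qed.

Lemma is_Hderive_mul f g t l m : is_Hderive f t l -> is_Hderive g t m ->
  is_Hderive (fun s => Hmul (f s) (g s)) t (Hadd (Hmul l (g t)) (Hmul (f t) m)).
Proof.
  intros (A0 & A1 & A2 & A3) (B0 & B1 & B2 & B3). unfold is_Hderive; simpl.
  pose (M := fun x y x' y' => is_derive_Rmult x y t x' y').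
  pose (P := fun x y x' y' => is_derive_Rplus x y t x' y').
  pose (S := fun x y x' y' => is_derive_Rminus x y t x' y').
  split; [|split; [|split]].
  - assert (D := S _ _ _ _ (S _ _ _ _ (S _ _ _ _ (M _ _ _ _ A0 B0) (M _ _ _ _ A1 B1)) (M _ _ _ _ A2 B2)) (M _ _ _ _ A3 B3)).
    cbv beta in D. refine (is_derive_eq _ _ _ _ D _). Req_type; ring.
  - assert (D := S _ _ _ _ (P _ _ _ _ (P _ _ _ _ (M _ _ _ _ A0 B1) (M _ _ _ _ A1 B0)) (M _ _ _ _ A2 B3)) (M _ _ _ _ A3 B2)).
    cbv beta in D. refine (is_derive_eq _ _ _ _ D _). Req_type; ring.
  - assert (D := P _ _ _ _ (P _ _ _ _ (S _ _ _ _ (M _ _ _ _ A0 B2) (M _ _ _ _ A1 B3)) (M _ _ _ _ A2 B0)) (M _ _ _ _ A3 B1)).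
    cbv beta in D. refine (is_derive_eq _ _ _ _ D _). Req_type; ring.
  - assert (D := P _ _ _ _ (S _ _ _ _ (P _ _ _ _ (M _ _ _ _ A0 B3) (M _ _ _ _ A1 B2)) (M _ _ _ _ A2 B1)) (M _ _ _ _ A3 B0)).
    cbv beta in D. refine (is_derive_eq _ _ _ _ D _). Req_type; ring.
Qed.

Lemma is_Hderive_ext_loc f g t l : locally t (fun s => f s = g s) -> is_Hderive f t l -> is_Hderive g t l.
Proof.
  intros E (A0 & A1 & A2 & A3).
  split; [|split; [|split]]; (eapply is_derive_ext_loc; [|eassumption]);
  revert E; apply filter_imp; intros s Hs; now rewrite Hs.
Qed.

Lemma is_Hderive_eq f t l l' : l = l' -> is_Hderive f t l -> is_Hderive f t l'.
Proof. now intros ->. Qed.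

Lemma Hpartial_unique i f q l :
  is_Hderive (fun t => f (Hadd q (Hscal t (He i)))) 0 l -> Hpartial i f q = l.
Proof.
  intros (A0 & A1 & A2 & A3). unfold Hpartial, Rpartial. destruct l.
  f_equal; now apply is_derive_unique.
Qed.

Lemma in_S_He i : (1 <= i)%nat -> in_S (He i).
Proof. intros Hi. unfold in_S, Hnorm2. destruct i as [|[|[|i]]]; [lia| | |]; simpl; split; ring. Qed.

Lemma in_S_opp J : in_S J -> in_S (Hopp J).
Proof. unfold in_S, Hnorm2. simpl. intros [E1 E2]. split; [rewrite E1; ring|etransitivity; [|exact E2]; ring]. Qed.

(** * Polar coordinates around the real axis *)

Definition rim2 (q : H) : R := h1 q ^ 2 + h2 q ^ 2 + h3 q ^ 2.
Definition rim (q : H) : R := sqrt (rim2 q).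
(** Meaningful only off the real axis; real points are treated separately throughout. *)
Definition imunit (q : H) : H := mkH 0 (h1 q / rim q) (h2 q / rim q) (h3 q / rim q).

Lemma rim2_nonneg q : 0 <= rim2 q.
Proof. unfold rim2. generalize (pow2_ge_0 (h1 q)) (pow2_ge_0 (h2 q)) (pow2_ge_0 (h3 q)). lra. Qed.

Lemma rim_nonneg q : 0 <= rim q.
Proof. apply sqrt_pos. Qed.

Lemma rim_sqr q : rim q * rim q = rim2 q.
Proof. apply sqrt_sqrt, rim2_nonneg. Qed.

Lemma rim_zero q : rim q = 0 -> h1 q = 0 /\ h2 q = 0 /\ h3 q = 0.
Proof.
  intros E. assert (S := rim_sqr q). rewrite E in S. unfold rim2 in S.
  generalize (pow2_ge_0 (h1 q)) (pow2_ge_0 (h2 q)) (pow2_ge_0 (h3 q)). intros.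
  repeat split; nra.
Qed.

Lemma imunit_in_S q : rim q <> 0 -> in_S (imunit q).
Proof.
  intros N. split; [reflexivity|]. unfold Hnorm2. simpl.
  replace (0 * (0 * 1) + h1 q / rim q * (h1 q / rim q * 1) + h2 q / rim q * (h2 q / rim q * 1) +
   h3 q / rim q * (h3 q / rim q * 1)) with (rim2 q / (rim q * rim q)) by (unfold rim2; field; assumption).
  rewrite rim_sqr. apply Rdiv_diag. rewrite <- rim_sqr. nra.
Qed.

Lemma sl_imunit q : rim q <> 0 -> sl (h0 q) (rim q) (imunit q) = q.
Proof. intros N. unfold sl, imunit. apply H_ext; simpl; field; assumption. Qed.

Lemma sl_real q J : rim q = 0 -> sl (h0 q) 0 J = q.
Proof.
  intros E. apply rim_zero in E. destruct E as (E1 & E2 & E3). unfold sl. apply H_ext; simpl; lra.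
Qed.

Section Slice.
Variables (W : H -> Prop) (alpha beta : R -> R -> H).
Hypotheses (HWo : H_open W) (HWs : axially_symmetric W) (SC : slice_conditions W alpha beta).

Lemma sl_dom_all u v J : sl_dom W u v -> in_S J -> W (sl u v J).
Proof. intros (I & HI & HW) HJ. exact (HWs u v I J HI HJ HW). Qed.

Lemma sl_dom_opp u v : sl_dom W u v -> sl_dom W u (- v).
Proof.
  intros (I & HI & HW). exists (Hopp I). split; [now apply in_S_opp|].
  replace (sl u (- v) (Hopp I)) with (sl u v I); [assumption|]. unfold sl. apply H_ext; simpl; ring.
Qed.

Lemma sl_dom_rim q : W q -> sl_dom W (h0 q) (rim q).
Proof.
  intros Hq. destruct (Req_dec (rim q) 0) as [E|N].
  - exists (He 1). split; [apply in_S_He; lia|]. rewrite E, sl_real; assumption.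
  - exists (imunit q). split; [now apply imunit_in_S|]. now rewrite sl_imunit.
Qed.

Lemma W_near q : W q -> Hnear q W.
Proof. intros Hq. apply Hnear_dist. exact (HWo q Hq). Qed.

Definition Om (z : C) : Prop := sl_dom W (fst z) (snd z).

Lemma copen_Om : copen Om.
Proof.
  intros z Hz. destruct z as [u v]. unfold Om in Hz. simpl in Hz.
  assert (H1 : in_S (He 1)) by (apply in_S_He; lia).
  destruct (W_near _ (sl_dom_all u v _ Hz H1)) as (eps & Heps & HP).
  apply locally_Cmod. exists eps. split; [assumption|]. intros [x y] Hw.
  exists (He 1). split; [assumption|]. simpl.
  assert (B1 := Cmod_fst ((x, y) - (u, v))). assert (B2 := Cmod_snd ((x, y) - (u, v))).
  simpl in B1, B2. change (x + - u) with (x - u) in B1. change (y + - v) with (y - v) in B2.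
  apply HP; simpl.
  - replace (x + y * 0 - (u + v * 0)) with (x - u) by ring. lra.
  - replace (0 + y * 1 - (0 + v * 1)) with (y - v) by ring. lra.
  - replace (0 + y * 0 - (0 + v * 0)) with 0 by ring. rewrite Rabs_R0. assumption.
  - replace (0 + y * 0 - (0 + v * 0)) with 0 by ring. rewrite Rabs_R0. assumption.
Qed.

Definition Fc (c : nat) (z : C) : C := (Hc (alpha (fst z) (snd z)) c, Hc (beta (fst z) (snd z)) c).

(* [du h u v] is the derivative in [u]; by the Cauchy-Riemann system those in [v] are
   [- du beta] for [alpha] and [du alpha] for [beta]. *)
Definition du (h : R -> R -> H) (u v : R) : H :=
  mkH (Derive (fun x => h0 (h x v)) u) (Derive (fun x => h1 (h x v)) u)
      (Derive (fun x => h2 (h x v)) u) (Derive (fun x => h3 (h x v)) u).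

Lemma slice_differentiable u v c : sl_dom W u v -> (c <= 3)%nat ->
  differentiable_pt_lim (fun x y => Hc (alpha x y) c) u v (Hc (du alpha u v) c) (- Hc (du beta u v) c) /\
  differentiable_pt_lim (fun x y => Hc (beta x y) c) u v (Hc (du beta u v) c) (Hc (du alpha u v) c).
Proof.
  intros Hd Hc. destruct SC as (_ & SC2 & SC3).
  destruct (SC2 u v Hd c Hc) as [(a1 & a2 & Ha) (b1 & b2 & Hb)].
  destruct (SC3 u v Hd c Hc) as [E1 E2].
  destruct (differentiable_pt_lim_unique _ _ _ _ _ Ha) as [A1 A2].
  destruct (differentiable_pt_lim_unique _ _ _ _ _ Hb) as [B1 B2].
  rewrite A1, B2 in *. rewrite A2, B1 in *.
  assert (Ea : Defs.Hc (du alpha u v) c = a1).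
  { rewrite <- A1. destruct c as [|[|[|[|c]]]]; try reflexivity; lia. }
  assert (Eb : Defs.Hc (du beta u v) c = b1).
  { rewrite <- B1. destruct c as [|[|[|[|c]]]]; try reflexivity; lia. }
  rewrite Ea, Eb. replace (- b1) with a2 by lra. replace a1 with b2 at 2 by lra.
  split; assumption.
Qed.

Lemma Fc_holo c : (c <= 3)%nat -> holo Om (Fc c).
Proof.
  intros Hc. apply holo_of_ex. intros [u v] Hz.
  destruct (slice_differentiable u v c Hz Hc) as [D1 D2].
  exists (Defs.Hc (du alpha u v) c, Defs.Hc (du beta u v) c). apply Cdiff_differentiable. split; assumption.
Qed.

Lemma Fc_conj c u v : sl_dom W u v -> Fc c (u, - v) = Cconj (Fc c (u, v)).
Proof.
  intros Hd. destruct SC as (SC1 & _ & _). destruct (SC1 u v Hd) as [E1 E2].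
  unfold Fc, Cconj. simpl. rewrite E1, E2. f_equal. destruct c as [|[|[|c]]]; reflexivity.
Qed.

Lemma beta_real u c : sl_dom W u 0 -> Hc (beta u 0) c = 0.
Proof.
  intros Hd. destruct SC as (SC1 & _ & _). destruct (SC1 u 0 Hd) as [_ E]. rewrite Ropp_0 in E.
  apply (f_equal (fun h => Hc h c)) in E.
  destruct c as [|[|[|c]]]; simpl in *; lra.
Qed.

(** [beta] is odd in [v], so it vanishes along the real axis, and with it its derivative in that
    direction. Hence the derivative of [Fc] is real there. *)
Lemma du_beta_real u c : sl_dom W u 0 -> Hc (du beta u 0) c = 0.
Proof.
  intros Hd.
  assert (L : locally u (fun x => sl_dom W x 0)).
  { destruct (proj2 (locally_Cmod _ _) (copen_Om (u, 0) Hd)) as (d & Hdp & H).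
    exists (mkposreal _ Hdp). intros x Hx. apply (H (x, 0)).
    replace ((x, 0) - (u, 0))%C with (RtoC (x - u)) by (unfold RtoC, Cminus, Cplus, Copp; simpl; f_equal; ring).
    rewrite Cmod_R. exact Hx. }
  assert (D : forall c, Derive (fun x => Hc (beta x 0) c) u = 0).
  { intros c'. rewrite (Derive_ext_loc _ (fun _ => 0)).
    - apply Derive_const.
    - revert L. apply filter_imp. intros x Hx. now apply beta_real. }
  destruct c as [|[|[|c]]]; [exact (D 0%nat)|exact (D 1%nat)|exact (D 2%nat)|exact (D 3%nat)].
Qed.

(** [phi] is real at a conjugate pair, so the real part loses nothing ([phi_Gr]): it is [beta / v]
    off the real axis and the [u]-derivative of [alpha] on it. *)
Definition Gr (c : nat) (u v : R) : R := fst (phi (Fc c) (u, - v) (u, v)).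

Lemma phi_nonreal c u v : sl_dom W u v -> v <> 0 ->
  phi (Fc c) (u, - v) (u, v) = RtoC (Hc (beta u v) c / v).
Proof.
  intros Hd N. rewrite phi_neq.
  - rewrite Fc_conj by assumption. unfold Fc, Cconj, Cdiv, Cminus, Cplus, Copp, Cinv, Cmult, RtoC. simpl.
    f_equal; field; nra.
  - intros E. apply (f_equal snd) in E. simpl in E. lra.
Qed.

Lemma phi_real c u : sl_dom W u 0 -> (c <= 3)%nat -> phi (Fc c) (u, - 0) (u, 0) = RtoC (Hc (du alpha u 0) c).
Proof.
  intros Hd Hc. rewrite Ropp_0, phi_diag.
  destruct (slice_differentiable u 0 c Hd Hc) as [D1 D2].
  rewrite (Cder_unique (Fc c) (u, 0) (Defs.Hc (du alpha u 0) c, Defs.Hc (du beta u 0) c)).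
  - rewrite du_beta_real by assumption. reflexivity.
  - apply Cdiff_differentiable. split; assumption.
Qed.

Lemma phi_Gr c u v : sl_dom W u v -> (c <= 3)%nat -> phi (Fc c) (u, - v) (u, v) = RtoC (Gr c u v).
Proof.
  intros Hd Hc. unfold Gr. destruct (Req_dec v 0) as [->|N].
  - rewrite phi_real by assumption. reflexivity.
  - rewrite phi_nonreal by assumption. reflexivity.
Qed.

(** The common value to which the Fueter derivative and the boundary integral are both reduced. It
    refers neither to [J] nor to the side of multiplication. *)
Definition GH (u v : R) : H := mkH (-2 * Gr 0 u v) (-2 * Gr 1 u v) (-2 * Gr 2 u v) (-2 * Gr 3 u v).

Lemma GH_nonreal u v : sl_dom W u v -> v <> 0 -> GH u v = Hscal (-2 * / v) (beta u v).
Proof.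
  intros Hd N. unfold GH, Gr. rewrite !phi_nonreal by assumption. unfold Hscal. simpl. f_equal; field; assumption.
Qed.

Lemma GH_real u : sl_dom W u 0 -> GH u 0 = Hscal (-2) (du alpha u 0).
Proof. intros Hd. unfold GH, Gr. rewrite !phi_real by (assumption || lia). reflexivity. Qed.

Lemma slice_path (x y : R -> R) t x' y' : sl_dom W (x t) (y t) -> is_derive x t x' -> is_derive y t y' ->
  is_Hderive (fun s => alpha (x s) (y s)) t
    (Hadd (Hscal x' (du alpha (x t) (y t))) (Hscal (- y') (du beta (x t) (y t)))) /\
  is_Hderive (fun s => beta (x s) (y s)) t
    (Hadd (Hscal x' (du beta (x t) (y t))) (Hscal y' (du alpha (x t) (y t)))).
Proof.
  intros Hd Dx Dy. apply is_derive_Reals in Dx. apply is_derive_Reals in Dy.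
  assert (A : forall c, (c <= 3)%nat ->
    is_derive (fun s => Hc (alpha (x s) (y s)) c) t
      (x' * Hc (du alpha (x t) (y t)) c + - y' * Hc (du beta (x t) (y t)) c) /\
    is_derive (fun s => Hc (beta (x s) (y s)) c) t
      (x' * Hc (du beta (x t) (y t)) c + y' * Hc (du alpha (x t) (y t)) c)).
  { intros c Hc. destruct (slice_differentiable _ _ c Hd Hc) as [D1 D2].
    split; apply is_derive_Reals.
    - replace (x' * Defs.Hc (du alpha (x t) (y t)) c + - y' * Defs.Hc (du beta (x t) (y t)) c) with
        (Defs.Hc (du alpha (x t) (y t)) c * x' + - Defs.Hc (du beta (x t) (y t)) c * y') by ring.
      exact (derivable_pt_lim_comp_2d (fun x y => Defs.Hc (alpha x y) c) _ _ _ _ _ _ _ D1 Dx Dy).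
    - replace (x' * Defs.Hc (du beta (x t) (y t)) c + y' * Defs.Hc (du alpha (x t) (y t)) c) with
        (Defs.Hc (du beta (x t) (y t)) c * x' + Defs.Hc (du alpha (x t) (y t)) c * y') by ring.
      exact (derivable_pt_lim_comp_2d (fun x y => Defs.Hc (beta x y) c) _ _ _ _ _ _ _ D2 Dx Dy). }
  destruct (A 0%nat ltac:(lia)) as [A0 B0]. destruct (A 1%nat ltac:(lia)) as [A1 B1].
  destruct (A 2%nat ltac:(lia)) as [A2 B2]. destruct (A 3%nat ltac:(lia)) as [A3 B3].
  split; (split; [|split; [|split]]); assumption.
Qed.

(** Half of the [i]-th partial derivative of [rim2]. *)
Definition imc (q : H) (i : nat) : R := match i with O => 0 | _ => Hc q i end.

Lemma is_derive_rim q i : rim q <> 0 ->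
  is_derive (fun t => rim (Hadd q (Hscal t (He i)))) 0 (imc q i / rim q).
Proof.
  intros N. unfold rim, rim2. unfold rim, rim2 in N.
  assert (P : 0 < h1 q ^ 2 + h2 q ^ 2 + h3 q ^ 2).
  { destruct (rim2_nonneg q) as [P|E]; [exact P|]. exfalso. apply N. unfold rim2 in E. rewrite <- E. apply sqrt_0. }
  destruct i as [|[|[|i]]]; simpl; auto_derive.
  all: try (simpl in P; nra).
  all: rewrite ?Rmult_0_l, ?Rplus_0_r; simpl in N, P; simpl; try (field; lra).
Qed.

Lemma is_Hderive_imunit q i : rim q <> 0 ->
  is_Hderive (fun t => imunit (Hadd q (Hscal t (He i)))) 0
    (Hadd (Hscal (/ rim q) (mkH 0 (del i 1) (del i 2) (del i 3)))
          (Hscal (- (imc q i / rim q) / rim q) (imunit q))).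
Proof.
  intros N. assert (D := is_derive_rim q i N).
  assert (E : rim (Hadd q (Hscal 0 (He i))) = rim q) by now rewrite Hadd_scal_0.
  assert (J : forall c, is_derive (fun t => Hc (Hadd q (Hscal t (He i))) c / rim (Hadd q (Hscal t (He i)))) 0
    (/ rim q * del i c + - (imc q i / rim q) / rim q * (Hc q c / rim q))).
  { intros c. assert (Dc := is_derive_coord q i c).
    assert (N' : rim (Hadd q (Hscal 0 (He i))) <> 0) by (rewrite E; assumption).
    refine (is_derive_eq _ _ _ _ (is_derive_div _ _ _ _ _ Dc D N') _).
    rewrite Hadd_scal_0. Req_type; field. assumption. }
  split; [|split; [|split]]; simpl.
  - replace (/ rim q * 0 + - (imc q i / rim q) / rim q * 0) with 0 by ring. apply (is_derive_const (V := R_NormedModule)).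
  - exact (J 1%nat).
  - exact (J 2%nat).
  - exact (J 3%nat).
Qed.

Lemma rim_near q : rim q <> 0 -> Hnear q (fun p => rim p <> 0).
Proof.
  intros N.
  assert (C : hcont rim2 q).
  { assert (S : forall i, hcont (fun p => Hc p i ^ 2) q).
    { intros i. simpl. apply hcont_mult; [apply hcont_coord|]. apply hcont_mult; [apply hcont_coord|apply hcont_const]. }
    exact (hcont_plus _ _ q (hcont_plus _ _ q (S 1%nat) (S 2%nat)) (S 3%nat)). }
  assert (P : 0 < rim2 q) by (rewrite <- rim_sqr; generalize (rim_nonneg q); nra).
  generalize (proj1 (filterlim_locally _ _) C (mkposreal _ P)). apply filter_imp. intros p Hp.
  change (Rabs (rim2 p - rim2 q) < rim2 q) in Hp. apply Rabs_def2 in Hp.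
  intros E. assert (S := rim_sqr p). rewrite E in S. lra.
Qed.

Lemma line_nonreal q i : W q -> rim q <> 0 ->
  locally 0 (fun t => W (Hadd q (Hscal t (He i))) /\ rim (Hadd q (Hscal t (He i))) <> 0).
Proof.
  intros Hq N. exact (Hnear_line q i _ (filter_and _ _ (W_near q Hq) (rim_near q N))).
Qed.

Lemma path_nonreal q i : W q -> rim q <> 0 ->
  is_Hderive (fun t => alpha (h0 (Hadd q (Hscal t (He i)))) (rim (Hadd q (Hscal t (He i))))) 0
    (Hadd (Hscal (del i 0) (du alpha (h0 q) (rim q))) (Hscal (- (imc q i / rim q)) (du beta (h0 q) (rim q)))) /\
  is_Hderive (fun t => beta (h0 (Hadd q (Hscal t (He i)))) (rim (Hadd q (Hscal t (He i))))) 0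
    (Hadd (Hscal (del i 0) (du beta (h0 q) (rim q))) (Hscal (imc q i / rim q) (du alpha (h0 q) (rim q)))).
Proof.
  intros Hq N.
  assert (S := slice_path (fun t => h0 (Hadd q (Hscal t (He i)))) (fun t => rim (Hadd q (Hscal t (He i)))) 0
    (del i 0) (imc q i / rim q)).
  cbv beta in S. rewrite Hadd_scal_0 in S.
  apply S; [now apply sl_dom_rim|exact (is_derive_coord q i 0)|now apply is_derive_rim].
Qed.

Lemma line_sl q i t : rim q = 0 -> (1 <= i)%nat -> Hadd q (Hscal t (He i)) = sl (h0 q) t (He i).
Proof.
  intros E Hi. apply rim_zero in E. destruct E as (E1 & E2 & E3).
  unfold sl. destruct i as [|[|[|i]]]; [lia| | |]; apply H_ext; simpl; rewrite ?E1, ?E2, ?E3; ring.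
Qed.

Lemma line_sl_0 q t J : rim q = 0 -> Hadd q (Hscal t (He 0)) = sl (h0 q + t) 0 J.
Proof.
  intros E. apply rim_zero in E. destruct E as (E1 & E2 & E3).
  unfold sl. apply H_ext; simpl; rewrite ?E1, ?E2, ?E3; ring.
Qed.

Lemma is_derive_shift (x : R) : is_derive (fun t => x + t) 0 1.
Proof. auto_derive; trivial; ring. Qed.

(** * Partial derivatives of slice functions, for both sides at once *)

Section LeftRight.
Variables (mul : H -> H -> H) (f : H -> H).
Hypothesis Hmul_derive : forall g k t l m, is_Hderive g t l -> is_Hderive k t m ->
  is_Hderive (fun s => mul (g s) (k s)) t (Hadd (mul l (k t)) (mul (g t) m)).
Hypothesis Hf : forall u v J, in_S J -> W (sl u v J) -> f (sl u v J) = Hadd (alpha u v) (mul J (beta u v)).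

(** The product is abstract so that [Hmul] gives left functions and the opposite product right ones.
    The three contributions come from [alpha], from the turning of the imaginary unit, and from
    [beta]. *)
Lemma Hpartial_nonreal q i : W q -> rim q <> 0 ->
  Hpartial i f q = Hadd
    (Hadd (Hscal (del i 0) (du alpha (h0 q) (rim q))) (Hscal (- (imc q i / rim q)) (du beta (h0 q) (rim q))))
    (Hadd (mul (Hadd (Hscal (/ rim q) (mkH 0 (del i 1) (del i 2) (del i 3)))
          (Hscal (- (imc q i / rim q) / rim q) (imunit q))) (beta (h0 q) (rim q)))
      (mul (imunit q)
        (Hadd (Hscal (del i 0) (du beta (h0 q) (rim q))) (Hscal (imc q i / rim q) (du alpha (h0 q) (rim q)))))).
Proof.
  intros Hq N. apply Hpartial_unique.
  destruct (path_nonreal q i Hq N) as [Da Db]. assert (Dj := is_Hderive_imunit q i N).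
  assert (D := is_Hderive_add _ _ _ _ _ Da (Hmul_derive _ _ _ _ _ Dj Db)).
  cbv beta in D. rewrite Hadd_scal_0 in D.
  refine (is_Hderive_ext_loc _ _ _ _ _ D).
  generalize (line_nonreal q i Hq N). apply filter_imp. intros t [Ht Nt].
  rewrite <- Hf.
  - now rewrite sl_imunit.
  - now apply imunit_in_S.
  - now rewrite sl_imunit.
Qed.

Hypothesis mul_0_l : forall x k, mul (mkH 0 0 0 0) x = mkH 0 0 0 0 /\ mul k (mkH 0 0 0 0) = mkH 0 0 0 0.

Lemma is_Hderive_const c t : is_Hderive (fun _ => c) t (mkH 0 0 0 0).
Proof. split; [|split; [|split]]; apply (is_derive_const (V := R_NormedModule)). Qed.

(** [rim] is not differentiable at a real point, so polar coordinates fail. The line in the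
    direction of an imaginary unit [He i] instead stays in the slice of that unit, where [v = t] is
    a signed smooth coordinate. *)
Lemma Hpartial_real q i : W q -> rim q = 0 ->
  Hpartial i f q = match i with O => du alpha (h0 q) 0 | _ => mul (He i) (du alpha (h0 q) 0) end.
Proof.
  intros Hq E.
  assert (Hd : sl_dom W (h0 q) 0) by (rewrite <- E; now apply sl_dom_rim).
  assert (B0 : du beta (h0 q) 0 = mkH 0 0 0 0).
  { assert (B := fun c => du_beta_real (h0 q) c Hd).
    apply H_ext; [exact (B 0%nat)|exact (B 1%nat)|exact (B 2%nat)|exact (B 3%nat)]. }
  apply Hpartial_unique. destruct i as [|i].
  - assert (SP := slice_path (fun t => h0 q + t) (fun _ => 0) 0 1 0).
    cbv beta in SP. rewrite Rplus_0_r in SP.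
    destruct (SP Hd (is_derive_shift _) (is_derive_const (V := R_NormedModule) 0 0)) as [Da Db].
    rewrite B0 in Da, Db.
    assert (D := is_Hderive_add _ _ _ _ _ Da (Hmul_derive _ _ _ _ _ (is_Hderive_const (He 1) 0) Db)).
    refine (is_Hderive_ext_loc _ _ _ _ _ (is_Hderive_eq _ _ _ (du alpha (h0 q) 0) _ D)).
    2: { rewrite (proj1 (mul_0_l _ (He 1))).
         replace (Hadd (Hscal 1 (mkH 0 0 0 0)) (Hscal 0 (du alpha (h0 q) 0))) with (mkH 0 0 0 0)
           by (apply H_ext; simpl; ring).
         rewrite (proj2 (mul_0_l (He 1) (He 1))). apply H_ext; simpl; ring. }
    generalize (Hnear_line q 0 _ (W_near q Hq)). apply filter_imp. intros t Ht.
    rewrite (line_sl_0 q t (He 1) E) in Ht |- *. symmetry. apply Hf; [apply in_S_He; lia|assumption].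
  - assert (SP := slice_path (fun _ => h0 q) (fun t => t) 0 0 1).
    cbv beta in SP.
    destruct (SP Hd (is_derive_const (V := R_NormedModule) _ 0) (is_derive_id 0)) as [Da Db].
    rewrite B0 in Da, Db.
    assert (D := is_Hderive_add _ _ _ _ _ Da (Hmul_derive _ _ _ _ _ (is_Hderive_const (He (S i)) 0) Db)).
    refine (is_Hderive_ext_loc _ _ _ _ _ (is_Hderive_eq _ _ _ (mul (He (S i)) (du alpha (h0 q) 0)) _ D)).
    2: { rewrite (proj1 (mul_0_l _ (He 1))).
         replace (Hadd (Hscal 0 (mkH 0 0 0 0)) (Hscal 1 (du alpha (h0 q) 0))) with (du alpha (h0 q) 0)
           by (apply H_ext; simpl; ring).
         apply H_ext; simpl; ring. }
    generalize (Hnear_line q (S i) _ (W_near q Hq)). apply filter_imp. intros t Ht.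
    rewrite line_sl in Ht |- * by (assumption || lia). symmetry. apply Hf; [apply in_S_He; lia|assumption].
Qed.
End LeftRight.

(** The equation of the unit sphere, solved for one square so that [ring] can use it as a rewriting
    rule. *)
Lemma imunit_norm q : rim q <> 0 ->
  h1 (imunit q) * h1 (imunit q) = 1 - h2 (imunit q) * h2 (imunit q) - h3 (imunit q) * h3 (imunit q).
Proof.
  intros N. destruct (imunit_in_S q N) as [E1 E2]. unfold Hnorm2 in E2. rewrite E1 in E2. lra.
Qed.

Lemma imc_imunit q i : imc q i / rim q = Hc (imunit q) i.
Proof. destruct i as [|[|[|i]]]; simpl; try reflexivity. unfold Rdiv; ring. Qed.

(** Off the real axis the derivatives of [alpha] and [beta] cancel by the Cauchy-Riemann system. The
    imaginary unit contributes [(- 3 + 1) / v] times [beta]: [- 3] from the squares of the units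
    [e_i], [1] from removing the radial part. On the axis the sum is [(1 - 3)] times the derivative
    of [alpha]. *)
Theorem FueterL_slice f : (forall u v J, in_S J -> W (sl u v J) ->
    f (sl u v J) = Hadd (alpha u v) (Hmul J (beta u v))) ->
  forall q, W q -> FueterL f q = GH (h0 q) (rim q).
Proof.
  intros Hf q Hq. destruct (Req_dec (rim q) 0) as [E|N].
  - rewrite E, GH_real by (rewrite <- E; now apply sl_dom_rim).
    unfold FueterL. rewrite !(Hpartial_real Hmul f is_Hderive_mul Hf) by
      (assumption || (intros; split; apply H_ext; simpl; ring)).
    apply H_ext; simpl; ring.
  - rewrite GH_nonreal by (assumption || now apply sl_dom_rim).
    unfold FueterL. rewrite !(Hpartial_nonreal Hmul f is_Hderive_mul Hf) by assumption.
    rewrite !imc_imunit. assert (HJ := imunit_norm q N).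
    assert (J0 : h0 (imunit q) = 0) by reflexivity.
    destruct (imunit q) as [j0 j1 j2 j3]. destruct (du alpha _ _) as [a0 a1 a2 a3].
    destruct (du beta _ _) as [b0 b1 b2 b3]. destruct (beta _ _) as [c0 c1 c2 c3].
    unfold del. simpl in *. subst j0. unfold Rdiv. apply H_ext; simpl; ring [HJ].
Qed.

(** The computation is that of the left case for the opposite product, whose product rule differs
    only in the order of the summands. *)
Theorem FueterR_slice f : (forall u v J, in_S J -> W (sl u v J) ->
    f (sl u v J) = Hadd (alpha u v) (Hmul (beta u v) J)) ->
  forall q, W q -> FueterR f q = GH (h0 q) (rim q).
Proof.
  intros Hf q Hq.
  assert (Hd : forall g k t l m, is_Hderive g t l -> is_Hderive k t m ->
    is_Hderive (fun s => (fun x y => Hmul y x) (g s) (k s)) t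
      (Hadd ((fun x y => Hmul y x) l (k t)) ((fun x y => Hmul y x) (g t) m))).
  { intros g k t l m Dg Dk. assert (D := is_Hderive_mul _ _ _ _ _ Dk Dg).
    match goal with |- is_Hderive _ _ ?l => match type of D with is_Hderive _ _ ?l' =>
      replace l with l' by (apply H_ext; simpl; ring) end end. exact D. }
  destruct (Req_dec (rim q) 0) as [E|N].
  - rewrite E, GH_real by (rewrite <- E; now apply sl_dom_rim).
    unfold FueterR. rewrite !(Hpartial_real (fun x y => Hmul y x) f Hd Hf) by
      (assumption || (intros; split; apply H_ext; simpl; ring)).
    apply H_ext; simpl; ring.
  - rewrite GH_nonreal by (assumption || now apply sl_dom_rim).
    unfold FueterR. rewrite !(Hpartial_nonreal (fun x y => Hmul y x) f Hd Hf) by assumption.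
    rewrite !imc_imunit. assert (HJ := imunit_norm q N).
    assert (J0 : h0 (imunit q) = 0) by reflexivity.
    destruct (imunit q) as [j0 j1 j2 j3]. destruct (du alpha _ _) as [a0 a1 a2 a3].
    destruct (du beta _ _) as [b0 b1 b2 b3]. destruct (beta _ _) as [c0 c1 c2 c3].
    unfold del. simpl in *. subst j0. unfold Rdiv. apply H_ext; simpl; ring [HJ].
Qed.
End Slice.

(** * Harmonicity *)

Lemma hcont_rim q : hcont rim q.
Proof.
  assert (S : forall i, hcont (fun p => Hc p i ^ 2) q).
  { intros i. simpl. apply hcont_mult; [apply hcont_coord|]. apply hcont_mult; [apply hcont_coord|apply hcont_const]. }
  assert (C : hcont rim2 q) by exact (hcont_plus _ _ q (hcont_plus _ _ q (S 1%nat) (S 2%nat)) (S 3%nat)).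
  refine (filterlim_comp _ _ _ rim2 sqrt _ _ _ C _).
  apply continuity_pt_filterlim, continuity_pt_sqrt, rim2_nonneg.
Qed.

Definition zp (q : H) : C := (h0 q, rim q).
Definition zm (q : H) : C := (h0 q, - rim q).

Lemma zp_near q r : 0 < r -> Hnear q (fun p => Cmod (zp p - zp q) < r /\ Cmod (zm p - zm q) < r).
Proof.
  intros Hr. assert (Hr2 : 0 < r / 2) by lra.
  generalize (filter_and _ _ (proj1 (filterlim_locally _ _) (hcont_coord 0 q) (mkposreal _ Hr2))
    (proj1 (filterlim_locally _ _) (hcont_rim q) (mkposreal _ Hr2))).
  apply filter_imp. intros p [B1 B2].
  change (Rabs (h0 p - h0 q) < r / 2) in B1. change (Rabs (rim p - rim q) < r / 2) in B2.
  split; (eapply Rle_lt_trans; [apply Cmod_le_abs|]).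
  - change (Rabs (h0 p - h0 q) + Rabs (rim p - rim q) < r). lra.
  - change (Rabs (h0 p - h0 q) + Rabs (- rim p - - rim q) < r).
    replace (- rim p - - rim q) with (- (rim p - rim q)) by ring. rewrite Rabs_Ropp. lra.
Qed.

Lemma Hnorm2_rim q : Hnorm2 q = h0 q * h0 q + rim q * rim q.
Proof. rewrite rim_sqr. unfold Hnorm2, rim2. ring. Qed.

Lemma Q_factor (w : C) q :
  (w * w - RtoC (2 * h0 q) * w + RtoC (Hnorm2 q))%C = ((w - zp q) * (w - zm q))%C.
Proof.
  rewrite Hnorm2_rim. destruct w as [x y]. unfold zp, zm, RtoC, Cmult, Cminus, Cplus, Copp. simpl. f_equal; ring.
Qed.

Lemma CInt_scal (f : R -> C) a b c : a <= b -> (forall t, a <= t <= b -> ccont f t) ->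
  CInt (fun t => c * f t)%C a b = (c * CInt f a b)%C.
Proof. intros Hab Hf. apply is_CInt_unique, is_CInt_scal, is_CInt_ccont; assumption. Qed.

Section Harmonic.
Variables (W : H -> Prop) (alpha beta : R -> R -> H).
Hypotheses (HWo : H_open W) (HWs : axially_symmetric W) (SC : slice_conditions W alpha beta).

(** At a real [q] a small circle encloses both [z] and [conj z], and [phi_Cauchy] is already of the
    required form. At other points the domain need not contain a disc around both, so the circle
    encloses [z] alone and Cauchy's formula is applied to [F (w) / (w - conj z)]. *)
Lemma Gr_potential q c : W q -> (c <= 3)%nat -> exists zeta K,
  (forall t, ccont zeta t) /\ (forall t, ccont K t) /\ regularH zeta q /\
  Hnear q (fun p => -2 * Gr alpha beta c (h0 p) (rim p) = AH zeta 1 K p).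
Proof.
  intros Hq Hc.
  set (F := Fc alpha beta c).
  assert (HF : holo (Om W) F) by now apply Fc_holo.
  assert (Ha : Om W (zp q)) by now apply sl_dom_rim.
  destruct (copen_box (Om W) (zp q) (copen_Om W HWo HWs) Ha) as (rho & Hrho & Hbox).
  destruct (Req_dec (rim q) 0) as [E|N].
  - set (r := rho / 2). assert (Hr : 0 < r < rho) by (unfold r; lra).
    assert (Hd : forall w, box (zp q) rho w -> exists l, Cdiff F w l) by (intros w Hw; eexists; apply HF, Hbox, Hw).
    assert (HFc : forall t, ccont (T := CT) F (circ (zp q) r t)).
    { intros t. eapply Cdiff_ccont, HF, Hbox, box_of_Cmod. rewrite circ_dist; lra. }
    assert (Em : zm q = zp q) by (unfold zm, zp; now rewrite E, Ropp_0).
    assert (Z0 : Cmod (zp q - zp q) < r) by (replace (zp q - zp q)%C with (RtoC 0) by ring; rewrite Cmod_0; lra).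
    exists (circ (zp q) r), (fun t => RtoC (-2) * / tpi * (F (circ (zp q) r t) * circ' r t))%C.
    split; [intros; apply ccont_circ|]. split.
    { intros t. apply ccont_mult; [apply ccont_const|]. now apply ccont_g_circ. }
    split.
    { intros t _. unfold Qz. rewrite Q_factor, Em. apply Cmult_neq_0; now apply Cminus_neq_0, circ_neq. }
    generalize (zp_near q r ltac:(lra)). apply filter_imp. intros p [P1 P2]. rewrite Em in P2.
    unfold AH, ak, EK, Gr. fold F.
    rewrite (phi_Cauchy F (zp q) rho r (h0 p, - rim p) (h0 p, rim p) Hd ltac:(lra) P2 P1).
    set (k := fun t => (F (circ (zp q) r t) * circ' r t * / (circ (zp q) r t - zm p) * / (circ (zp q) r t - zp p))%C).
    assert (Hk : forall t, ccont k t).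
    { intros t. apply ccont_mult; [apply ccont_mult; [now apply ccont_g_circ|]|];
      (apply ccont_inv; [apply ccont_minus; [apply ccont_circ|apply ccont_const]|now apply Cminus_neq_0, circ_neq]). }
    transitivity (fst (RtoC (-2) * / tpi * CInt k 0 (2 * PI))%C).
    + rewrite <- Cmult_assoc. set (v := (/ tpi * CInt k 0 (2 * PI))%C). simpl.
      change (/ tpi * CInt _ 0 (2 * PI))%C with v. ring.
    + f_equal. rewrite <- CInt_scal by (apply two_PI_pos || (intros; apply Hk)).
      unfold CInt. f_equal; apply RInt_ext; intros t _; f_equal; unfold k, Qz; rewrite Q_factor, Cpow_1_r; field;
      (repeat split; [now apply Cminus_neq_0, circ_neq|now apply Cminus_neq_0, circ_neq|apply tpi_neq_0]).
  - assert (Pq : 0 < rim q) by (generalize (rim_nonneg q); lra).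
    (* Half the height of [z] keeps the square in the open upper half plane, away from every
       [zm p]. *)
    set (rho' := Rmin rho (rim q / 2)).
    assert (Hrho' : 0 < rho') by (apply Rmin_pos; lra).
    assert (L1 : rho' <= rho) by apply Rmin_l. assert (L2 : rho' <= rim q / 2) by apply Rmin_r.
    set (r := rho' / 2). assert (Hr : 0 < r < rho') by (unfold r; lra).
    assert (HboxF : forall w, box (zp q) rho' w -> Om W w).
    { intros w [B1 B2]. apply Hbox. split; lra. }
    assert (Hpos : forall w, box (zp q) rho' w -> 0 < snd w).
    { intros w [_ B2]. simpl in B2. apply Rabs_le_between in B2. lra. }
    assert (Hneg : forall w p, box (zp q) rho' w -> w <> zm p).
    { intros w p Hw Ew. apply Hpos in Hw. rewrite Ew in Hw. simpl in Hw. generalize (rim_nonneg p). lra. }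
    assert (Hcb : forall t, box (zp q) rho' (circ (zp q) r t)) by (intros; apply box_of_Cmod; rewrite circ_dist; lra).
    assert (HFc : forall t, ccont (T := CT) F (circ (zp q) r t)) by (intros t; eapply Cdiff_ccont, HF, HboxF, Hcb).
    assert (Z0 : Cmod (zp q - zp q) < r) by (replace (zp q - zp q)%C with (RtoC 0) by ring; rewrite Cmod_0; lra).
    (* The real part of [F (z) / (z - conj z)] is [beta / (2 v)], half of [Gr]; hence -4 in place of
       -2. *)
    exists (circ (zp q) r), (fun t => RtoC (-4) * / tpi * (F (circ (zp q) r t) * circ' r t))%C.
    split; [intros; apply ccont_circ|]. split.
    { intros t. apply ccont_mult; [apply ccont_const|]. now apply ccont_g_circ. }
    split.
    { intros t _. unfold Qz. rewrite Q_factor. apply Cmult_neq_0; apply Cminus_neq_0; [now apply circ_neq|now apply Hneg]. }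
    assert (Z1 := zp_near q r ltac:(lra)). assert (Z2 := W_near W HWo q Hq). assert (Z3 := rim_near q N).
    generalize (filter_and _ _ Z1 (filter_and _ _ Z2 Z3)).
    apply filter_imp. intros p [[P1 _] [Wp Np]].
    set (gp := fun w : C => (F w * / (w - zm p))%C).
    assert (CF := Cauchy_formula gp (zp q) rho' r (zp p)).
    assert (I := is_CInt_Cauchy_int gp (zp q) r 1 (zp p)).
    rewrite CF in I; [| |lra|assumption].
    2: { intros w Hw. eexists. apply Cdiff_mult; [apply (HF w), HboxF, Hw|]. apply Cdiff_inv. now apply Hneg. }
    assert (Hdom := sl_dom_rim W p Wp).
    unfold Gr. rewrite (phi_nonreal W alpha beta SC) by assumption.
    unfold AH, ak, EK.
    replace (CInt _ 0 (2 * PI)) with (RtoC (-4) * / tpi * (tpi * gp (zp p)))%C.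
    + rewrite <- Cmult_assoc, (Cmult_assoc (/ tpi)), Cinv_l, Cmult_1_l by apply tpi_neq_0.
      unfold gp, F, Fc, zp, zm, Cmult, Cminus, Cplus, Copp, Cinv, RtoC. simpl. field. nra.
    + symmetry. apply is_CInt_unique.
      eapply is_CInt_ext; [apply two_PI_pos| |apply is_CInt_scal, I].
      * intros t _. unfold Qz, gp. rewrite Q_factor. rewrite !Cpow_1_r. field.
        repeat split; first [apply tpi_neq_0 | now apply Cminus_neq_0, Hneg | now apply Cminus_neq_0, circ_neq].
      * intros t. apply ccont_mult; [apply HFc|]. apply ccont_inv_sub. now apply Hneg.
      * assumption.
Qed.

Lemma slice_harmonic (g : H -> H) : (forall q, W q -> g q = GH alpha beta (h0 q) (rim q)) -> H_harmonic W g.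
Proof.
  intros Hg c Hc q Hq.
  destruct (Gr_potential q c Hq Hc) as (zeta & K & Hz & HK & Hr & Hn).
  apply (harmonic_of_potential zeta Hz K HK); [assumption|].
  generalize (filter_and _ _ (W_near W HWo q Hq) Hn). apply filter_imp. intros p [Wp Ep].
  rewrite <- Ep, Hg by assumption. destruct c as [|[|[|c]]]; reflexivity.
Qed.
End Harmonic.

(** * The boundary integral *)

Lemma plane_dist a b x y e : 0 < e -> (a - x) ^ 2 + (b - y) ^ 2 < e ^ 2 <-> Cmod ((a, b) - (x, y)) < e.
Proof.
  intros He. unfold Cmod. simpl fst. simpl snd. change (a + - x) with (a - x). change (b + - y) with (b - y).
  assert (P1 := pow2_ge_0 (a - x)). assert (P2 := pow2_ge_0 (b - y)).
  split; intros H0.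
  - rewrite <- (sqrt_pow2 e) by lra. apply sqrt_lt_1_alt. lra.
  - apply sqrt_lt_0_alt. rewrite sqrt_pow2 by lra. exact H0.
Qed.

Lemma Hdist_sl J a b x y : in_S J -> Hdist (sl a b J) (sl x y J) = Cmod ((a, b) - (x, y)).
Proof.
  intros [J0 J1]. unfold Hdist, Hnorm, Cmod. f_equal. unfold Hnorm2 in *. simpl in *.
  rewrite J0 in *. transitivity ((a - x) ^ 2 + (b - y) ^ 2 * (0 * (0 * 1) + h1 J * (h1 J * 1) + h2 J * (h2 J * 1) + h3 J * (h3 J * 1))).
  - ring.
  - rewrite J1. ring.
Qed.

Lemma Hnorm_sl J a b : in_S J -> Hnorm (sl a b J) = Cmod (a, b).
Proof.
  intros HJ. transitivity (Hdist (sl a b J) (sl 0 0 J)).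
  - unfold Hdist. f_equal. apply H_ext; simpl; ring.
  - rewrite Hdist_sl by assumption. f_equal. unfold Cminus, Cplus, Copp. simpl. f_equal; ring.
Qed.

Lemma slice_closure_H_closure U J x y : in_S J -> slice_closure U J x y -> H_closure U (sl x y J).
Proof.
  intros HJ Hc eps He. destruct (Hc eps He) as (a & b & Hd & HU). exists (sl a b J). split; [assumption|].
  rewrite Hdist_sl by assumption. now apply plane_dist.
Qed.

Lemma slice_boundary_closure U J x y : slice_boundary U J x y -> slice_closure U J x y.
Proof. intros Hb eps He. apply (Hb eps He). Qed.

Lemma slice_boundary_open U J x y : in_S J -> H_open U -> slice_boundary U J x y -> ~ U (sl x y J).
Proof.
  intros HJ HU Hb Hin. destruct (HU _ Hin) as (eps & He & H0).
  destruct (Hb eps He) as [_ (a & b & Hd & Hn)]. apply Hn, H0.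
  rewrite Hdist_sl by assumption. now apply plane_dist.
Qed.

(** This takes the part of [V] in Dixon's argument. It is open, contains a neighbourhood of
    infinity, and covers the plane together with [Om W] because the closure of [U] lies in [W]. *)
Definition exterior (U : H -> Prop) (J : H) (z : C) : Prop := ~ slice_closure U J (fst z) (snd z).

Lemma exterior_open U J : copen (exterior U J).
Proof.
  intros [x y] Hz. unfold exterior in Hz. simpl in Hz.
  assert (E : exists eps, 0 < eps /\ forall a b, Cmod ((a, b) - (x, y)) < eps -> ~ U (sl a b J)).
  { apply NNPP. intros N. apply Hz. intros eps He. apply NNPP. intros N'. apply N.
    exists eps. split; [assumption|]. intros a b Hd HU. apply N'. exists a, b. split; [|assumption].
    now apply plane_dist. }
  destruct E as (eps & He & H0). apply locally_Cmod. exists (eps / 2). split; [lra|].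
  intros [u v] Hd Hc. destruct (Hc (eps / 2)) as (a & b & Hab & HU); [lra|].
  apply plane_dist in Hab; [|lra]. simpl in Hab. apply (H0 a b); [|assumption].
  replace ((a, b) - (x, y))%C with (((a, b) - (u, v)) + ((u, v) - (x, y)))%C by ring.
  eapply Rle_lt_trans; [apply Cmod_triangle|]. lra.
Qed.

Lemma exterior_far U J : in_S J -> H_bounded U -> exists B, forall z, B < Cmod z -> exterior U J z.
Proof.
  intros HJ [M HM]. exists (M + 1). intros [x y] Hz Hc. destruct (Hc 1 Rlt_0_1) as (a & b & Hab & HU).
  apply plane_dist in Hab; [|lra]. simpl in Hab. specialize (HM _ HU). rewrite Hnorm_sl in HM by assumption.
  assert (T := Cmod_triangle (a, b) (- ((a, b) - (x, y)))). rewrite Cmod_opp in T.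
  replace ((a, b) + - ((a, b) - (x, y)))%C with ((x, y) : C) in T
    by (unfold Cminus, Cplus, Copp; simpl; f_equal; ring). lra.
Qed.

Section Integral.
Variables (W : H -> Prop) (alpha beta : R -> R -> H).
Hypotheses (HWo : H_open W) (HWs : axially_symmetric W) (SC : slice_conditions W alpha beta).
Variables (U : H -> Prop) (J : H) (l : list curve) (q : H).
Hypotheses (HU : slice_Cauchy_domain U) (HUW : forall q, H_closure U q -> W q) (HJ : in_S J)
  (Hl : pos_oriented_boundary U J l) (Hq : U q).

Lemma subset_closure p : U p -> W p.
Proof.
  intros Hp. apply HUW. intros eps He. exists p. split; [assumption|].
  unfold Hdist, Hnorm. replace (Hnorm2 (Hadd p (Hopp p))) with 0 by (unfold Hnorm2; simpl; ring).
  now rewrite sqrt_0.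
Qed.

Lemma curve_in_W g x y : In g l -> on_curve g x y -> W (sl x y J).
Proof.
  intros Hg Hxy. destruct Hl as [(_ & _ & Hb) _].
  apply HUW, slice_closure_H_closure, slice_boundary_closure; [assumption|]. apply Hb. now exists g.
Qed.

Definition Qker (w : C) : C := (/ ((w - zp q) * (w - zm q)))%C.

(** [Cauchy_cycle_quadratic] at the two roots [zp q] and [zm q] of the denominator. Both lie in the
    slice of [U] by axial symmetry, so both have winding number 1, and they avoid the boundary
    because [U] is open. *)
Theorem slice_Cauchy c : (c <= 3)%nat ->
  (forall g, In g l -> is_cint g (fun w => Fc alpha beta c w * Qker w)%C 0 1
     (cint g (fun w => Fc alpha beta c w * Qker w)%C)) /\
  lint l (fun w => Fc alpha beta c w * Qker w)%C = (tpi * RtoC (Gr alpha beta c (h0 q) (rim q)))%C.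
Proof.
  intros Hc. destruct HU as (HUs & HUo & HUb & _).
  destruct Hl as [(Hcur & _ & Hbd) [Hw1 Hw0]].
  destruct (curves_chain l Hcur) as (ps & A1 & A2 & A3).
  assert (Hchb : forall z, on_chain ps z -> slice_boundary U J (fst z) (snd z)).
  { intros z Hz. apply Hbd. now apply A1. }
  assert (HpsO : forall z, on_chain ps z -> Om W z).
  { intros z Hz. exists J. split; [assumption|].
    apply HUW, slice_closure_H_closure; [assumption|]. now apply slice_boundary_closure, Hchb. }
  assert (HpsV : forall z, on_chain ps z -> ~ exterior U J z).
  { intros z Hz HV. apply HV. now apply slice_boundary_closure, Hchb. }
  assert (Hwind : forall z, ~ on_chain ps z -> chint ps (fun w => / (w - z))%C =
     (RtoC (sum_curves (fun g => winding g (fst z) (snd z)) l) * tpi)%C).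
  { intros z Hz. apply chain_winding; try assumption. apply A3. intros w Hw. apply ccont_inv_sub.
    intros ->. contradiction. }
  assert (Hdom := sl_dom_rim U q Hq).
  assert (Up : U (sl (h0 q) (rim q) J)) by now apply sl_dom_all.
  assert (Um : U (sl (h0 q) (- rim q) J)) by (apply sl_dom_all; try assumption; now apply sl_dom_opp).
  assert (Np : ~ on_chain ps (zp q)).
  { intros H0. apply Hchb in H0. now apply slice_boundary_open in H0. }
  assert (Nm : ~ on_chain ps (zm q)).
  { intros H0. apply Hchb in H0. now apply slice_boundary_open in H0. }
  assert (HF := Fc_holo W alpha beta SC c Hc).
  assert (HfQ : forall z, on_chain ps z -> ccont (T := CT) (fun w => Fc alpha beta c w * Qker w)%C z).
  { intros z Hz. apply ccont_mult; [eapply Cdiff_ccont, HF, HpsO, Hz|].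
    apply ccont_inv.
    - apply ccont_mult; (apply ccont_minus; [apply ccont_id|apply ccont_const]).
    - apply Cmult_neq_0; apply Cminus_neq_0; intros ->; contradiction. }
  destruct (A3 _ HfQ) as [B1 B2]. split; [exact B1|]. refine (eq_trans B2 _).
  rewrite <- (phi_Gr W alpha beta HWo HWs SC) by (assumption || apply sl_dom_rim; now apply subset_closure).
  apply (Cauchy_cycle_quadratic (Om W) (exterior U J)); try assumption.
  - now apply copen_Om.
  - apply exterior_open.
  - intros z. destruct (classic (slice_closure U J (fst z) (snd z))) as [H0|H0]; [left|now right].
    exists J. split; [assumption|]. now apply HUW, slice_closure_H_closure.
  - intros z Hz. rewrite Hwind by (intros H0; now apply (HpsV z)).
    rewrite Hw0 by exact Hz. ring.
  - now apply exterior_far.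
  - exists J. split; [assumption|]. now apply subset_closure.
  - exists J. split; [assumption|]. now apply subset_closure.
  - rewrite Hwind by assumption. rewrite Hw1 by exact Up. ring.
  - rewrite Hwind by assumption. rewrite Hw1 by exact Um. ring.
Qed.

(* The embedding of the complex plane onto [C_J]. *)
Definition iota (z : C) : H := sl (fst z) (snd z) J.

Lemma J_sqr : h1 J * h1 J = 1 - h2 J * h2 J - h3 J * h3 J.
Proof. destruct HJ as [E1 E2]. unfold Hnorm2 in E2. rewrite E1 in E2. lra. Qed.

Lemma iota_mul (z w : C) : Hmul (iota z) (iota w) = iota (z * w).
Proof.
  assert (J0 := proj1 HJ). assert (J1 := J_sqr). unfold iota, sl.
  apply H_ext; simpl; rewrite J0; ring [J1].
Qed.

Lemma iota_inv (z : C) : z <> 0 -> Hinv (iota z) = iota (/ z).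
Proof.
  intros N. apply Cnorm2_neq_0 in N. assert (J0 := proj1 HJ). assert (J1 := J_sqr).
  assert (E : Hnorm2 (iota z) = fst z ^ 2 + snd z ^ 2).
  { unfold Hnorm2, iota, sl. simpl. rewrite J0. ring [J1]. }
  unfold Hinv. rewrite E. unfold iota, sl, Hconj. apply H_ext; simpl; rewrite ?J0; field; simpl in N; nra.
Qed.

Lemma Qcs_iota w : w <> zp q -> w <> zm q -> Qcs_inv q (iota w) = iota (Qker w).
Proof.
  intros N1 N2. unfold Qcs_inv, Qker. rewrite <- iota_inv by (apply Cmult_neq_0; now apply Cminus_neq_0).
  f_equal. rewrite <- Q_factor, iota_mul. unfold iota, sl, Hre. apply H_ext; simpl; ring.
Qed.

Lemma dsJ_iota g t : dsJ J g t = iota (ccurve' g t * - Ci).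
Proof.
  unfold dsJ. rewrite <- iota_mul. f_equal.
  assert (J0 := proj1 HJ). unfold iota, sl. apply H_ext; simpl; rewrite ?J0; ring.
Qed.

Lemma Hmul_assoc a b c : Hmul (Hmul a b) c = Hmul a (Hmul b c).
Proof. apply H_ext; simpl; ring. Qed.

(** * Quaternionic integrals reassembled from complex ones *)

Definition slice_form (c : nat) (g : curve) (t : R) : C :=
  (Fc alpha beta c (ccurve g t) * Qker (ccurve g t) * ccurve' g t)%C.
Definition reX (g : curve) (t : R) : H := mkH (fst (slice_form 0 g t)) (fst (slice_form 1 g t)) (fst (slice_form 2 g t)) (fst (slice_form 3 g t)).
Definition imX (g : curve) (t : R) : H := mkH (snd (slice_form 0 g t)) (snd (slice_form 1 g t)) (snd (slice_form 2 g t)) (snd (slice_form 3 g t)).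

Lemma on_ccurve g t : 0 <= t <= 1 -> on_curve g (cu g t) (cv g t).
Proof. intros Ht. now exists t. Qed.

Lemma ccurve_neq g t : In g l -> 0 <= t <= 1 -> ccurve g t <> zp q /\ ccurve g t <> zm q.
Proof.
  intros Hg Ht. destruct Hl as [(_ & _ & Hbd) _]. destruct HU as (HUs & HUo & _).
  assert (B : slice_boundary U J (cu g t) (cv g t)).
  { apply Hbd. exists g. split; [assumption|]. now apply on_ccurve. }
  apply slice_boundary_open in B; try assumption.
  assert (Hdom := sl_dom_rim U q Hq).
  split; intros E; apply B; injection E; intros -> ->; apply sl_dom_all; try assumption. now apply sl_dom_opp.
Qed.

(** Kernel and [ds_J] lie in [C_J] and commute with [J], so they act on each pair of coordinates of
    [alpha + J beta] as on the complex number [F_c]. The factor [- J] of [ds_J] is multiplication by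
    [- i], and [- i X = Im X - i Re X]. *)
Lemma integrand_left f g t : (forall u v J, in_S J -> W (sl u v J) ->
    f (sl u v J) = Hadd (alpha u v) (Hmul J (beta u v))) -> In g l -> 0 <= t <= 1 ->
  Hmul (Hmul (Qcs_inv q (cpt J g t)) (dsJ J g t)) (f (cpt J g t)) =
  Hadd (imX g t) (Hopp (Hmul J (reX g t))).
Proof.
  intros Hf Hg Ht. destruct (ccurve_neq g t Hg Ht) as [N1 N2].
  change (cpt J g t) with (iota (ccurve g t)). rewrite Qcs_iota, dsJ_iota, iota_mul by assumption.
  unfold iota at 2. rewrite Hf by (assumption || apply (curve_in_W g); try assumption; now apply on_ccurve).
  unfold reX, imX, slice_form, Fc. set (al := alpha _ _). set (be := beta _ _).
  set (Qk := Qker (ccurve g t)). set (gp := ccurve' g t).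
  assert (J0 := proj1 HJ). assert (J1 := J_sqr).
  unfold iota, sl. apply H_ext; simpl; rewrite J0; ring [J1].
Qed.

Lemma integrand_right f g t : (forall u v J, in_S J -> W (sl u v J) ->
    f (sl u v J) = Hadd (alpha u v) (Hmul (beta u v) J)) -> In g l -> 0 <= t <= 1 ->
  Hmul (Hmul (f (cpt J g t)) (dsJ J g t)) (Qcs_inv q (cpt J g t)) =
  Hadd (imX g t) (Hopp (Hmul (reX g t) J)).
Proof.
  intros Hf Hg Ht. destruct (ccurve_neq g t Hg Ht) as [N1 N2].
  change (cpt J g t) with (iota (ccurve g t)). rewrite Hmul_assoc, Qcs_iota, dsJ_iota, iota_mul by assumption.
  unfold iota at 1. rewrite Hf by (assumption || apply (curve_in_W g); try assumption; now apply on_ccurve).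
  unfold reX, imX, slice_form, Fc. set (al := alpha _ _). set (be := beta _ _).
  set (Qk := Qker (ccurve g t)). set (gp := ccurve' g t).
  assert (J0 := proj1 HJ). assert (J1 := J_sqr).
  unfold iota, sl. apply H_ext; simpl; rewrite J0; ring [J1].
Qed.

Lemma is_RInt_lin5 (f0 f1 f2 f3 f4 : R -> R) a b i0 i1 i2 i3 i4 c1 c2 c3 c4 :
  is_RInt f0 a b i0 -> is_RInt f1 a b i1 -> is_RInt f2 a b i2 -> is_RInt f3 a b i3 -> is_RInt f4 a b i4 ->
  is_RInt (fun t => f0 t + c1 * f1 t + c2 * f2 t + c3 * f3 t + c4 * f4 t) a b
    (i0 + c1 * i1 + c2 * i2 + c3 * i3 + c4 * i4).
Proof.
  intros I0 I1 I2 I3 I4.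
  pose (P := fun f g i j => @is_RInt_plus R_NormedModule f g a b i j).
  pose (S := fun f c i => @is_RInt_scal R_NormedModule f a b c i).
  exact (P _ _ _ _ (P _ _ _ _ (P _ _ _ _ (P _ _ _ _ I0 (S _ c1 _ I1)) (S _ c2 _ I2)) (S _ c3 _ I3)) (S _ c4 _ I4)).
Qed.

Definition cI (c : nat) (g : curve) : C := cint g (fun w => Fc alpha beta c w * Qker w)%C.
Definition reI (g : curve) : H := mkH (fst (cI 0 g)) (fst (cI 1 g)) (fst (cI 2 g)) (fst (cI 3 g)).
Definition imI (g : curve) : H := mkH (snd (cI 0 g)) (snd (cI 1 g)) (snd (cI 2 g)) (snd (cI 3 g)).

(** A real-linear map of the quaternions given by the images of the basis. Multiplication by [J]
    from the left and from the right are both of this form, so the integration is done once. *)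
Definition comb (m0 m1 m2 m3 x : H) : H :=
  Hadd (Hscal (h0 x) m0) (Hadd (Hscal (h1 x) m1) (Hadd (Hscal (h2 x) m2) (Hscal (h3 x) m3))).

(** Each coordinate of [comb] mixes all four real parts. Splitting its integral needs their
    integrability, which [slice_Cauchy] supplies. *)
Lemma HRInt_slice (G : R -> H) g m0 m1 m2 m3 : In g l ->
  (forall t, 0 <= t <= 1 -> G t = Hadd (imX g t) (Hopp (comb m0 m1 m2 m3 (reX g t)))) ->
  HRInt G 0 1 = Hadd (imI g) (Hopp (comb m0 m1 m2 m3 (reI g))).
Proof.
  intros Hg HG.
  destruct (proj1 (slice_Cauchy 0 ltac:(lia)) g Hg) as [R0 I0].
  destruct (proj1 (slice_Cauchy 1 ltac:(lia)) g Hg) as [R1 I1].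
  destruct (proj1 (slice_Cauchy 2 ltac:(lia)) g Hg) as [R2 I2].
  destruct (proj1 (slice_Cauchy 3 ltac:(lia)) g Hg) as [R3 I3].
  fold (cI 0 g) in R0, I0. fold (cI 1 g) in R1, I1. fold (cI 2 g) in R2, I2. fold (cI 3 g) in R3, I3.
  assert (K : forall (h : H -> R) (i : R),
    (forall x y, h (Hadd x (Hopp y)) = h x - h y) ->
    (forall x, h (comb m0 m1 m2 m3 x) = h0 x * h m0 + h1 x * h m1 + h2 x * h m2 + h3 x * h m3) ->
    is_RInt (fun t => h (imX g t)) 0 1 i ->
    RInt (fun t => h (G t)) 0 1 = i + - h m0 * fst (cI 0 g) + - h m1 * fst (cI 1 g) + - h m2 * fst (cI 2 g) + - h m3 * fst (cI 3 g)).
  { intros h i E1 E2 Hi. apply is_RInt_unique.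
    refine (is_RInt_ext _ _ _ _ _ _ (is_RInt_lin5 _ _ _ _ _ _ _ _ _ _ _ _ _ _ _ _ Hi R0 R1 R2 R3)).
    intros t; segment; intros Ht. rewrite HG by lra. rewrite E1, E2.
    unfold reX, slice_form. cbn [h0 h1 h2 h3]. cbv beta.
    Req_type; ring. }
  unfold HRInt. apply H_ext.
  - refine (eq_trans (K h0 _ (fun _ _ => eq_refl) ltac:(intros; simpl; ring) I0) _). simpl. ring.
  - refine (eq_trans (K h1 _ (fun _ _ => eq_refl) ltac:(intros; simpl; ring) I1) _). simpl. ring.
  - refine (eq_trans (K h2 _ (fun _ _ => eq_refl) ltac:(intros; simpl; ring) I2) _). simpl. ring.
  - refine (eq_trans (K h3 _ (fun _ _ => eq_refl) ltac:(intros; simpl; ring) I3) _). simpl. ring.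
Qed.

Fixpoint Hsum (F : curve -> H) (l : list curve) : H :=
  match l with nil => mkH 0 0 0 0 | cons g l => Hadd (F g) (Hsum F l) end.

Lemma cycle_int_Hsum A B l' : cycle_int J A B l' = Hsum (curve_int J A B) l'.
Proof. induction l' as [|g l' IH]; simpl; [reflexivity|now rewrite IH]. Qed.

Lemma Hsum_slice (F : curve -> H) m0 m1 m2 m3 l' :
  (forall g, In g l' -> F g = Hadd (imI g) (Hopp (comb m0 m1 m2 m3 (reI g)))) ->
  Hsum F l' =
  let L := fun c => lint l' (fun w => Fc alpha beta c w * Qker w)%C in
  Hadd (mkH (snd (L 0%nat)) (snd (L 1%nat)) (snd (L 2%nat)) (snd (L 3%nat)))
    (Hopp (comb m0 m1 m2 m3 (mkH (fst (L 0%nat)) (fst (L 1%nat)) (fst (L 2%nat)) (fst (L 3%nat))))).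
Proof.
  induction l' as [|g l' IH]; intros HF.
  - apply H_ext; simpl; ring.
  - cbn [Hsum]. rewrite IH by (intros; apply HF; now right). rewrite HF by now left.
    unfold imI, reI, cI. cbn [lint]. cbv zeta.
    apply H_ext; cbn [h0 h1 h2 h3 Hadd Hopp comb Hscal fst snd Cplus]; unfold Cplus; cbn [fst snd]; ring.
Qed.

(** Summed over the cycle, the complex integrals equal [2 pi i] times the real numbers [Gr]. Their
    real parts vanish, so [comb], and with it [J], disappears; the imaginary parts [2 pi Gr] times
    [- 1 / pi] give [GH]. *)
Theorem slice_cycle_int A B m0 m1 m2 m3 :
  (forall g t, In g l -> 0 <= t <= 1 ->
    Hmul (Hmul (A (cpt J g t)) (dsJ J g t)) (B (cpt J g t)) =
    Hadd (imX g t) (Hopp (comb m0 m1 m2 m3 (reX g t)))) ->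
  Hscal (- / PI) (cycle_int J A B l) = GH alpha beta (h0 q) (rim q).
Proof.
  intros HAB. rewrite cycle_int_Hsum, (Hsum_slice _ m0 m1 m2 m3).
  - cbv beta zeta. rewrite !(fun c Hc => proj2 (slice_Cauchy c Hc)) by lia.
    assert (N := PI_neq0). unfold GH.
    apply H_ext; simpl; field; assumption.
  - intros g Hg. unfold curve_int. apply HRInt_slice; [assumption|]. intros t Ht. now apply HAB.
Qed.
End Integral.

(** That the integrals depend neither on [U] nor on [J] is contained in the equations, whose left
    sides mention neither of them. *)
Theorem theorem4p16 :
  forall (W : H -> Prop), H_open W -> axially_symmetric W ->
  (* (1) left slice hyperholomorphic *)
  (forall f : H -> H, left_slice_hyperholomorphic W f ->
     H_harmonic W (FueterL f) /\
     forall U : H -> Prop, slice_Cauchy_domain U ->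
       (forall q, H_closure U q -> W q) ->
       forall J (l : list curve), in_S J -> pos_oriented_boundary U J l ->
       forall q, U q ->
         FueterL f q = Hscal (- / PI) (cycle_int J (Qcs_inv q) f l)) /\
  (* (2) right slice hyperholomorphic *)
  (forall f : H -> H, right_slice_hyperholomorphic W f ->
     H_harmonic W (FueterR f) /\
     forall U : H -> Prop, slice_Cauchy_domain U ->
       (forall q, H_closure U q -> W q) ->
       forall J (l : list curve), in_S J -> pos_oriented_boundary U J l ->
       forall q, U q ->
         FueterR f q = Hscal (- / PI) (cycle_int J f (Qcs_inv q) l)).
Proof.
  intros W HWo HWs. split; intros f (_ & _ & alpha & beta & SC & Hf).
  - assert (E := FueterL_slice W alpha beta HWo HWs SC f Hf).
    split; [now apply (slice_harmonic W alpha beta)|].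
    intros U HU HUW J l HJ Hl q Hq. rewrite E by (now apply (subset_closure W U)).
    symmetry. apply (slice_cycle_int W alpha beta HWo HWs SC U J l q HU HUW HJ Hl Hq _ _
      (Hmul J (He 0)) (Hmul J (He 1)) (Hmul J (He 2)) (Hmul J (He 3))).
    intros g t Hg Ht. rewrite (integrand_left W alpha beta U J l q HU HUW HJ Hl Hq f g t Hf Hg Ht).
    f_equal. f_equal. apply H_ext; simpl; ring.
  - assert (E := FueterR_slice W alpha beta HWo HWs SC f Hf).
    split; [now apply (slice_harmonic W alpha beta)|].
    intros U HU HUW J l HJ Hl q Hq. rewrite E by (now apply (subset_closure W U)).
    symmetry. apply (slice_cycle_int W alpha beta HWo HWs SC U J l q HU HUW HJ Hl Hq _ _
      (Hmul (He 0) J) (Hmul (He 1) J) (Hmul (He 2) J) (Hmul (He 3) J)).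
    intros g t Hg Ht. rewrite (integrand_right W alpha beta U J l q HU HUW HJ Hl Hq f g t Hf Hg Ht).
    f_equal. f_equal. apply H_ext; simpl; ring.
Qed.
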